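(* Let $k$ be a field of characteristic $0$. When restricting to irreducible cocommutative Hopf algebras over $k$, the notions of crossed module of Hopf algebras and of $\mathrm{cat}^1$-Hopf algebra are equivalent: the category of crossed modules of Hopf algebras $\gamma:B\to H$ with $B,H$ irreducible cocommutative is equivalent to the category of $\mathrm{cat}^1$-Hopf algebras $(A,H,s,t,e)$ with $A,H$ irreducible cocommutative.
   Context: A Hopf algebra is irreducible if any two nonzero subcoalgebras intersect nontrivially (equivalently, $k\cdot 1$ is its unique simple subcoalgebra). A crossed module of Hopf algebras is a morphism of Hopf algebras $\gamma:B\to H$ with a left $H$-module structure on $B$ such that (i) $B$ is an $H$-module algebra and an $H$-module coalgebra; (ii) $\gamma(h\cdot b)=\sum h_1\gamma(b)S_H(h_2)$; (iii) $\gamma(b)\cdot b'=\sum b_1b'S_B(b_2)$ (Sweedler notation). A morphism to $\gamma':B'\to H'$ is a pair of Hopf algebra morphisms $\rho:B\to B'$, $\sigma:H\to H'$ with $\gamma'\rho=\sigma\gamma$ and $\rho(h\cdot b)=\sigma(h)\cdot\rho(b)$. In the cocommutative setting, a $\mathrm{cat}^1$-Hopf algebra (Hopf $2$-algebra) consists of Hopf algebras $A$, $H$ and Hopf algebra morphisms $s,t:A\to H$, $e:H\to A$ with $s\circ e=t\circ e=\mathrm{id}_H$, together with a composition $m:A\,\square_H A\to A$ which is a morphism of Hopf algebras, such that these data form a category object (objects $H$, arrows $A$, source $s$, target $t$, identities $e$, composition $m$) in the category of cocommutative Hopf algebras; here $A\,\square_H A$ is the cotensor product, i.e. the fibre product of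 $t$ and $s$ over $H$ in cocommutative Hopf algebras. Morphisms are pairs of Hopf algebra morphisms ($A\to A'$, $H\to H'$) commuting with $s,t,e,m$. *)

(* Defs.v *)
From HB Require Import structures.
From mathcomp Require Import all_boot all_order all_algebra.
From mathcomp Require Import boolp.

Set Implicit Arguments.
Unset Strict Implicit.
Unset Printing Implicit Defensive.

Import GRing.Theory.
Local Open Scope ring_scope.
Local Open Scope quotient_scope.

Notation bilinear f := (bilinear_for *:%R *:%R f).

(* The formal sum [:: (a1, b1); ...; (an, bn)] stands for                   *)
(* a1 (x) b1 + ... + an (x) bn, and [tens_rel] is the congruence generated  *)
(* by biadditivity and by c a (x) b = a (x) c b.  No formal scalars are     *)
(* needed: c (a (x) b) is represented by [:: (c *: a, b)].                  *)
Inductive tens_rel (k : fieldType) (A B : lmodType k) :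
    seq (A * B) -> seq (A * B) -> Prop :=
| tens_rel_refl s : tens_rel s s
| tens_rel_sym s t : tens_rel s t -> tens_rel t s
| tens_rel_trans s t u : tens_rel s t -> tens_rel t u -> tens_rel s u
| tens_rel_cat s s' t t' :
    tens_rel s s' -> tens_rel t t' -> tens_rel (s ++ t) (s' ++ t')
| tens_rel_catC s t : tens_rel (s ++ t) (t ++ s)
| tens_rel0 b : tens_rel [:: (0, b)] [::]
| tens_relDl a a' b : tens_rel [:: (a + a', b)] [:: (a, b); (a', b)]
| tens_relDr a b b' : tens_rel [:: (a, b + b')] [:: (a, b); (a, b')]
| tens_relZ (c : k) a b : tens_rel [:: (c *: a, b)] [:: (a, c *: b)].

Section TensorProduct.
Variables (k : fieldType) (A B : lmodType k).
Implicit Types (s t : seq (A * B)) (c : k).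

Definition tens_equiv s t : bool := `[< tens_rel s t >].

Lemma tens_equiv_refl : reflexive tens_equiv.
Proof. by move=> s; apply/asboolP; exact: tens_rel_refl. Qed.

Lemma tens_equiv_sym : symmetric tens_equiv.
Proof.
by move=> s t; apply/asboolP/asboolP => h; exact: tens_rel_sym.
Qed.

Lemma tens_equiv_trans : transitive tens_equiv.
Proof.
move=> t s u /asboolP h1 /asboolP h2; apply/asboolP.
exact: tens_rel_trans h1 h2.
Qed.

Canonical tens_equiv_rel :=
  EquivRel tens_equiv tens_equiv_refl tens_equiv_sym tens_equiv_trans.

Definition tensor : Type := {eq_quot tens_equiv_rel}.
HB.instance Definition _ := Choice.on tensor.
HB.instance Definition _ := Quotient.on tensor.

Definition tens (a : A) (b : B) : tensor := \pi_tensor [:: (a, b)].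

Lemma tens_piP s t : \pi_tensor s = \pi_tensor t <-> tens_rel s t.
Proof.
split=> [h|h]; first by have /eqmodP/asboolP := h.
by apply/eqmodP/asboolP.
Qed.

Lemma tens_repr (x : tensor) s : x = \pi_tensor s -> tens_rel (repr x) s.
Proof. by move=> h; apply/tens_piP; rewrite reprK. Qed.

Definition tens_scale_seq c s := [seq (c *: p.1, p.2) | p <- s].

Definition tens_zero : tensor := \pi_tensor [::].
Definition tens_add (x y : tensor) : tensor := \pi_tensor (repr x ++ repr y).
Definition tens_scale c (x : tensor) : tensor :=
  \pi_tensor (tens_scale_seq c (repr x)).
Definition tens_opp (x : tensor) : tensor := tens_scale (-1) x.

Lemma tens_rel_scale c s t :
  tens_rel s t -> tens_rel (tens_scale_seq c s) (tens_scale_seq c t).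
Proof.
elim=> {s t} /=.
- by move=> s; exact: tens_rel_refl.
- by move=> s t _ h; exact: tens_rel_sym.
- by move=> s t u _ h _ h'; exact: tens_rel_trans h h'.
- move=> s s' t t' _ h _ h'; rewrite /tens_scale_seq !map_cat.
  exact: tens_rel_cat.
- move=> s t; rewrite /tens_scale_seq !map_cat; exact: tens_rel_catC.
- by move=> b; rewrite scaler0; exact: tens_rel0.
- by move=> a a' b; rewrite scalerDr; exact: tens_relDl.
- by move=> a b b'; exact: tens_relDr.
- by move=> d a b; rewrite scalerA mulrC -scalerA; exact: tens_relZ.
Qed.

Lemma tens_addE s t :
  tens_add (\pi_tensor s) (\pi_tensor t) = \pi_tensor (s ++ t).
Proof.
by apply/tens_piP; apply: tens_rel_cat; exact: tens_repr.
Qed.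

Lemma tens_scaleE c s :
  tens_scale c (\pi_tensor s) = \pi_tensor (tens_scale_seq c s).
Proof. by apply/tens_piP; apply: tens_rel_scale; exact: tens_repr. Qed.

Lemma tens_addA : associative tens_add.
Proof.
move=> x y z; rewrite -[x]reprK -[y]reprK -[z]reprK.
rewrite (tens_addE (repr y)) (tens_addE (repr x)) (tens_addE (repr x)) tens_addE.
by rewrite catA.
Qed.

Lemma tens_addC : commutative tens_add.
Proof.
move=> x y; rewrite -[x]reprK -[y]reprK !tens_addE.
by apply/tens_piP; exact: tens_rel_catC.
Qed.

Lemma tens_add0 : left_id tens_zero tens_add.
Proof. by move=> x; rewrite -[x]reprK tens_addE. Qed.

Lemma tens_scaleA a c (x : tensor) :
  tens_scale a (tens_scale c x) = tens_scale (a * c) x.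
Proof.
rewrite -[x]reprK (tens_scaleE c) (tens_scaleE a) (tens_scaleE (a * c)).
rewrite /tens_scale_seq -map_comp; congr (\pi_tensor _).
by apply: eq_map => p /=; rewrite scalerA.
Qed.

Lemma tens_scale1 : left_id 1 tens_scale.
Proof.
move=> x; rewrite -[x]reprK tens_scaleE; congr (\pi_tensor _).
by rewrite /tens_scale_seq -[RHS]map_id; apply: eq_map => -[a b] /=; rewrite scale1r.
Qed.

Lemma tens_scaleDr : right_distributive tens_scale tens_add.
Proof.
move=> c x y; rewrite -[x]reprK -[y]reprK tens_addE.
rewrite (tens_scaleE c (repr x)) (tens_scaleE c (repr y)) tens_scaleE tens_addE.
by rewrite /tens_scale_seq map_cat.
Qed.

Lemma tens_scaleDl (x : tensor) :
  {morph tens_scale^~ x : a b / a + b >-> tens_add a b}.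
Proof.
move=> a c; rewrite -[x]reprK (tens_scaleE a) (tens_scaleE c) tens_scaleE tens_addE.
apply/tens_piP.
elim: (repr x) => [|[u v] s IHs] /=; first exact: tens_rel_refl.
rewrite -cat1s -[X in tens_rel _ X]cat1s.
apply: tens_rel_trans (tens_rel_cat _ IHs) _.
  rewrite scalerDl; exact: tens_relDl.
rewrite -[[:: _; _]](cat1s _ [:: _]) -catA.
apply: tens_rel_cat; first exact: tens_rel_refl.
rewrite catA -[X in tens_rel _ (_ ++ X)]cat1s catA.
apply: tens_rel_cat; first exact: tens_rel_catC.
exact: tens_rel_refl.
Qed.

Lemma tens_scale0 (x : tensor) : tens_scale 0 x = tens_zero.
Proof.
rewrite -[x]reprK tens_scaleE; apply/tens_piP.
elim: (repr x) => [|[u v] s IHs] /=; first exact: tens_rel_refl.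
rewrite -cat1s -[[::]]/([::] ++ [::]); apply: tens_rel_cat => //.
rewrite scale0r; exact: tens_rel0.
Qed.

Lemma tens_addN : left_inverse tens_zero tens_opp tens_add.
Proof.
move=> x; rewrite /tens_opp -{2}[x]tens_scale1 -tens_scaleDl addNr.
exact: tens_scale0.
Qed.

HB.instance Definition _ :=
  GRing.isZmodule.Build tensor tens_addA tens_addC tens_add0 tens_addN.
HB.instance Definition _ := GRing.Zmodule_isLmodule.Build k tensor
  tens_scaleA tens_scale1 tens_scaleDr tens_scaleDl.

(* For bilinear f, the linear map a (x) b |-> f a b.  It is defined by      *)
(* summing f over a chosen representative, so it has no meaning when f is   *)
(* not bilinear; see [tens_lift_tens] and [tens_lift_is_linear].            *)
Definition tens_lift (V : zmodType) (f : A -> B -> V) (x : tensor) : V :=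
  \sum_(p <- repr x) f p.1 p.2.

Section Universal.
Variables (V : lmodType k) (f : A -> B -> V).
Hypothesis fbil : bilinear f.

Lemma tens_rel_lift s t : tens_rel s t ->
  \sum_(p <- s) f p.1 p.2 = \sum_(p <- t) f p.1 p.2.
Proof.
have [fl fr] := fbil.
have fDl b : {morph f^~ b : u v / u + v}.
  by move=> u v; have := fl b 1 u v; rewrite /= !scale1r => ->.
have fDr a : {morph f a : u v / u + v}.
  by move=> u v; have := fr a 1 u v; rewrite /= !scale1r => ->.
have f0l b : f 0 b = 0 by apply: (addrI (f 0 b)); rewrite -fDl !addr0.
have f0r a : f a 0 = 0 by apply: (addrI (f a 0)); rewrite -fDr !addr0.
elim=> {s t} //=.
- by move=> s t u _ -> _ ->.
- by move=> s s' t t' _ h _ h'; rewrite !big_cat /= h h'.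
- by move=> s t; rewrite !big_cat /= addrC.
- by move=> b; rewrite big_seq1 big_nil f0l.
- by move=> a a' b; rewrite big_seq1 big_cons big_seq1 /= fDl.
- by move=> a b b'; rewrite big_seq1 big_cons big_seq1 /= fDr.
- move=> c a b; rewrite !big_seq1 /=.
  have := fl b c a 0; have := fr a c b 0.
  by rewrite !addr0 f0l f0r !addr0 => -> ->.
Qed.

Lemma tens_lift_pi s :
  tens_lift f (\pi_tensor s) = \sum_(p <- s) f p.1 p.2.
Proof. by apply: tens_rel_lift; exact: tens_repr. Qed.

Lemma tens_lift_tens a b : tens_lift f (tens a b) = f a b.
Proof. by rewrite tens_lift_pi big_seq1. Qed.

Lemma tens_lift_is_linear : linear (tens_lift f).
Proof.
move=> c x y; rewrite -[x]reprK -[y]reprK.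
rewrite [c *: _]tens_scaleE [_ + \pi_tensor _]tens_addE !tens_lift_pi.
rewrite big_cat /= big_map scaler_sumr; congr (_ + _).
apply: eq_bigr => -[a b] _ /=.
have [fl fr] := fbil.
have f0 : f 0 b = 0.
  by have := fl b (-1) 0 0; rewrite /= scaler0 addr0 scaleN1r addNr.
by have := fl b c a 0; rewrite !addr0 f0 addr0.
Qed.
End Universal.

Lemma tens_bilinear : bilinear tens.
Proof.
split=> [b c a a'|a c b b'] /=.
  rewrite [c *: tens _ _]tens_scaleE [_ + tens _ _]tens_addE /=.
  by apply/tens_piP; exact: tens_relDl.
rewrite [c *: tens _ _]tens_scaleE [_ + tens _ _]tens_addE /=.
apply/tens_piP; apply: tens_rel_trans (tens_relDr _ _ _) _.
rewrite -cat1s -[X in tens_rel _ X]cat1s.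
apply: tens_rel_cat; last exact: tens_rel_refl.
by apply: tens_rel_sym; exact: tens_relZ.
Qed.

Lemma tensE (x : tensor) : x = \sum_(p <- repr x) tens p.1 p.2.
Proof.
rewrite -{1}[x]reprK; elim: (repr x) => [|[a b] s IHs]; first by rewrite big_nil.
by rewrite big_cons -IHs [RHS]tens_addE.
Qed.

End TensorProduct.

Notation "A \ot B" := (tensor A B) (at level 40, left associativity) : type_scope.
Notation "a \ot b" := (tens a b) (at level 40, left associativity) : ring_scope.

Lemma eq_tens_lift (k : fieldType) (A B : lmodType k) (V : zmodType)
    (f g : A -> B -> V) (x : (A \ot B)%type) :
  (forall a b, f a b = g a b) -> tens_lift f x = tens_lift g x.
Proof. by move=> fg; apply: eq_bigr. Qed.

Lemma tens_lift_sum (k : fieldType) (A B : lmodType k) (V W : zmodType)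
    (h : V -> W) (h0 : h 0 = 0) (hD : {morph h : u v / u + v})
    (f : A -> B -> V) (x : (A \ot B)%type) :
  h (tens_lift f x) = tens_lift (fun a b => h (f a b)) x.
Proof. exact: (big_morph h hD h0). Qed.

HB.mixin Record isCoalgebra (k : fieldType) C of GRing.Lmodule k C := {
  comul : {linear C -> (C \ot C)%type};
  counit : {scalar C};
  comulA : forall x : C,
    tens_lift (fun x1 x2 => tens_lift (fun y z => y \ot (z \ot x2)) (comul x1))
      (comul x)
    = tens_lift (fun x1 x2 => tens_lift (fun y z => x1 \ot (y \ot z)) (comul x2))
      (comul x);
  counitl : forall x : C, tens_lift (fun x1 x2 => counit x1 *: x2) (comul x) = x;
  counitr : forall x : C, tens_lift (fun x1 x2 => counit x2 *: x1) (comul x) = x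
}.

#[short(type="coalgType")]
HB.structure Definition Coalgebra (k : fieldType) :=
  {C of GRing.Lmodule k C & isCoalgebra k C}.

(* Sweedler's sum of E over the tensors x1 (x) x2 of the comultiplication   *)
(* of x; the summand E must be bilinear in x1 and x2.                       *)
Notation "\swe_ ( x1 , x2 <- x ) E" :=
  (tens_lift (fun x1 x2 => E) (comul x))
  (at level 41, x1 name, x2 name, x at level 50, E at level 41,
   format "'[' \swe_ ( x1 ,  x2  <-  x ) '/  '  E ']'") : ring_scope.

HB.mixin Record Coalgebra_isHopf (k : fieldType) H
    of GRing.Algebra k H & Coalgebra k H := {
  antipode : {linear H -> H};
  comulM : forall x y : H,
    comul (x * y) = \swe_(x1, x2 <- x) \swe_(y1, y2 <- y) (x1 * y1) \ot (x2 * y2);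
  comul1 : comul (1 : H) = 1 \ot 1;
  counitM : forall x y : H, counit (x * y) = counit x * counit y;
  counit1 : counit (1 : H) = 1;
  antipodel : forall x : H, \swe_(x1, x2 <- x) antipode x1 * x2 = counit x *: 1;
  antipoder : forall x : H, \swe_(x1, x2 <- x) x1 * antipode x2 = counit x *: 1
}.

#[short(type="hopfType")]
HB.structure Definition Hopf (k : fieldType) :=
  {H of GRing.Algebra k H & Coalgebra k H & Coalgebra_isHopf k H}.

Definition cocommutative (k : fieldType) (C : coalgType k) :=
  forall x : C, \swe_(x1, x2 <- x) x2 \ot x1 = comul x.

Definition subcoalgebra (k : fieldType) (C : coalgType k) (D : {pred C}) :=
  submod_closed D /\
  {in D, forall x, exists2 s : seq (C * C),
    {in s, forall p, p.1 \in D /\ p.2 \in D} &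
    comul x = \sum_(p <- s) p.1 \ot p.2}.

Definition irreducible (k : fieldType) (C : coalgType k) :=
  forall D E : {pred C},
    subcoalgebra D -> (exists2 x, x \in D & x != 0) ->
    subcoalgebra E -> (exists2 x, x \in E & x != 0) ->
    exists2 x, x \in D /\ x \in E & x != 0.

(* Compatibility with the antipodes is automatic. *)
Record hopf_hom (k : fieldType) (A B : hopfType k) := HopfHom {
  hopf_fun :> A -> B;
  hopf_hom_linear : linear hopf_fun;
  hopf_hom_monoid : monoid_morphism hopf_fun;
  hopf_hom_comul : forall x,
    comul (hopf_fun x) = \swe_(x1, x2 <- x) hopf_fun x1 \ot hopf_fun x2;
  hopf_hom_counit : forall x, counit (hopf_fun x) = counit x
}.

HB.instance Definition _ (k : fieldType) (A B : hopfType k)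
    (f : hopf_hom A B) :=
  GRing.isLinear.Build k A B *:%R (hopf_fun f) (hopf_hom_linear f).
HB.instance Definition _ (k : fieldType) (A B : hopfType k)
    (f : hopf_hom A B) :=
  GRing.isMonoidMorphism.Build A B (hopf_fun f) (hopf_hom_monoid f).

Section HopfHom.
Variable k : fieldType.
Implicit Types A B C : hopfType k.

Lemma hopf_homP A B (f g : hopf_hom A B) : f =1 g -> f = g.
Proof.
case: f g => [f f1 f2 f3 f4] [g g1 g2 g3 g4] /= /funext fg.
by subst g; congr HopfHom; exact: Prop_irrelevance.
Qed.

Lemma tens_map_bilinear A B (f : hopf_hom A B) :
  bilinear (fun x y : A => f x \ot f y).
Proof.
by split=> [y c x x'|x c y y']; rewrite linearP;
  [exact: (tens_bilinear B B).1 | exact: (tens_bilinear B B).2].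
Qed.

Definition hopf_id_def A := fun x : A => x.
Fact hopf_id_linear A : linear (@hopf_id_def A). Proof. by []. Qed.
Fact hopf_id_monoid A : monoid_morphism (@hopf_id_def A). Proof. by []. Qed.
Fact hopf_id_comul A (x : A) :
  comul (hopf_id_def x) = \swe_(x1, x2 <- x) hopf_id_def x1 \ot hopf_id_def x2.
Proof. exact: tensE. Qed.
Fact hopf_id_counit A (x : A) : counit (hopf_id_def x) = counit x.
Proof. by []. Qed.
Definition hopf_id A : hopf_hom A A :=
  HopfHom (@hopf_id_linear A) (@hopf_id_monoid A) (@hopf_id_comul A)
    (@hopf_id_counit A).

Section Comp.
Variables (A B C : hopfType k) (g : hopf_hom B C) (f : hopf_hom A B).
Definition hopf_comp_def := fun x : A => g (f x).
Fact hopf_comp_linear : linear hopf_comp_def.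
Proof. by move=> c x y; rewrite /hopf_comp_def !linearP. Qed.
Fact hopf_comp_monoid : monoid_morphism hopf_comp_def.
Proof. by split=> [|x y]; rewrite /hopf_comp_def ?rmorph1 ?rmorphM. Qed.
Fact hopf_comp_comul (x : A) :
  comul (hopf_comp_def x)
  = \swe_(x1, x2 <- x) hopf_comp_def x1 \ot hopf_comp_def x2.
Proof.
have gbil := tens_map_bilinear g.
have glin := tens_lift_is_linear gbil.
rewrite /hopf_comp_def hopf_hom_comul hopf_hom_comul.
rewrite (tens_lift_sum (h := tens_lift (fun y1 y2 => g y1 \ot g y2))).
- by apply: eq_tens_lift => a b; rewrite tens_lift_tens.
- by have := glin (-1) 0 0; rewrite /= scaler0 addr0 scaleN1r addNr.
- by move=> u v; have := glin 1 u v; rewrite /= !scale1r => ->.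
Qed.
Fact hopf_comp_counit (x : A) : counit (hopf_comp_def x) = counit x.
Proof. by rewrite /hopf_comp_def !hopf_hom_counit. Qed.
Definition hopf_comp : hopf_hom A C :=
  HopfHom hopf_comp_linear hopf_comp_monoid hopf_comp_comul hopf_comp_counit.
End Comp.
End HopfHom.

Section Actions.
Variables (k : fieldType) (H B : hopfType k) (act : H -> B -> B).

Definition hopf_module :=
  [/\ bilinear act, (forall b, act 1 b = b) &
      forall g h b, act (g * h) b = act g (act h b)].

Definition module_algebra :=
  (forall h a b, act h (a * b) = \swe_(h1, h2 <- h) act h1 a * act h2 b) /\
  (forall h, act h 1 = counit h *: 1).

Definition module_coalgebra :=
  (forall h b, comul (act h b)
     = \swe_(h1, h2 <- h) \swe_(b1, b2 <- b) act h1 b1 \ot act h2 b2) /\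
  (forall h b, counit (act h b) = counit h * counit b).
End Actions.

Record crossed_module (k : fieldType) := CrossedModule {
  xm_top : hopfType k;
  xm_base : hopfType k;
  xm_map : hopf_hom xm_top xm_base;
  xm_act : xm_base -> xm_top -> xm_top;
  xm_module : hopf_module xm_act;
  xm_module_algebra : module_algebra xm_act;
  xm_module_coalgebra : module_coalgebra xm_act;
  xm_equivariant : forall h b,
    xm_map (xm_act h b) = \swe_(h1, h2 <- h) h1 * xm_map b * antipode h2;
  xm_peiffer : forall b b',
    xm_act (xm_map b) b' = \swe_(b1, b2 <- b) b1 * b' * antipode b2
}.

Record crossed_module_hom (k : fieldType) (X Y : crossed_module k) :=
  CrossedModuleHom {
  xmh_top : hopf_hom (xm_top X) (xm_top Y);
  xmh_base : hopf_hom (xm_base X) (xm_base Y);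
  xmh_map : forall b, xm_map Y (xmh_top b) = xmh_base (xm_map X b);
  xmh_act : forall h b,
    xmh_top (@xm_act k X h b) = @xm_act k Y (xmh_base h) (xmh_top b)
}.

Section CrossedModuleHom.
Variable k : fieldType.

Lemma crossed_module_homP (X Y : crossed_module k)
    (f g : crossed_module_hom X Y) :
  xmh_top f = xmh_top g -> xmh_base f = xmh_base g -> f = g.
Proof.
case: f g => [f1 f0 fm fa] [g1 g0 gm ga] /= e1 e0; subst g1 g0.
by congr CrossedModuleHom; exact: Prop_irrelevance.
Qed.

Definition crossed_module_id (X : crossed_module k) : crossed_module_hom X X :=
  @CrossedModuleHom k X X (hopf_id _) (hopf_id _) (fun _ => erefl)
    (fun _ _ => erefl).

Section Comp.
Variables (X Y Z : crossed_module k).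
Variables (g : crossed_module_hom Y Z) (f : crossed_module_hom X Y).
Fact crossed_module_comp_map b :
  xm_map Z (hopf_comp (xmh_top g) (xmh_top f) b)
  = hopf_comp (xmh_base g) (xmh_base f) (xm_map X b).
Proof. by rewrite /= /hopf_comp_def !xmh_map. Qed.
Fact crossed_module_comp_act h b :
  hopf_comp (xmh_top g) (xmh_top f) (@xm_act k X h b)
  = @xm_act k Z (hopf_comp (xmh_base g) (xmh_base f) h)
      (hopf_comp (xmh_top g) (xmh_top f) b).
Proof. by rewrite /= /hopf_comp_def !xmh_act. Qed.
Definition crossed_module_comp : crossed_module_hom X Z :=
  CrossedModuleHom crossed_module_comp_map crossed_module_comp_act.
End Comp.
End CrossedModuleHom.

Record category := Category {
  ob :> Type;
  hom : ob -> ob -> Type;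
  idm : forall X, hom X X;
  comp : forall X Y Z, hom Y Z -> hom X Y -> hom X Z;
  comp1m : forall X Y (f : hom X Y), comp (idm Y) f = f;
  compm1 : forall X Y (f : hom X Y), comp f (idm X) = f;
  compA : forall W X Y Z (h : hom Y Z) (g : hom X Y) (f : hom W X),
    comp h (comp g f) = comp (comp h g) f
}.

Arguments hom {c} X Y.
Arguments idm {c} X.
Arguments comp {c X Y Z} g f.

Declare Scope category_scope.
Delimit Scope category_scope with cat.
Local Open Scope category_scope.
Notation "g \oc f" := (comp g f) (at level 40, left associativity) : category_scope.

Record functor (C D : category) := Functor {
  fob :> C -> D;
  fmap : forall X Y : C, hom X Y -> hom (fob X) (fob Y);
  fmap1 : forall X : C, fmap (idm X) = idm (fob X);
  fmapM : forall (X Y Z : C) (g : hom Y Z) (f : hom X Y),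
    fmap (g \oc f) = fmap g \oc fmap f
}.

Definition functor_id (C : category) : functor C C :=
  @Functor C C id (fun _ _ f => f) (fun _ => erefl) (fun _ _ _ _ _ => erefl).

Section FunctorComp.
Variables (C D E : category) (G : functor D E) (F : functor C D).
Fact functor_comp1 (X : C) : fmap G (fmap F (idm X)) = idm (G (F X)).
Proof. by rewrite !fmap1. Qed.
Fact functor_compM (X Y Z : C) (g : hom Y Z) (f : hom X Y) :
  fmap G (fmap F (g \oc f)) = fmap G (fmap F g) \oc fmap G (fmap F f).
Proof. by rewrite !fmapM. Qed.
Definition functor_comp : functor C E :=
  @Functor C E (fun X => G (F X)) (fun X Y f => fmap G (fmap F f))
    functor_comp1 functor_compM.
End FunctorComp.

Definition naturally_isomorphic (C D : category) (F G : functor C D) : Prop :=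
  exists (eta : forall X : C, hom (F X) (G X))
         (theta : forall X : C, hom (G X) (F X)),
    [/\ forall (X Y : C) (f : hom X Y), eta Y \oc fmap F f = fmap G f \oc eta X,
        forall X : C, theta X \oc eta X = idm (F X) &
        forall X : C, eta X \oc theta X = idm (G X)].

Definition equivalent_categories (C D : category) : Prop :=
  exists (F : functor C D) (G : functor D C),
    naturally_isomorphic (functor_comp G F) (functor_id C) /\
    naturally_isomorphic (functor_comp F G) (functor_id D).

Section FullSubcategory.
Variables (C : category) (P : C -> Prop).
Definition full_subcategory : category :=
  @Category {X : C | P X} (fun X Y => hom (sval X) (sval Y))
    (fun X => idm (sval X)) (fun X Y Z g f => g \oc f)
    (fun X Y f => comp1m f) (fun X Y f => compm1 f)
    (fun W X Y Z h g f => compA h g f).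
End FullSubcategory.

Definition is_pullback (C : category) (X Y Z P : C) (f : hom X Z) (g : hom Y Z)
    (p1 : hom P X) (p2 : hom P Y) : Prop :=
  f \oc p1 = g \oc p2 /\
  forall (Q : C) (u : hom Q X) (v : hom Q Y), f \oc u = g \oc v ->
    exists! w : hom Q P, p1 \oc w = u /\ p2 \oc w = v.

(* A category object in C.  The object [co_pairs] of composable pairs is    *)
(* the fibre product of t and s, a pair (a, a') with t a = s a' being       *)
(* composed to an arrow from s a to t a'.  The unit and associativity       *)
(* axioms are stated on generalized elements: [x : hom Q co_pairs] is the   *)
(* pair (p1 x, p2 x) of Q-points of the object of arrows, and q1, q2 in     *)
(* [co_assoc] range over the Q-points of the object of composable triples.  *)
Record category_object (C : category) := CategoryObject {
  co_arr : C;
  co_obj : C;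
  co_src : hom co_arr co_obj;
  co_tgt : hom co_arr co_obj;
  co_unit : hom co_obj co_arr;
  co_pairs : C;
  co_p1 : hom co_pairs co_arr;
  co_p2 : hom co_pairs co_arr;
  co_comp : hom co_pairs co_arr;
  co_pairsP : is_pullback co_tgt co_src co_p1 co_p2;
  co_src_unit : co_src \oc co_unit = idm co_obj;
  co_tgt_unit : co_tgt \oc co_unit = idm co_obj;
  co_src_comp : co_src \oc co_comp = co_src \oc co_p1;
  co_tgt_comp : co_tgt \oc co_comp = co_tgt \oc co_p2;
  co_unitl : forall x : hom co_arr co_pairs,
    co_p1 \oc x = co_unit \oc co_src -> co_p2 \oc x = idm co_arr ->
    co_comp \oc x = idm co_arr;
  co_unitr : forall x : hom co_arr co_pairs,
    co_p1 \oc x = idm co_arr -> co_p2 \oc x = co_unit \oc co_tgt ->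
    co_comp \oc x = idm co_arr;
  co_assoc : forall (Q : C) (q1 q2 l r : hom Q co_pairs),
    co_p2 \oc q1 = co_p1 \oc q2 ->
    co_p1 \oc l = co_comp \oc q1 -> co_p2 \oc l = co_p2 \oc q2 ->
    co_p1 \oc r = co_p1 \oc q1 -> co_p2 \oc r = co_comp \oc q2 ->
    co_comp \oc l = co_comp \oc r
}.

(* In [coh_comp], x is the unique morphism induced by [coh_arr] between the *)
(* objects of composable pairs.                                             *)
Record category_object_hom (C : category) (X Y : category_object C) :=
  CategoryObjectHom {
  coh_arr : hom (co_arr X) (co_arr Y);
  coh_obj : hom (co_obj X) (co_obj Y);
  coh_src : co_src Y \oc coh_arr = coh_obj \oc co_src X;
  coh_tgt : co_tgt Y \oc coh_arr = coh_obj \oc co_tgt X;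
  coh_unit : coh_arr \oc co_unit X = co_unit Y \oc coh_obj;
  coh_comp : forall x : hom (co_pairs X) (co_pairs Y),
    co_p1 Y \oc x = coh_arr \oc co_p1 X -> co_p2 Y \oc x = coh_arr \oc co_p2 X ->
    coh_arr \oc co_comp X = co_comp Y \oc x
}.

Section CategoryObjectHom.
Variable C : category.

Lemma category_object_homP (X Y : category_object C)
    (f g : category_object_hom X Y) :
  coh_arr f = coh_arr g -> coh_obj f = coh_obj g -> f = g.
Proof.
case: f g => [f1 f0 fs ft fe fm] [g1 g0 gs gt ge gm] /= e1 e0; subst g1 g0.
by congr CategoryObjectHom; exact: Prop_irrelevance.
Qed.

Section Id.
Variable X : category_object C.
Fact category_object_id_ax (Y Z : C) (f : hom Y Z) : f \oc idm Y = idm Z \oc f.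
Proof. by rewrite comp1m compm1. Qed.
Fact category_object_id_comp (x : hom (co_pairs X) (co_pairs X)) :
  co_p1 X \oc x = idm _ \oc co_p1 X -> co_p2 X \oc x = idm _ \oc co_p2 X ->
  idm _ \oc co_comp X = co_comp X \oc x.
Proof.
rewrite !comp1m => x1 x2; have [eqp /(_ _ _ _ eqp)[w [_ wu]]] := co_pairsP X.
have <- : w = x by exact: wu.
by rewrite (wu (idm _)) ?compm1.
Qed.
Definition category_object_id : category_object_hom X X :=
  CategoryObjectHom (category_object_id_ax _) (category_object_id_ax _)
    (esym (category_object_id_ax _)) category_object_id_comp.
End Id.

Section Comp.
Variables (X Y Z : category_object C).
Variables (g : category_object_hom Y Z) (f : category_object_hom X Y).
Let h1 := coh_arr g \oc coh_arr f.
Let h0 := coh_obj g \oc coh_obj f.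
Fact category_object_comp_src : co_src Z \oc h1 = h0 \oc co_src X.
Proof. by rewrite /h1 compA coh_src -compA coh_src compA. Qed.
Fact category_object_comp_tgt : co_tgt Z \oc h1 = h0 \oc co_tgt X.
Proof. by rewrite /h1 compA coh_tgt -compA coh_tgt compA. Qed.
Fact category_object_comp_unit : h1 \oc co_unit X = co_unit Z \oc h0.
Proof. by rewrite /h1 -compA coh_unit compA coh_unit -compA. Qed.

Lemma category_object_hom_pairs (U V : category_object C)
    (u : category_object_hom U V) :
  exists x : hom (co_pairs U) (co_pairs V),
    co_p1 V \oc x = coh_arr u \oc co_p1 U /\ co_p2 V \oc x = coh_arr u \oc co_p2 U.
Proof.
have [_ /(_ _ (coh_arr u \oc co_p1 U) (coh_arr u \oc co_p2 U))[]] := co_pairsP V.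
  by rewrite !compA coh_tgt coh_src -!compA (co_pairsP U).1.
by move=> x [[x1 x2] _]; exists x.
Qed.

Fact category_object_comp_comp (x : hom (co_pairs X) (co_pairs Z)) :
  co_p1 Z \oc x = h1 \oc co_p1 X -> co_p2 Z \oc x = h1 \oc co_p2 X ->
  h1 \oc co_comp X = co_comp Z \oc x.
Proof.
move=> x1 x2.
have [u [u1 u2]] := category_object_hom_pairs f.
have [v [v1 v2]] := category_object_hom_pairs g.
have -> : x = v \oc u.
  have e1 : co_p1 Z \oc (v \oc u) = h1 \oc co_p1 X.
    by rewrite compA v1 -compA u1 compA.
  have e2 : co_p2 Z \oc (v \oc u) = h1 \oc co_p2 X.
    by rewrite compA v2 -compA u2 compA.
  have [_ /(_ _ (h1 \oc co_p1 X) (h1 \oc co_p2 X))[]] := co_pairsP Z.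
    by rewrite -x1 -x2 !compA (co_pairsP Z).1.
  by move=> w [_ wu]; rewrite -(wu x) // -(wu (v \oc u)).
by rewrite /h1 -compA (coh_comp u1 u2) compA (coh_comp v1 v2) compA.
Qed.
Definition category_object_comp : category_object_hom X Z :=
  CategoryObjectHom category_object_comp_src category_object_comp_tgt
    category_object_comp_unit category_object_comp_comp.
End Comp.

Definition category_objects : category.
Proof.
refine (@Category (category_object C) (@category_object_hom C)
  category_object_id category_object_comp _ _ _) => *;
apply: category_object_homP => /=; by [exact: comp1m | exact: compm1 | exact: compA].
Defined.
End CategoryObjectHom.

Section Categories.
Variable k : fieldType.

Definition hopf_algebras : category.
Proof.
refine (@Category (hopfType k) (@hopf_hom k) (@hopf_id k) (@hopf_comp k) _ _ _)
  => *; exact: hopf_homP.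
Defined.

Definition cocomm_hopf_algebras : category :=
  @full_subcategory hopf_algebras (fun A => cocommutative (A : hopfType k)).

Definition crossed_modules : category.
Proof.
refine (@Category (crossed_module k) (@crossed_module_hom k)
  (@crossed_module_id k) (@crossed_module_comp k) _ _ _) => *;
apply: crossed_module_homP => /=; exact: hopf_homP.
Defined.

(* The fibre product of t and s in cocommutative Hopf algebras is the       *)
(* cotensor product of A with itself over H, so [co_comp] is a morphism of  *)
(* Hopf algebras from this cotensor product to A.                           *)
Definition cat1_hopf_algebras : category := category_objects cocomm_hopf_algebras.

Definition irr_cocomm_crossed_modules : category :=
  @full_subcategory crossed_modules (fun X : crossed_module k =>
    [/\ cocommutative (xm_top X), cocommutative (xm_base X),
        irreducible (xm_top X) & irreducible (xm_base X)]).

Definition irr_cat1_hopf_algebras : category :=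
  @full_subcategory cat1_hopf_algebras
    (fun X : category_object cocomm_hopf_algebras =>
      irreducible (sval (co_arr X) : hopfType k) /\
      irreducible (sval (co_obj X) : hopfType k)).
End Categories.

(* Main.v *)
From HB Require Import structures.
From mathcomp Require Import all_boot all_order all_algebra.
From mathcomp Require Import boolp.
From mathcomp Require classical_sets.
Require Import Defs.

(** A cocommutative Hopf algebra is a group object in the category of
cocommutative coalgebras, whose products are the tensor products. So for every
cocommutative coalgebra C the coalgebra morphisms from C to A, the C-points of
A, form a group under convolution ([pt]), and a Hopf algebra morphism is the
same thing as a family of group homomorphisms between the groups of points,
natural in C ([mkhom]). Conversely a coalgebra with natural group structures on
its points is a Hopf algebra ([represent]). An identity between elements that
involves Sweedler sums is the value of an identity between points at universal
points, namely the projections of a tensor product. This turns the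
theorem into the classical equivalence between crossed modules of groups and
categories internal to groups, which is proved by computing with points.

From a crossed module g : B -> H one forms the semidirect product A of B by H
([smash_splitext]), with s (b, h) = h, t (b, h) = g(b) h and e h = (1, h). From
a category object one takes the kernel B of s ([kernel_splitext]), the
restriction of t to B, and the action h.b = e(h) b e(h)^-1. Both constructions
meet in the notion of [cat1_datum]: a split extension B -> A -> H with a second
retraction t of e such that e(t a) b e(t a)^-1 = a b a^-1 for b in B.

- In a category object the unit laws force the composite of (a, a') to be
  a' e(s a')^-1 a ([category_compE]), and since composition is a homomorphism
  the identity above follows ([category_peiffer]). Conversely that identity makes
  the formula a homomorphism ([datum_pairs]). In particular a morphism that
  respects s, t and e respects composition ([cat1_hom]).
- The fibre product of t and s is taken among Hopf algebras, so its universal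
  property says nothing directly about its points. It is however isomorphic
  to the semidirect product of the kernel of s by the arrows ([pullback_ex]),
  hence a point of it is determined by its two projections ([pullback_mono]).
- As a coalgebra the semidirect product is the tensor product of B and H, and
  the tensor product of two irreducible cocommutative coalgebras with grouplike
  elements is irreducible ([tens_irreducible]). The kernel embeds in A as a coalgebra and
  so inherits irreducibility ([irreducible_inj]). *)

Set Implicit Arguments.
Unset Strict Implicit.
Unset Printing Implicit Defensive.

Import GRing.Theory.
Local Open Scope ring_scope.

(** * Linear maps on tensor products *)

Section Linear.
Variable k : fieldType.
Implicit Types U V W A B C D : lmodType k.

(** [linear], [scalar] and [bilinear] are notations that carry scaling laws to
be inferred. Opaque heads let proofs of linearity be found by the shape of the
function alone. *)
Definition lin V W (f : V -> W) : Prop := linear f.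

Definition sca V (f : V -> k) : Prop := scalar f.

Definition bil A B V (E : A -> B -> V) : Prop :=
  (forall b, lin (E^~ b)) /\ (forall a, lin (E a)).

Lemma bilE A B V (E : A -> B -> V) : bil E -> bilinear E.
Proof. by move=> [h1 h2]; split=> [b c x y|a c x y]; [exact: h1 | exact: h2]. Qed.

Lemma lin_id V : lin (fun x : V => x). Proof. by []. Qed.

Lemma lin_comp U V W (g : V -> W) (f : U -> V) :
  lin g -> lin f -> lin (fun x => g (f x)).
Proof. by move=> hg hf c x y; rewrite hf hg. Qed.

Lemma lin_scale U V (f : U -> V) a : lin f -> lin (fun x => a *: f x).
Proof. by move=> hf c x y; rewrite hf scalerDr !scalerA mulrC. Qed.

Lemma lin_scalar U V (f : U -> k) (v : V) : sca f -> lin (fun x => f x *: v).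
Proof. by move=> hf c x y; rewrite hf scalerDl scalerA. Qed.

Lemma lin_tensl U A B (f : U -> A) (b : B) : lin f -> lin (fun x => f x \ot b).
Proof. by move=> hf c x y; rewrite hf; exact: (tens_bilinear A B).1. Qed.

Lemma lin_tensr U A B (f : U -> B) (a : A) : lin f -> lin (fun x => a \ot f x).
Proof. by move=> hf c x y; rewrite hf; exact: (tens_bilinear A B).2. Qed.

Lemma lin_lift U A B V (E : U -> A -> B -> V) t :
  (forall a b, lin (fun x => E x a b)) -> lin (fun x => tens_lift (E x) t).
Proof.
move=> hE c x y; rewrite /tens_lift scaler_sumr -big_split /=.
by apply: eq_bigr => p _; rewrite hE.
Qed.

Lemma lin_lift_arg U A B V (E : A -> B -> V) (f : U -> (A \ot B)%type) :
  bil E -> lin f -> lin (fun x => tens_lift E (f x)).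
Proof.
by move=> /bilE hE; apply: lin_comp; exact: tens_lift_is_linear hE.
Qed.

Lemma lin0 V W (f : V -> W) : lin f -> f 0 = 0.
Proof. by move=> h; have := h (-1) 0 0; rewrite scaler0 addr0 scaleN1r addNr. Qed.

Lemma linD V W (f : V -> W) : lin f -> {morph f : u v / u + v}.
Proof. by move=> h u v; have := h 1 u v; rewrite !scale1r. Qed.

Lemma linZ V W (f : V -> W) c x : lin f -> f (c *: x) = c *: f x.
Proof. by move=> h; have := h c x 0; rewrite !addr0 (lin0 h) addr0. Qed.

Lemma lin_sum V W (f : V -> W) I (r : seq I) (F : I -> V) : lin f ->
  f (\sum_(i <- r) F i) = \sum_(i <- r) f (F i).
Proof. by move=> h; apply: big_morph; [exact: linD | exact: lin0]. Qed.

(** [tens_lift] is a sum over a chosen representative, so a linear map goes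
through it even when the summand is not bilinear. *)
Lemma lift_lin A B V W (h : V -> W) (f : A -> B -> V) t : lin h ->
  h (tens_lift f t) = tens_lift (fun a b => h (f a b)) t.
Proof. by move=> hl; apply: tens_lift_sum; [exact: lin0 | exact: linD]. Qed.

Lemma lift_lift A B C D V (f : C -> D -> V) (g : A -> B -> (C \ot D)%type) t :
  bil f ->
  tens_lift f (tens_lift g t) = tens_lift (fun a b => tens_lift f (g a b)) t.
Proof. by move=> /bilE hf; apply: lift_lin; exact: tens_lift_is_linear hf. Qed.

Lemma lift_tens A B V (f : A -> B -> V) a b :
  bil f -> tens_lift f (a \ot b) = f a b.
Proof. by move=> /bilE hf; exact: tens_lift_tens hf _ _. Qed.

Lemma lift_exch A B C D V (f : A -> B -> C -> D -> V) s t :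
  tens_lift (fun a b => tens_lift (f a b) t) s =
  tens_lift (fun c d => tens_lift (fun a b => f a b c d) s) t.
Proof. exact: exchange_big. Qed.

Lemma lin_ext A B V (f g : (A \ot B)%type -> V) : lin f -> lin g ->
  (forall a b, f (a \ot b) = g (a \ot b)) -> f =1 g.
Proof.
move=> hf hg fg x; rewrite [x]tensE (lin_sum _ _ hf) (lin_sum _ _ hg).
by apply: eq_bigr.
Qed.

Lemma lift_eta A B (t : (A \ot B)%type) : tens_lift (fun a b => a \ot b) t = t.
Proof. exact/esym/tensE. Qed.

Lemma tensZl A B c (a : A) (b : B) : (c *: a) \ot b = c *: (a \ot b).
Proof. exact: (linZ c a (lin_tensl b (@lin_id A))). Qed.

Lemma tensZr A B c (a : A) (b : B) : a \ot (c *: b) = c *: (a \ot b).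
Proof. exact: (linZ c b (lin_tensr a (@lin_id B))). Qed.

Lemma lin_comul U (C : coalgType k) (f : U -> C) :
  lin f -> lin (fun x => comul (f x)).
Proof. by apply: lin_comp => c x y; rewrite linearP. Qed.

Lemma sca_counit U (C : coalgType k) (f : U -> C) :
  lin f -> sca (fun x => counit (f x)).
Proof. by move=> hf c x y; rewrite hf linearP. Qed.

Lemma lin_mull U (A : algType k) (f : U -> A) b : lin f -> lin (fun x => f x * b).
Proof. by move=> hf c x y; rewrite hf mulrDl scalerAl. Qed.

Lemma lin_mulr U (A : algType k) (f : U -> A) b : lin f -> lin (fun x => b * f x).
Proof. by move=> hf c x y; rewrite hf mulrDr scalerAr. Qed.

Lemma lin_antipode U (H : hopfType k) (f : U -> H) :
  lin f -> lin (fun x => antipode (f x)).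
Proof. by apply: lin_comp => c x y; rewrite linearP. Qed.

Lemma lin_hopf U (A B : hopfType k) (g : hopf_hom A B) (f : U -> A) :
  lin f -> lin (fun x => g (f x)).
Proof. by apply: lin_comp => c x y; rewrite linearP. Qed.

Lemma sca_mull U (f : U -> k) b : sca f -> sca (fun x => f x * b).
Proof. by move=> hf c x y; rewrite hf mulrDl mulrA. Qed.

Lemma sca_mulr U (f : U -> k) b : sca f -> sca (fun x => b * f x).
Proof. by move=> hf c x y; rewrite hf mulrDr mulrCA. Qed.

Lemma sca_lift_arg U A B (E : A -> B -> k) (f : U -> (A \ot B)%type) :
  (forall b, sca (E^~ b)) -> (forall a, sca (E a)) -> lin f ->
  sca (fun x => tens_lift E (f x)).
Proof. by move=> h1 h2; apply: (@lin_lift_arg U A B k^o). Qed.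

Lemma sca_lift_tens A B (E : A -> B -> k) a b :
  (forall b, sca (E^~ b)) -> (forall a, sca (E a)) ->
  tens_lift E (a \ot b) = E a b.
Proof. by move=> h1 h2; apply: (@lift_tens A B k^o). Qed.

End Linear.

(** [lin_tac] proves the linearity of an explicit expression by recursion on its
shape. [lin_atom] is the case of maps that are introduced later. *)
Ltac lin_atom := fail.
Ltac lin_step :=
  lazymatch goal with
  | |- bil _ => (split=> ? /=)
  | |- lin (fun x => x) => exact: lin_id
  | |- lin (fun x => tens _ _) => first [apply: lin_tensl | apply: lin_tensr]
  | |- lin (fun x => tens_lift _ _) =>
      first [(apply: lin_lift => ? ?) | apply: lin_lift_arg]
  | |- _ => first
    [ apply: lin_id
    | progress lin_atom
    | apply: lin_tensl | apply: lin_tensr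
    | apply: lin_mull | apply: lin_mulr
    | apply: lin_comul | apply: lin_antipode | apply: lin_hopf
    | apply: lin_scale | apply: lin_scalar
    | apply: lin_lift => ? ? | apply: lin_lift_arg
    | apply: sca_counit | apply: sca_mull | apply: sca_mulr
    | (split=> ? /=)
    | solve [auto 2] ]
  end.
Ltac lin_tac := repeat lin_step.

Section Sweedler.
Variable k : fieldType.
Implicit Types (U V W : lmodType k) (C D : coalgType k).

(** The axiom [comulA] is an equality of tensors. A trilinear F factors through
the triple tensor product, which gives coassociativity in the form in which
Sweedler sums are used. *)
Lemma swe_coassoc C V (F : C -> C -> C -> V) (x : C) :
  (forall b c, lin (fun a => F a b c)) -> (forall a c, lin (fun b => F a b c)) ->
  (forall a b, lin (fun c => F a b c)) ->
  \swe_(a, b <- x) \swe_(a1, a2 <- a) F a1 a2 b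
  = \swe_(a, b <- x) \swe_(b1, b2 <- b) F a b1 b2.
Proof.
move=> h1 h2 h3.
have bF a : bil (F a) by split=> ? /=; [exact: h2 | exact: h3].
have bG : bil (fun a => tens_lift (F a)).
  split=> t /=; first by apply: lin_lift => ? ?; exact: h1.
  by apply: lin_lift_arg => //; exact: lin_id.
have e := congr1 (tens_lift (fun a => tens_lift (F a))) (comulA x).
transitivity (tens_lift (fun a => tens_lift (F a))
  (\swe_(a, b <- x) \swe_(y, z <- a) y \ot (z \ot b))).
  rewrite lift_lift //; apply: eq_tens_lift => a b; rewrite lift_lift //.
  by apply: eq_tens_lift => ? ?; rewrite !lift_tens.
rewrite e lift_lift //; apply: eq_tens_lift => a b; rewrite lift_lift //.
by apply: eq_tens_lift => ? ?; rewrite !lift_tens.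
Qed.

Lemma swe_counitl C V (F : C -> V) (x : C) : lin F ->
  \swe_(a, b <- x) counit a *: F b = F x.
Proof.
move=> hF; rewrite -[in RHS](counitl x) lift_lin //.
by apply: eq_tens_lift => a b; rewrite linZ.
Qed.

Lemma swe_counitr C V (F : C -> V) (x : C) : lin F ->
  \swe_(a, b <- x) counit b *: F a = F x.
Proof.
move=> hF; rewrite -[in RHS](counitr x) lift_lin //.
by apply: eq_tens_lift => a b; rewrite linZ.
Qed.

Lemma swe_cocomm C V (F : C -> C -> V) (x : C) : cocommutative C -> bil F ->
  \swe_(a, b <- x) F a b = \swe_(a, b <- x) F b a.
Proof.
move=> cC bF; rewrite -[in LHS](cC x) lift_lift //.
by apply: eq_tens_lift => a b; rewrite lift_tens.
Qed.

Lemma liftZ C D V c (F : C -> D -> V) t :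
  tens_lift (fun a b => c *: F a b) t = c *: tens_lift F t.
Proof. by rewrite [RHS](@lift_lin _ _ _ _ _ (fun x => c *: x)) //; lin_tac. Qed.

(** By coassociativity both sides are sums over x1, x2, x3, x4, and the two middle
legs come from the comultiplication of one factor, which is cocommutative. This
is what makes the pairing of two coalgebra morphisms a coalgebra morphism. *)
Lemma swe_swap C V (F : C -> C -> C -> C -> V) (x : C) : cocommutative C ->
  (forall b c d, lin (fun a => F a b c d)) ->
  (forall a c d, lin (fun b => F a b c d)) ->
  (forall a b d, lin (fun c => F a b c d)) ->
  (forall a b c, lin (fun d => F a b c d)) ->
  \swe_(u, v <- x) \swe_(a, b <- u) \swe_(c, d <- v) F a b c d
  = \swe_(u, v <- x) \swe_(a, b <- u) \swe_(c, d <- v) F a c b d.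
Proof.
move=> cC h1 h2 h3 h4.
have hh a : forall b c, lin (fun d => F a b c d) by move=> b c; exact: h4.
have inner G : (forall b c d, lin (fun a => G a b c d : V)) ->
  (forall a c d, lin (fun b => G a b c d)) ->
  (forall a b d, lin (fun c => G a b c d)) ->
  (forall a b c, lin (fun d => G a b c d)) ->
  \swe_(u, v <- x) \swe_(a, b <- u) \swe_(c, d <- v) G a b c d
  = \swe_(a, v <- x) \swe_(w, d <- v) \swe_(b, c <- w) G a b c d.
  move=> g1 g2 g3 g4.
  rewrite (@swe_coassoc _ _ (fun a b v => \swe_(c, d <- v) G a b c d)).
  - apply: eq_tens_lift => a v; symmetry.
    by apply: (@swe_coassoc _ _ (fun b c d => G a b c d)).
  - by move=> b c; apply: lin_lift => ? ?.
  - by move=> b c; apply: lin_lift => ? ?.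
  - by move=> a b; apply: lin_lift_arg; [split=> ? /= | exact: lin_comul].
rewrite inner // [RHS](inner (fun a b c d => F a c b d)) //.
apply: eq_tens_lift => a v; apply: eq_tens_lift => w d.
by apply: swe_cocomm => //; split=> ? /=.
Qed.

End Sweedler.

(** * The tensor product of two coalgebras *)

Section TensorCoalgebra.
Variables (k : fieldType) (C D : coalgType k).

Definition tens_comul (t : (C \ot D)%type) :=
  tens_lift (fun c d => \swe_(c1, c2 <- c) \swe_(d1, d2 <- d)
    (c1 \ot d1) \ot (c2 \ot d2)) t.

Definition tens_counit (t : (C \ot D)%type) : k :=
  tens_lift (fun c d => counit c * counit d) t.

Lemma lin_tens_comul : lin tens_comul.
Proof. by apply: lin_lift_arg; [lin_tac | exact: lin_id]. Qed.

Lemma lin_tens_counit : sca tens_counit.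
Proof. by apply: sca_lift_arg => [?|?|] /=; last exact: lin_id; lin_tac. Qed.

Lemma tens_comulE c d : tens_comul (c \ot d) =
  \swe_(c1, c2 <- c) \swe_(d1, d2 <- d) (c1 \ot d1) \ot (c2 \ot d2).
Proof. by rewrite /tens_comul lift_tens //; lin_tac. Qed.

Lemma tens_counitE c d : tens_counit (c \ot d) = counit c * counit d.
Proof. by rewrite /tens_counit sca_lift_tens // => ?; lin_tac. Qed.

HB.instance Definition _ :=
  GRing.isLinear.Build k (C \ot D)%type ((C \ot D) \ot (C \ot D))%type *:%R
    tens_comul lin_tens_comul.
HB.instance Definition _ :=
  GRing.isLinear.Build k (C \ot D)%type k *%R tens_counit lin_tens_counit.

Lemma tens_comulA (x : (C \ot D)%type) :
  tens_lift (fun x1 x2 => tens_lift (fun y z => y \ot (z \ot x2)) (tens_comul x1))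
      (tens_comul x)
    = tens_lift (fun x1 x2 =>
      tens_lift (fun y z => x1 \ot (y \ot z)) (tens_comul x2))
      (tens_comul x).
Proof.
move: x; apply: lin_ext => [||c d].
- by apply: lin_lift_arg; [lin_tac; exact: lin_tens_comul|exact: lin_tens_comul].
- by apply: lin_lift_arg; [lin_tac; exact: lin_tens_comul|exact: lin_tens_comul].
pose G (c1 c2 c3 : C) := \swe_(d1, d2 <- d) \swe_(d11, d12 <- d1)
  (c1 \ot d11) \ot ((c2 \ot d12) \ot (c3 \ot d2)).
transitivity (\swe_(c1, c2 <- c) \swe_(c11, c12 <- c1) G c11 c12 c2).
  rewrite tens_comulE lift_lift; last by lin_tac; exact: lin_tens_comul.
  apply: eq_tens_lift => c1 c2.
  rewrite lift_lift; last by lin_tac; exact: lin_tens_comul.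
  rewrite /G lift_exch; apply: eq_tens_lift => d1 d2.
  rewrite lift_tens; last by lin_tac; exact: lin_tens_comul.
  rewrite tens_comulE lift_lift; last by lin_tac.
  apply: eq_tens_lift => c11 c12; rewrite lift_lift; last by lin_tac.
  by apply: eq_tens_lift => d11 d12; rewrite lift_tens //; lin_tac.
rewrite swe_coassoc; try by move=> *; rewrite /G; lin_tac.
symmetry; rewrite tens_comulE lift_lift; last by lin_tac; exact: lin_tens_comul.
apply: eq_tens_lift => c1 c2.
rewrite lift_lift; last by lin_tac; exact: lin_tens_comul.
transitivity (\swe_(d1, d2 <- d) \swe_(c21, c22 <- c2) \swe_(d21, d22 <- d2)
  (c1 \ot d1) \ot ((c21 \ot d21) \ot (c22 \ot d22))).
  apply: eq_tens_lift => d1 d2.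
  rewrite lift_tens; last by lin_tac; exact: lin_tens_comul.
  rewrite tens_comulE lift_lift; last by lin_tac.
  apply: eq_tens_lift => c11 c12; rewrite lift_lift; last by lin_tac.
  by apply: eq_tens_lift => d11 d12; rewrite lift_tens //; lin_tac.
rewrite lift_exch; apply: eq_tens_lift => c21 c22; symmetry.
by apply: (@swe_coassoc _ _ _
  (fun x y z => (c1 \ot x) \ot ((c21 \ot y) \ot (c22 \ot z)))) => *; lin_tac.
Qed.

Lemma tens_counitl (x : (C \ot D)%type) :
  tens_lift (fun x1 x2 => tens_counit x1 *: x2) (tens_comul x) = x.
Proof.
move: x; apply: lin_ext => [||c d]; first 2 [by []].
- apply: lin_lift_arg; last exact: lin_tens_comul.
  split=> ? /=; last by lin_tac.
  by apply: lin_scalar; exact: lin_tens_counit.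
have b : bil (fun x1 x2 : (C \ot D)%type => tens_counit x1 *: x2).
  by split=> ? /=; [apply: lin_scalar; exact: lin_tens_counit | lin_tac].
rewrite tens_comulE lift_lift //.
rewrite -[in RHS](@swe_counitl _ _ _ (fun c => c \ot d)); last by lin_tac.
apply: eq_tens_lift => c1 c2; rewrite lift_lift //.
rewrite -(@swe_counitl _ _ _ (fun d => c2 \ot d)); last by lin_tac.
rewrite -liftZ; apply: eq_tens_lift => d1 d2.
by rewrite lift_tens // tens_counitE scalerA.
Qed.

Lemma tens_counitr (x : (C \ot D)%type) :
  tens_lift (fun x1 x2 => tens_counit x2 *: x1) (tens_comul x) = x.
Proof.
move: x; apply: lin_ext => [||c d]; first 2 [by []].
- apply: lin_lift_arg; last exact: lin_tens_comul.
  split=> ? /=; first by lin_tac.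
  by apply: lin_scalar; exact: lin_tens_counit.
have b : bil (fun x1 x2 : (C \ot D)%type => tens_counit x2 *: x1).
  by split=> ? /=; [lin_tac | apply: lin_scalar; exact: lin_tens_counit].
rewrite tens_comulE lift_lift //.
rewrite -[in RHS](@swe_counitr _ _ _ (fun c => c \ot d)); last by lin_tac.
apply: eq_tens_lift => c1 c2; rewrite lift_lift //.
rewrite -(@swe_counitr _ _ _ (fun d => c1 \ot d)); last by lin_tac.
rewrite -liftZ; apply: eq_tens_lift => d1 d2.
by rewrite lift_tens // tens_counitE scalerA.
Qed.

HB.instance Definition _ := isCoalgebra.Build k (C \ot D)%type
  tens_comulA tens_counitl tens_counitr.

Lemma comul_tens (c : C) (d : D) : comul (c \ot d) =
  \swe_(c1, c2 <- c) \swe_(d1, d2 <- d) (c1 \ot d1) \ot (c2 \ot d2).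
Proof. exact: tens_comulE. Qed.

Lemma counit_tens (c : C) (d : D) : counit (c \ot d) = counit c * counit d.
Proof. exact: tens_counitE. Qed.

Lemma tens_cocomm : cocommutative C -> cocommutative D ->
  cocommutative (C \ot D)%type.
Proof.
move=> cC cD; apply: lin_ext => [||c d].
- by apply: lin_lift_arg; [lin_tac | apply: lin_comul; exact: lin_id].
- by apply: lin_comul; exact: lin_id.
rewrite comul_tens lift_lift; last by lin_tac.
rewrite [RHS]swe_cocomm //; last by lin_tac.
apply: eq_tens_lift => c1 c2.
rewrite lift_lift; last by lin_tac.
rewrite [RHS]swe_cocomm //; last by lin_tac.
by apply: eq_tens_lift => d1 d2; rewrite lift_tens //; lin_tac.
Qed.

End TensorCoalgebra.

(** * Coalgebra morphisms and products of cocommutative coalgebras *)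

Record cocoalg (k : fieldType) :=
  Cocoalg { cocoalg_car :> coalgType k; cocoalgP : cocommutative cocoalg_car }.

Record comor (k : fieldType) (C D : coalgType k) := Comor {
  cfun :> C -> D;
  comor_lin : lin cfun;
  comor_comul : forall x,
    comul (cfun x) = \swe_(x1, x2 <- x) cfun x1 \ot cfun x2;
  comor_counit : forall x, counit (cfun x) = counit x
}.

Section CoalgebraMorphisms.
Variable k : fieldType.
Implicit Types (U V : lmodType k).

Lemma comorP (C D : coalgType k) (f g : comor C D) : f =1 g -> f = g.
Proof.
case: f g => [f f1 f2 f3] [g g1 g2 g3] /= /funext fg.
by subst g; congr Comor; exact: Prop_irrelevance.
Qed.

Lemma lin_comor U (C D : coalgType k) (u : comor C D) (f : U -> C) :
  lin f -> lin (fun x => u (f x)).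
Proof. by apply: lin_comp; exact: comor_lin. Qed.

Ltac lin_atom ::= apply: lin_comor.

Lemma swe_comor (C D : coalgType k) V (u : comor C D) (F : D -> D -> V) x :
  bil F -> \swe_(a, b <- u x) F a b = \swe_(a, b <- x) F (u a) (u b).
Proof.
move=> bF; rewrite comor_comul lift_lift //.
by apply: eq_tens_lift => a b; rewrite lift_tens.
Qed.

Definition cprod (C D : cocoalg k) : cocoalg k :=
  Cocoalg (tens_cocomm (@cocoalgP _ C) (@cocoalgP _ D)).

Lemma comor_ext (C D : cocoalg k) (E : coalgType k) (f g : comor (cprod C D) E) :
  (forall c d, f (c \ot d) = g (c \ot d)) -> f = g.
Proof. by move=> fg; apply: comorP; apply: lin_ext => //; exact: comor_lin. Qed.

Definition comor_id (C : coalgType k) : comor C C :=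
  @Comor k C C id (@lin_id _ _) (fun x => tensE (comul x)) (fun x => erefl).

Section Comp.
Variables (C D E : coalgType k) (g : comor D E) (f : comor C D).
Fact ccomp_lin : lin (fun x => g (f x)). Proof. by lin_tac. Qed.
Fact ccomp_comul x :
  comul (g (f x)) = \swe_(x1, x2 <- x) g (f x1) \ot g (f x2).
Proof. by rewrite comor_comul swe_comor //; lin_tac. Qed.
Fact ccomp_counit x : counit (g (f x)) = counit x.
Proof. by rewrite !comor_counit. Qed.
Definition ccomp : comor C E := Comor ccomp_lin ccomp_comul ccomp_counit.
Lemma ccompE x : ccomp x = g (f x). Proof. by []. Qed.
End Comp.

Definition grouplike (C : coalgType k) (g : C) :=
  comul g = g \ot g /\ counit g = 1.

Lemma grouplike_tens (C D : coalgType k) (g : C) (h : D) :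
  grouplike g -> grouplike h -> grouplike (g \ot h).
Proof.
move=> [g1 g2] [h1 h2]; split; last by rewrite counit_tens g2 h2 mulr1.
rewrite comul_tens g1 h1 lift_tens.
  rewrite lift_tens //; split=> ? /=.
    by apply: lin_tensl; apply: lin_tensr; exact: lin_id.
  by apply: lin_tensr; apply: lin_tensr; exact: lin_id.
split=> ? /=; apply: lin_lift => ? ?.
  by apply: lin_tensl; apply: lin_tensl; exact: lin_id.
by apply: lin_tensr; apply: lin_tensl; exact: lin_id.
Qed.

(** The morphism x |-> counit(x) g plays the role of the constant map g. *)
Section Constant.
Variables (C D : coalgType k) (g : D) (gl : grouplike g).
Fact cconst_lin : lin (fun x : C => counit x *: g).
Proof. by lin_tac. Qed.
Fact cconst_comul (x : C) : comul (counit x *: g) =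
  \swe_(x1, x2 <- x) (counit x1 *: g) \ot (counit x2 *: g).
Proof.
rewrite linearZ /= gl.1 -(@swe_counitl _ _ _ (fun x => counit x *: (g \ot g))).
  by apply: eq_tens_lift => a b; rewrite tensZl tensZr.
by lin_tac.
Qed.
Fact cconst_counit (x : C) : counit (counit x *: g) = counit x.
Proof. by rewrite linearZ /= gl.2 mulr1. Qed.
Definition cconst : comor C D := Comor cconst_lin cconst_comul cconst_counit.
End Constant.

Section Projections.
Variables C D : cocoalg k.
Fact cp1_bil : bil (fun (c : C) (d : D) => counit d *: c).
Proof. by lin_tac. Qed.
Fact cp2_bil : bil (fun (c : C) (d : D) => counit c *: d).
Proof. by lin_tac. Qed.
Definition cp1_fun (t : (C \ot D)%type) := tens_lift (fun c d => counit d *: c) t.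
Definition cp2_fun (t : (C \ot D)%type) := tens_lift (fun c d => counit c *: d) t.
Fact cp1_lin : lin cp1_fun.
Proof. by apply: lin_lift_arg; [exact: cp1_bil | exact: lin_id]. Qed.
Fact cp2_lin : lin cp2_fun.
Proof. by apply: lin_lift_arg; [exact: cp2_bil | exact: lin_id]. Qed.
Lemma cp1_funE c d : cp1_fun (c \ot d) = counit d *: c.
Proof. by rewrite /cp1_fun lift_tens //; exact: cp1_bil. Qed.
Lemma cp2_funE c d : cp2_fun (c \ot d) = counit c *: d.
Proof. by rewrite /cp2_fun lift_tens //; exact: cp2_bil. Qed.
Let lin_cp1 U (f : U -> (C \ot D)%type) : lin f -> lin (fun x => cp1_fun (f x)).
Proof. by apply: lin_comp; exact: cp1_lin. Qed.
Let lin_cp2 U (f : U -> (C \ot D)%type) : lin f -> lin (fun x => cp2_fun (f x)).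
Proof. by apply: lin_comp; exact: cp2_lin. Qed.
Ltac lin_atom ::= first [apply: lin_comor | apply: lin_cp1 | apply: lin_cp2].

Fact cp1_comul x :
  comul (cp1_fun x) = \swe_(x1, x2 <- x) cp1_fun x1 \ot cp1_fun x2.
Proof.
move: x; apply: lin_ext => [||c d].
- by lin_tac.
- by apply: lin_lift_arg; [lin_tac | apply: lin_comul; exact: lin_id].
rewrite cp1_funE linearZ /= comul_tens lift_lift; last by lin_tac.
rewrite -[in LHS](lift_eta (comul c)) -liftZ; apply: eq_tens_lift => c1 c2.
rewrite lift_lift; last by lin_tac.
rewrite -(@swe_counitl _ _ _ (fun d => counit d *: (c1 \ot c2))); last by lin_tac.
apply: eq_tens_lift => d1 d2; rewrite lift_tens; last by lin_tac.
by rewrite !cp1_funE tensZl tensZr.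
Qed.
Fact cp2_comul x :
  comul (cp2_fun x) = \swe_(x1, x2 <- x) cp2_fun x1 \ot cp2_fun x2.
Proof.
move: x; apply: lin_ext => [||c d].
- by lin_tac.
- by apply: lin_lift_arg; [lin_tac | apply: lin_comul; exact: lin_id].
rewrite cp2_funE linearZ /= comul_tens lift_lift; last by lin_tac.
rewrite -(@swe_counitl _ _ _ (fun c => counit c *: comul d)); last by lin_tac.
apply: eq_tens_lift => c1 c2; rewrite lift_lift; last by lin_tac.
rewrite -[in LHS](lift_eta (comul d)) -!liftZ.
apply: eq_tens_lift => d1 d2; rewrite lift_tens; last by lin_tac.
by rewrite !cp2_funE tensZl tensZr.
Qed.
Fact cp1_counit x : counit (cp1_fun x) = counit x.
Proof.
move: x; apply: (@lin_ext _ _ _ k^o) => [||c d].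
- by apply: sca_counit; lin_tac.
- by apply: sca_counit; lin_tac.
by rewrite cp1_funE linearZ counit_tens mulrC.
Qed.
Fact cp2_counit x : counit (cp2_fun x) = counit x.
Proof.
move: x; apply: (@lin_ext _ _ _ k^o) => [||c d].
- by apply: sca_counit; lin_tac.
- by apply: sca_counit; lin_tac.
by rewrite cp2_funE linearZ counit_tens.
Qed.
Definition cp1 : comor (cprod C D) C := Comor cp1_lin cp1_comul cp1_counit.
Definition cp2 : comor (cprod C D) D := Comor cp2_lin cp2_comul cp2_counit.

Lemma cp1E c d : cp1 (c \ot d) = counit d *: c. Proof. exact: cp1_funE. Qed.
Lemma cp2E c d : cp2 (c \ot d) = counit c *: d. Proof. exact: cp2_funE. Qed.
End Projections.

Ltac lin_atom ::= apply: lin_comor.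

(** The morphism into the product: comultiply, then apply f and g to the two
legs. It preserves the comultiplication because its source is cocommutative. *)
Section Pair.
Variables (C D E : cocoalg k) (f : comor C D) (g : comor C E).
Definition cpair_fun (x : C) := \swe_(x1, x2 <- x) f x1 \ot g x2.
Fact cpair_lin : lin cpair_fun.
Proof. by apply: lin_lift_arg; [lin_tac | apply: lin_comul; exact: lin_id]. Qed.
Fact cpair_comul x :
  comul (cpair_fun x) = \swe_(x1, x2 <- x) cpair_fun x1 \ot cpair_fun x2.
Proof.
transitivity (\swe_(u, v <- x) \swe_(a, b <- u) \swe_(c, d <- v)
  (f a \ot g c) \ot (f b \ot g d)).
  rewrite /cpair_fun lift_lin; last by apply: lin_comul; exact: lin_id.
  apply: eq_tens_lift => u v; rewrite comul_tens swe_comor; last by lin_tac.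
  by apply: eq_tens_lift => a b; rewrite swe_comor //; lin_tac.
rewrite swe_swap; [|exact: cocoalgP|by move=> *; lin_tac..].
apply: eq_tens_lift => u v; rewrite /cpair_fun.
rewrite (@lift_lin _ _ _ _ _ (fun z => z \ot _)); last by lin_tac.
apply: eq_tens_lift => a b.
by rewrite (@lift_lin _ _ _ _ _ (fun z => _ \ot z)) //; lin_tac.
Qed.
Fact cpair_counit x : counit (cpair_fun x) = counit x.
Proof.
rewrite /cpair_fun (@lift_lin _ _ _ _ k^o counit); last first.
  by apply: sca_counit; exact: lin_id.
rewrite -[in RHS](counitl x) (@lift_lin _ _ _ _ k^o counit); last first.
  by apply: sca_counit; exact: lin_id.
by apply: eq_tens_lift => a b; rewrite counit_tens !comor_counit linearZ.
Qed.
Definition cpair : comor C (cprod D E) :=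
  Comor cpair_lin cpair_comul cpair_counit.

Lemma cpairE x : cpair x = \swe_(x1, x2 <- x) f x1 \ot g x2. Proof. by []. Qed.
End Pair.

Lemma cp1_pair (C D E : cocoalg k) (f : comor C D) (g : comor C E) :
  ccomp (cp1 D E) (cpair f g) = f.
Proof.
apply: comorP => x; rewrite ccompE cpairE lift_lin; last exact: comor_lin.
rewrite -[RHS](@swe_counitr _ _ _ f); last by lin_tac.
by apply: eq_tens_lift => a b; rewrite cp1E comor_counit.
Qed.

Lemma cp2_pair (C D E : cocoalg k) (f : comor C D) (g : comor C E) :
  ccomp (cp2 D E) (cpair f g) = g.
Proof.
apply: comorP => x; rewrite ccompE cpairE lift_lin; last exact: comor_lin.
rewrite -[RHS](@swe_counitl _ _ _ g); last by lin_tac.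
by apply: eq_tens_lift => a b; rewrite cp2E comor_counit.
Qed.

Lemma cpair_comp (C' C D E : cocoalg k) (f : comor C D)
    (g : comor C E) (u : comor C' C) :
  ccomp (cpair f g) u = cpair (ccomp f u) (ccomp g u).
Proof. by apply: comorP => x; rewrite ccompE !cpairE swe_comor //; lin_tac. Qed.

Lemma cpair_proj (C D : cocoalg k) :
  cpair (cp1 C D) (cp2 C D) = comor_id _.
Proof.
apply: comor_ext => c d; rewrite cpairE comul_tens lift_lift; last by lin_tac.
rewrite -[RHS](@swe_counitr _ _ _ (fun c => c \ot d)); last by lin_tac.
apply: eq_tens_lift => c1 c2; rewrite lift_lift; last by lin_tac.
rewrite -(@swe_counitl _ _ _ (fun d => c1 \ot d)); last by lin_tac.
rewrite -liftZ; apply: eq_tens_lift => d1 d2; rewrite lift_tens; last by lin_tac.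
by rewrite ?ccompE cp1E cp2E tensZl tensZr !scalerA mulrC.
Qed.

Lemma cpair_eta (C D E : cocoalg k) (u : comor C (cprod D E)) :
  cpair (ccomp (cp1 _ _) u) (ccomp (cp2 _ _) u) = u.
Proof.
rewrite -cpair_comp cpair_proj.
by apply: comorP.
Qed.

(** Evaluation of a pairing at a pure tensor when its legs depend on different
factors. Most identities between elements are obtained from identities between
morphisms by this lemma. *)
Lemma cpair_tens (C D E F : cocoalg k) (f : comor C E) (g : comor D F)
    c d :
  cpair (ccomp f (cp1 _ _)) (ccomp g (cp2 _ _)) (c \ot d)
  = f c \ot g d.
Proof.
rewrite cpairE comul_tens lift_lift; last by lin_tac.
rewrite -[RHS](@swe_counitr _ _ _ (fun c => f c \ot g d)); last by lin_tac.
apply: eq_tens_lift => c1 c2; rewrite lift_lift; last by lin_tac.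
rewrite -(@swe_counitl _ _ _ (fun d => f c1 \ot g d)); last by lin_tac.
rewrite -liftZ; apply: eq_tens_lift => d1 d2; rewrite lift_tens; last by lin_tac.
rewrite ?ccompE cp1E cp2E !(linZ _ _ (comor_lin _)) tensZl tensZr.
by rewrite !scalerA mulrC.
Qed.

Lemma comor_inverse (C D : coalgType k) (f : comor C D) (g : D -> C) :
  cancel f g -> cancel g f -> lin g /\
  (forall x, comul (g x) = \swe_(x1, x2 <- x) g x1 \ot g x2) /\
  (forall x, counit (g x) = counit x).
Proof.
move=> fg gf.
have hg : lin g.
  by move=> c x y; apply: (can_inj fg); rewrite gf (comor_lin f) !gf.
split=> //; split=> x; last by rewrite -[in RHS](gf x) comor_counit.
rewrite -[x in RHS]gf comor_comul lift_lift; last first.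
  by split=> ? /=; [apply: lin_tensl | apply: lin_tensr].
rewrite -[LHS]lift_eta; apply: eq_tens_lift => a b; rewrite lift_tens ?fg //.
by split=> ? /=; [apply: lin_tensl | apply: lin_tensr].
Qed.

End CoalgebraMorphisms.

Ltac lin_atom ::= apply: lin_comor.

(** * Functionals and shortest tensors *)

Section Functionals.
Variables (k : fieldType) (V : lmodType k).

(** By Zorn's lemma there is a largest subspace M that contains W and not x. It is
a hyperplane: if no multiple of x differs from y by an element of M, then M and y
span a larger subspace without x. The functional is the coefficient of x modulo
M. *)
Lemma separating_functional (W : {pred V}) (x : V) :
  submod_closed W -> x \notin W ->
  exists2 f : V -> k, sca f & {in W, forall y, f y = 0} /\ f x = 1.
Proof.
move=> [W0 WD] xW.
(* M is A together with W, so that the union of the empty chain is admissible *)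
pose P (A : V -> Prop) :=
  (forall c u v, A u \/ u \in W -> A v \/ v \in W ->
     A (c *: u + v) \/ c *: u + v \in W) /\ ~ A x.
have [|A [[AD Ax] Amax]] := @classical_sets.Zorn_bigcup V P.
  move=> F FP Ftot; split; last by move=> [A FA]; exact: (FP A FA).2.
  move=> c u v [[A FA Au]|uW] [[A' FA' Av]|vW].
  - have [AA|AA] := Ftot A A' FA FA'.
      have [h|h] := (FP A' FA').1 c u v (or_introl (AA _ Au)) (or_introl Av).
        by left; exists A'.
      by right.
    have [h|h] := (FP A FA).1 c u v (or_introl Au) (or_introl (AA _ Av)).
      by left; exists A.
    by right.
  - have [h|h] := (FP A FA).1 c u v (or_introl Au) (or_intror vW).
      by left; exists A.
    by right.
  - have [h|h] := (FP A' FA').1 c u v (or_intror uW) (or_introl Av).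
      by left; exists A'.
    by right.
  - by right; exact: WD.
pose M u := A u \/ u \in W.
have M0 : M 0 by right.
have MD c u v : M u -> M v -> M (c *: u + v) by exact: AD.
have MZ c u : M u -> M (c *: u) by move=> h; rewrite -[_ *: _]addr0; exact: MD.
have Mx : ~ M x by case=> // h; rewrite h in xW.
have uniq c : M (c *: x) -> c = 0.
  move=> h; apply/eqP/negPn/negP => c0; apply: Mx.
  by rewrite -[x](scalerK c0); exact: MZ.
have ex y : exists c, M (y - c *: x).
  apply: contrapT => ny.
  pose A' z := exists c, exists2 u, M u & z = c *: y + u.
  apply: (Amax A').
    split; first by move=> z Az; exists 0, z; [left | rewrite scale0r add0r].
    move=> AA; apply: ny; exists 0; rewrite scale0r subr0; left.
    apply: AA; exists 1, 0; first exact: M0.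
    by rewrite scale1r addr0.
  have MA' z : A' z \/ z \in W -> A' z.
    by case=> // zW; exists 0, z; [right | rewrite scale0r add0r].
  split.
    move=> c u v /MA' [a [u' Mu ->]] /MA' [b [v' Mv ->]].
    left; exists (c * a + b), (c *: u' + v'); first exact: MD.
    by rewrite scalerDr scalerDl scalerA addrACA.
  move=> [c [u Mu xE]]; have [c0|c0] := eqVneq c 0.
    by apply: Mx; rewrite xE c0 scale0r add0r.
  apply: ny; exists c^-1.
  have -> : y - c^-1 *: x = - c^-1 *: u.
    by rewrite xE scalerDr scalerA mulVf // scale1r opprD addNKr scaleNr.
  exact: MZ.
have sgl c y : M (y - c *: x) -> sval (cid (ex y)) = c.
  move=> h; case: (cid (ex y)) => d /= hd; apply/eqP; rewrite -subr_eq0;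
    apply/eqP.
  apply: uniq; have -> : (d - c) *: x = -1 *: (y - d *: x) + (y - c *: x).
    by rewrite scaleN1r opprB scalerBl addrA subrK.
  exact: MD.
have spec y : M (y - sval (cid (ex y)) *: x) by exact: svalP (cid (ex y)).
exists (fun y => sval (cid (ex y))).
  move=> c u v; apply: sgl.
  have -> : c *: u + v - (c * sval (cid (ex u)) + sval (cid (ex v))) *: x
    = c *: (u - sval (cid (ex u)) *: x) + (v - sval (cid (ex v)) *: x).
    by rewrite scalerDl scalerBr scalerA opprD addrACA.
  exact: MD.
split=> [y yW|]; apply: sgl; first by rewrite scale0r subr0; right.
by rewrite scale1r subrr.
Qed.
End Functionals.

Section MinimalRank.
Variables (k : fieldType) (A B : lmodType k).

Definition tsum (s : seq (A * B)) : (A \ot B)%type := \sum_(p <- s) p.1 \ot p.2.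

Lemma tsum_ex z : exists s, z = tsum s.
Proof. by exists (repr z); exact: tensE. Qed.

Lemma lin_tsuml u r (c : nat -> k) :
  u \ot (\sum_(i < size r) c i *: (nth (0, 0) r i).2) + tsum r
  = tsum [seq ((nth (0, 0) r i).1 + c i *: u, (nth (0, 0) r i).2) | i <-
    index_iota 0 (size r)].
Proof.
rewrite /tsum big_map (lin_sum _ _ (lin_tensr u (@lin_id _ _))).
rewrite (big_nth (0, 0)) big_mkord big_mkord -big_split /=; apply: eq_bigr => i _.
by rewrite (linD (lin_tensl _ (@lin_id _ _))) tensZr tensZl addrC.
Qed.

(** In an expression of minimal length of a tensor the second components are
linearly independent: a relation v = sum c_i v_i would let u (x) v be absorbed in
the other terms, replacing u_i by u_i + c_i u. So some functional is 1 at v and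
vanishes at the v_i. *)
Lemma shortest_dual (u : A) (v : B) r :
  (forall s, tsum s = tsum ((u, v) :: r) -> (size r < size s)%N) ->
  exists2 f : B -> k, sca f & f v = 1 /\ {in r, forall p, f p.2 = 0}.
Proof.
move=> rmin.
pose W : {pred B} := fun y =>
  `[< exists c : nat -> k, y = \sum_(i < size r) c i *: (nth (0, 0) r i).2 >].
have [||f fl [fW fv]] := @separating_functional k B W v.
- split=> [|c y z /asboolP [a ->] /asboolP [b ->]]; apply/asboolP.
    by exists (fun=> 0); rewrite big1 // => i _; rewrite scale0r.
  exists (fun i => c * a i + b i).
  rewrite scaler_sumr -big_split /=; apply: eq_bigr => i _.
  by rewrite scalerDl scalerA.
- apply/negP => /asboolP [c vE].
  have := rmin _ (esym (_ : tsum ((u, v) :: r) = _)).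
  rewrite {1}/tsum big_cons /= -/(tsum r) vE lin_tsuml => /(_ _ erefl).
  by rewrite size_map size_iota subn0 ltnn.
exists f => //; split=> // p /(nthP (0, 0)) [i ir <-]; apply: fW; apply/asboolP.
exists (fun j => (j == i)%:R).
rewrite (bigD1 (Ordinal ir)) //= eqxx scale1r big1 ?addr0 // => j ji.
by rewrite (_ : (_ == _) = false) ?scale0r //; apply: contraNF ji => /eqP e;
  apply/eqP/val_inj.
Qed.
End MinimalRank.

(** * Irreducible coalgebras *)

Section Shortest.
Variables (k : fieldType) (A B : lmodType k).
Lemma shortest_ex (z : (A \ot B)%type) :
  exists2 s, z = tsum s & forall s', z = tsum s' -> (size s <= size s')%N.
Proof.
pose P n := `[< exists2 s : seq (A * B), z = tsum s & size s = n >].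
have exP : exists n, P n.
  by have [s zs] := tsum_ex z; exists (size s); apply/asboolP; exists s.
case: (ex_minnP exP) => n /asboolP [s zs sn] nmin.
exists s => // s' zs'; rewrite sn; apply: nmin.
by apply/asboolP; exists s'.
Qed.
End Shortest.

Section Hit.
Variables (k : fieldType) (C : coalgType k).

(** The action of the dual algebra on a coalgebra, f . x = f(x1) x2. *)
Definition hit (f : C -> k) (x : C) : C := \swe_(a, b <- x) f a *: b.

Lemma hit_bil (f : C -> k) : sca f -> bil (fun a b : C => f a *: b).
Proof. by move=> hf; split=> ? /=; [apply: lin_scalar | lin_tac]. Qed.

Lemma hit_lin (f : C -> k) : sca f -> lin (hit f).
Proof. by move=> hf; apply: lin_lift_arg;
  [exact: hit_bil | apply: lin_comul; lin_tac]. Qed.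

Lemma hit_sub (D : {pred C}) (f : C -> k) x :
  subcoalgebra D -> sca f -> x \in D -> hit f x \in D.
Proof.
move=> [[D0 DD] Dc] hf xD; have [s sD xs] := Dc x xD.
rewrite /hit xs (lin_sum _ _ (lin_lift_arg (hit_bil hf) (@lin_id _ _))).
have DZ c y : y \in D -> c *: y \in D by move=> yD; rewrite -[_ *: _]addr0;
  exact: DD.
elim: s sD {xs} => [|p s IHs] sD; first by rewrite big_nil.
rewrite big_cons lift_tens; last exact: hit_bil.
apply: DD; first by apply: (sD p _).2; rewrite mem_head.
by apply: IHs => q qs; apply: sD; rewrite inE qs orbT.
Qed.

Lemma hit_counit x : hit counit x = x. Proof. exact: counitl. Qed.

Definition convolution (f g : C -> k) (y : C) : k := \swe_(a, b <- y) (f a * g b).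

Lemma convolution_sca f g : sca f -> sca g -> sca (convolution f g).
Proof.
move=> hf hg; apply: sca_lift_arg => [b|a|] /=.
- exact: sca_mull.
- exact: sca_mulr.
- by apply: lin_comul; lin_tac.
Qed.

Lemma hit_hit (f g : C -> k) x : sca f -> sca g ->
  hit g (hit f x) = hit (convolution f g) x.
Proof.
move=> hf hg.
transitivity (\swe_(a, b <- x) \swe_(c, d <- b) (f a * g c) *: d).
  rewrite {2}/hit (lift_lin _ _ (hit_lin hg)); apply: eq_tens_lift => a b.
  rewrite (linZ _ _ (hit_lin hg)) /hit -liftZ; apply: eq_tens_lift => c d.
  by rewrite scalerA.
rewrite -(@swe_coassoc _ _ _ (fun a b c => (f a * g b) *: c)).
- apply: eq_tens_lift => a b.
  rewrite /convolution [RHS](@lift_lin _ _ _ k^o _ (fun z : k => z *: b)) //.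
  by move=> c u v; rewrite scalerDl scalerA.
- by move=> b c; apply: lin_scalar; exact: sca_mull.
- by move=> b c; apply: lin_scalar; exact: sca_mulr.
- by move=> *; lin_tac.
Qed.

(** A functional dual to a second component v of a shortest expression of the
comultiplication of x extracts the first component that goes with it, so that
component is of the form f . x. *)
Lemma shortest_in (E : {pred C}) x s : cocommutative C ->
  (forall f, sca f -> hit f x \in E) ->
  comul x = tsum s -> (forall s', comul x = tsum s' -> (size s <= size s')%N) ->
  {in s, forall p, p.1 \in E}.
Proof.
move=> cC hE xs smin p ps.
have sp := perm_to_rem ps.
have xs' : comul x = tsum (p :: rem p s).
  by rewrite xs /tsum; apply: perm_big.
have [|f hf [fp fr]] := @shortest_dual k C C p.1 p.2 (rem p s).
  move=> s' e; have := smin s' _; rewrite (perm_size sp); apply.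
  by rewrite e -surjective_pairing.
suff -> : p.1 = hit f x by exact: hE.
have b : bil (fun a b : C => f b *: a).
  by split=> ? /=; [lin_tac | apply: lin_scalar].
rewrite /hit (swe_cocomm x cC (hit_bil hf)) xs'.
rewrite (lin_sum _ _ (lin_lift_arg b (@lin_id _ _))) big_cons lift_tens //.
rewrite fp scale1r big1_seq ?addr0 // => q /andP [_ qr].
by rewrite lift_tens // fr // scale0r.
Qed.

(** Subcoalgebras of a cocommutative coalgebra are the submodules for the action
of the dual algebra. A shortest expression of the comultiplication of x in E has
its first components in E, and so has the expression with the factors exchanged,
which is shortest too. *)
Lemma hit_subcoalgebra (E : {pred C}) : cocommutative C -> submod_closed E ->
  (forall f x, sca f -> x \in E -> hit f x \in E) -> subcoalgebra E.
Proof.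
move=> cC E0 hE; split=> // x xE; have [s xs smin] := shortest_ex (comul x).
pose sw (p : C * C) := (p.2, p.1).
have sw_sum t : comul x = tsum t -> comul x = tsum (map sw t).
  move=> xt; rewrite -cC xt /tsum big_map
    (lin_sum _ _ (lin_lift_arg _ (@lin_id _ _))).
    by apply: eq_bigr => p _; rewrite lift_tens //; lin_tac.
  by lin_tac.
exists s => // p ps; split.
  by apply: shortest_in xs smin _ ps => // f hf; exact: hE.
apply: (@shortest_in E x (map sw s) cC _ (sw_sum _ xs) _ (p.2, p.1)).
- by move=> f hf; exact: hE.
- by move=> s' xs'; rewrite size_map -(size_map sw s'); apply: smin;
  exact: sw_sum.
- exact: map_f.
Qed.

End Hit.

Section Irreducible.
Variable k : fieldType.

(** The elements f . x form a nonzero subcoalgebra, which has to meet the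
subcoalgebra spanned by g. *)
Lemma irreducible_hit (C : coalgType k) (g x : C) : cocommutative C ->
  irreducible C -> grouplike g -> x != 0 -> exists2 f, sca f & hit f x = g.
Proof.
move=> cC iC gl x0.
pose D : {pred C} := fun y => `[< exists2 f, sca f & y = hit f x >].
pose E : {pred C} := fun y => `[< exists c : k, y = c *: g >].
have scaD (c : k) (f f' : C -> k) : sca f -> sca f' ->
  sca (fun y => c * f y + f' y).
  move=> hf hf' a u v; rewrite hf hf' !mulrDr addrACA; congr (_ + _ + _).
  by rewrite mulrCA.
have sD : subcoalgebra D.
  apply: hit_subcoalgebra => //.
    split=> [|c u v /asboolP [f hf ->] /asboolP [f' hf' ->]]; apply/asboolP.
      exists (fun=> 0); first by move=> a u v; rewrite mulr0 addr0.
      by rewrite /hit /tens_lift big1 // => p _; rewrite scale0r.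
    exists (fun y => c * f y + f' y); first exact: scaD.
    rewrite /hit -liftZ /tens_lift -big_split /=; apply: eq_bigr => p _.
    by rewrite scalerDl scalerA.
  move=> f y hf /asboolP [f' hf' ->]; apply/asboolP.
  by exists (convolution f' f); [exact: convolution_sca | exact: hit_hit].
have sE : subcoalgebra E.
  split.
    split=> [|c u v /asboolP [a ->] /asboolP [b ->]]; apply/asboolP.
      by exists 0; rewrite scale0r.
    by exists (c * a + b); rewrite scalerDl scalerA.
  move=> y /asboolP [c ->]; exists [:: (c *: g, g)].
    move=> p; rewrite inE => /eqP -> /=; split; apply/asboolP; first by exists c.
    by exists 1; rewrite scale1r.
  by rewrite big_seq1 linearZ /= gl.1 tensZl.
have g0 : g != 0.
  by apply/eqP => e; have := gl.2; rewrite e linear0 => /esym/eqP;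
    rewrite oner_eq0.
have [||y [/asboolP [f hf yf] /asboolP [c yc]] y0] := iC D E sD _ sE.
- exists x => //; apply/asboolP; exists counit; last by rewrite hit_counit.
  exact: sca_counit (@lin_id _ _).
- exists g => //; apply/asboolP; exists 1; by rewrite scale1r.
have c0 : c != 0 by apply: contraNneq y0 => c0; rewrite yc c0 scale0r.
exists (fun z => c^-1 * f z); first exact: sca_mulr.
have -> : hit (fun z => c^-1 * f z) x = c^-1 *: hit f x.
  by rewrite /hit -liftZ; apply: eq_tens_lift => a b; rewrite scalerA.
by rewrite -yf yc scalerA mulVf // scale1r.
Qed.

Lemma irreducible_grouplike (C : coalgType k) (g : C) : grouplike g ->
  (forall D : {pred C}, subcoalgebra D -> forall x, x \in D -> x != 0 ->
    g \in D) ->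
  irreducible C.
Proof.
move=> gl h D E sD [x xD x0] sE [y yE y0]; exists g.
  by split; [exact: h xD x0 | exact: h yE y0].
by apply/eqP => e; have := gl.2; rewrite e linear0 => /esym/eqP; rewrite oner_eq0.
Qed.

(** The image of a subcoalgebra under a coalgebra morphism is a subcoalgebra. *)
Lemma irreducible_inj (C D : coalgType k) (i : comor C D) :
  injective i -> irreducible D -> irreducible C.
Proof.
move=> ii iD E F sE [x xE x0] sF [y yF y0].
pose im (E : {pred C}) : {pred D} := fun z => `[< exists2 x, x \in E & z = i x >].
have im_in (G : {pred C}) z : z \in G -> i z \in im G.
  by move=> zG; apply/asboolP; exists z.
have sim G : subcoalgebra G -> subcoalgebra (im G).
  move=> [[G0 GD] Gc]; split.
    split=> [|c u v /asboolP [a aG ->] /asboolP [b bG ->]]; apply/asboolP.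
      by exists 0 => //; rewrite (lin0 (comor_lin i)).
    by exists (c *: a + b); [exact: GD | rewrite (comor_lin i)].
  move=> z /asboolP [a aG ->]; have [s sG as_] := Gc a aG.
  exists [seq (i p.1, i p.2) | p <- s].
    by move=> q /mapP [p ps ->] /=; have [h1 h2] := sG p ps; split; exact: im_in.
  rewrite comor_comul as_ (lin_sum _ _ (lin_lift_arg _ (@lin_id _ _)));
    last by lin_tac.
  by rewrite big_map; apply: eq_bigr => p _; rewrite lift_tens //; lin_tac.
have nz z : z != 0 -> i z != 0.
  by move=> z0; apply: contraNneq z0 => e; apply/eqP/ii;
    rewrite (lin0 (comor_lin i)).
have [||z [/asboolP [a aE ->] /asboolP [b bF e]] z0] :=
  iD _ _ (sim E sE) _ (sim F sF).
- by exists (i x); [exact: im_in | exact: nz].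
- by exists (i y); [exact: im_in | exact: nz].
exists a; first by split=> //; rewrite (ii _ _ e).
by apply: contraNneq z0 => ->; rewrite (lin0 (comor_lin i)).
Qed.
End Irreducible.

(** * Irreducibility of tensor products *)

Section TensorIrreducible.
Variables (k : fieldType) (B H : cocoalg k).

Definition tens_functional (f : B -> k) (f' : H -> k) (t : (B \ot H)%type) : k :=
  tens_lift (fun b h => f b * f' h) t.

Lemma tens_functional_sca f f' : sca f -> sca f' -> sca (tens_functional f f').
Proof.
move=> hf hf'; apply: sca_lift_arg => [b|a|] /=; last exact: lin_id.
- exact: sca_mull.
- exact: sca_mulr.
Qed.

Lemma tens_functionalE f f' b h : sca f -> sca f' ->
  tens_functional f f' (b \ot h) = f b * f' h.
Proof.
by move=> hf hf'; rewrite /tens_functional sca_lift_tens // => ?;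
  [exact: sca_mull | exact: sca_mulr].
Qed.

Lemma hit_tens f f' b h : sca f -> sca f' ->
  hit (tens_functional f f') (b \ot h) = hit f b \ot hit f' h.
Proof.
move=> hf hf'; have hff := tens_functional_sca hf hf'.
rewrite /hit comul_tens lift_lift; last exact: hit_bil.
rewrite [RHS](@lift_lin _ _ _ _ _ (fun z => z \ot _)); last by lin_tac.
apply: eq_tens_lift => b1 b2; rewrite lift_lift; last exact: hit_bil.
rewrite [RHS](@lift_lin _ _ _ _ _ (fun z => _ \ot z)); last by lin_tac.
apply: eq_tens_lift => h1 h2; rewrite lift_tens; last exact: hit_bil.
by rewrite tens_functionalE // tensZl tensZr scalerA.
Qed.

Lemma slice_counit f t : sca f ->
  tens_lift (fun b h => counit b *: h) (hit (tens_functional f counit) t)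
  = tens_lift (fun b h => f b *: h) t.
Proof.
move=> hf; have hc : sca (@counit k H) by apply: sca_counit; exact: lin_id.
have hff := tens_functional_sca hf hc.
have b1 : bil (fun (b : B) (h : H) => counit b *: h) by lin_tac.
have b2 : bil (fun (b : B) (h : H) => f b *: h).
  by split=> ? /=; [apply: lin_scalar | lin_tac].
move: t; apply: lin_ext => [||b h].
- by apply: lin_lift_arg => //; exact: hit_lin.
- by apply: lin_lift_arg => //; exact: lin_id.
rewrite hit_tens // lift_tens // lift_tens // hit_counit; congr (_ *: _).
have hcB : sca (@counit k B) by apply: sca_counit; exact: lin_id.
rewrite /hit (@lift_lin _ _ _ _ k^o counit) //.
rewrite -[in RHS](counitr b) (@lift_lin _ _ _ _ k^o f) //.
apply: eq_tens_lift => x y.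
by rewrite (@linZ _ _ k^o f) // (@linZ _ _ k^o counit) //= /GRing.scale /= mulrC.
Qed.

(** Every nonzero subcoalgebra D contains g (x) g'. Take a nonzero element of D
with an expression of minimal length among all nonzero elements of D. Acting by a
functional on the first factors, one can assume that its first term is g (x) h.
If some other first component p is not a multiple of g, act by a functional psi
on B that vanishes at g and is 1 at p: the first term disappears, so by
minimality the result is 0, which contradicts the independence of the second
components. Hence the element is g (x) h' with h' nonzero, and acting on the
second factor gives g (x) g'. *)
Lemma tens_irreducible (g : B) (g' : H) : grouplike g -> grouplike g' ->
  irreducible B -> irreducible H -> irreducible (cprod B H).
Proof.
move=> gl gl' iB iH.
have glt : grouplike (g \ot g' : cprod B H) by exact: grouplike_tens.
have g0 : g != 0.
  by apply/eqP => e; have := gl.2; rewrite e linear0 => /esym/eqP;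
    rewrite oner_eq0.
have cB : sca (@counit k B) by apply: sca_counit; exact: lin_id.
have cH : sca (@counit k H) by apply: sca_counit; exact: lin_id.
apply: (irreducible_grouplike glt) => D sD z0 z0D z00.
pose P n := `[< exists2 s : seq (B * H), tsum s \in D /\ tsum s != 0 & size s =
  n >].
have exP : exists n, P n.
  have [s zs] := tsum_ex z0; exists (size s); apply/asboolP; exists s => //.
  by rewrite -zs.
case: (ex_minnP exP) => n /asboolP [s [sD' s0] sn] nmin.
have smin s' : tsum s' \in D -> tsum s' != 0 -> (size s <= size s')%N.
  by move=> h1 h2; rewrite sn; apply: nmin; apply/asboolP; exists s'.
have hit_tsum f t : sca f -> hit (tens_functional f counit) (tsum t) =
  tsum [seq (hit f p.1, p.2) | p <- t].
  move=> hf; rewrite /tsum (lin_sum _ _ (hit_lin (tens_functional_sca hf cH)))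
    big_map.
  by apply: eq_bigr => p _; rewrite hit_tens // hit_counit.
have hitD f t : sca f -> t \in D -> hit (tens_functional f counit) t \in D.
  by move=> hf; apply: hit_sub => //; exact: tens_functional_sca.
case: s => [|[b h] r] in sD' s0 sn smin *;
  first by rewrite /tsum big_nil eqxx in s0.
have b0 : b != 0.
  apply/eqP => b0; have e : tsum ((b, h) :: r) = tsum r.
    by rewrite /tsum big_cons /= b0 (lin0 (lin_tensl h (@lin_id _ _))) add0r.
  by have := smin r; rewrite -e => /(_ sD' s0); rewrite /= ltnn.
have [f hf fb] := irreducible_hit (@cocoalgP _ B) iB gl b0.
have [|phi hphi [phih phir]] := @shortest_dual k B H b h r.
  by move=> s' e; apply: smin; rewrite e.
pose r' := [seq (hit f p.1, p.2) | p <- r].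
pose z := tsum ((g, h) :: r').
have zE : z = hit (tens_functional f counit) (tsum ((b, h) :: r)) by rewrite
  hit_tsum //= fb.
have zD : z \in D by rewrite zE; exact: hitD.
have bphi : bil (fun (b : B) (h : H) => phi h *: b).
  by split=> ? /=; [lin_tac | apply: lin_scalar].
have z_0 : z != 0.
  apply: contra_neq g0 => e.
  have : tens_lift (fun (b : B) (h : H) => phi h *: b) z = g.
    rewrite /z /tsum (lin_sum _ _ (lin_lift_arg bphi (@lin_id _ _))) big_cons.
    rewrite lift_tens // phih scale1r big_map big1_seq ?addr0 // =>
      p /andP [_ pr].
    by rewrite lift_tens //= phir // scale0r.
  by rewrite e (lin0 (lin_lift_arg bphi (@lin_id _ _))).
pose E : {pred B} := fun y => `[< exists c : k, y = c *: g >].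
have r'E p : p \in r' -> p.1 \in E.
  move=> pr; apply/negPn/negP => pE.
  have sE : submod_closed E.
    split=> [|c u v /asboolP [a ->] /asboolP [a' ->]]; apply/asboolP.
      by exists 0; rewrite scale0r.
    by exists (c * a + a'); rewrite scalerDl scalerA.
  have [psi hpsi [psiE psip]] := separating_functional sE pE.
  have psig : psi g = 0 by apply: psiE; apply/asboolP; exists 1; rewrite scale1r.
  have hpg : hit psi g = 0.
    rewrite /hit gl.1 (lift_tens _ _ (hit_bil hpsi)) psig.
    exact: scale0r.
  (* acting by psi kills the first term, so minimality applies *)
  have w0 : hit (tens_functional psi counit) z = 0.
    apply/eqP/negPn/negP => w0.
    have e : hit (tens_functional psi counit) z =
      tsum [seq (hit psi p.1, p.2) | p <- r'].
      rewrite hit_tsum // /tsum big_cons /= hpg.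
      by rewrite (lin0 (lin_tensl h (@lin_id _ _))) add0r.
    have := smin [seq (hit psi p.1, p.2) | p <- r'].
    rewrite -e => /(_ (hitD _ _ hpsi zD) w0).
    by rewrite !size_map ltnn.
  have := slice_counit z hpsi.
  have bc : bil (fun (b : B) (h : H) => counit b *: h) by lin_tac.
  have bpsi : bil (fun (b : B) (h : H) => psi b *: h).
    by split=> ? /=; [apply: lin_scalar | lin_tac].
  rewrite w0 (lin0 (lin_lift_arg bc (@lin_id _ _))) => /esym sl.
  pose s' := (g, h) :: r'.
  have ps' : p \in s' by rewrite inE pr orbT.
  have sp := perm_to_rem ps'.
  have zs' : z = tsum (p :: rem p s') by rewrite /z /tsum; apply: perm_big.
  have [|phi' hphi' [php phr]] := @shortest_dual k B H p.1 p.2 (rem p s').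
    move=> s2; rewrite -surjective_pairing -zs' => e.
    have := smin s2; rewrite e => /(_ zD z_0).
    have := perm_size sp; rewrite /= size_map => -[<-]; exact.
  have : phi' (tens_lift (fun b h => psi b *: h) z) = 1.
    rewrite zs' /tsum (lin_sum _ _ (lin_lift_arg bpsi (@lin_id _ _))).
    rewrite (@lin_sum _ _ k^o phi') // big_cons lift_tens //.
    rewrite (@linZ _ _ k^o phi') // php psip big1_seq ?addr0 ?scale1r // =>
      q /andP [_ qr].
    by rewrite lift_tens // (@linZ _ _ k^o phi') // phr // scaler0.
  by rewrite sl (@lin0 _ _ k^o phi') // => /esym/eqP; rewrite oner_eq0.
have zg : z = g \ot cp2 B H z.
  have e u v : (u, v) \in (g, h) :: r' -> u \ot v = g \ot cp2 B H (u \ot v).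
    rewrite inE => /orP [/eqP [-> ->]|/r'E /asboolP [c uc]].
      by rewrite cp2E gl.2 scale1r.
    by rewrite [u]uc cp2E linearZ /= gl.2 mulr1 tensZr tensZl.
  rewrite {2}/z /tsum (lin_sum _ _ (comor_lin _))
    (lin_sum _ _ (lin_tensr g (@lin_id _ _))).
  by apply: eq_big_seq => -[u v] /e.
have h0 : cp2 B H z != 0.
  by apply: contra_neq z_0 => e; rewrite zg e (lin0 (lin_tensr g (@lin_id _ _))).
have [f' hf' fh] := irreducible_hit (@cocoalgP _ H) iH gl' h0.
have -> : g \ot g' = hit (tens_functional counit f') z.
  by rewrite zg hit_tens // hit_counit fh.
by apply: hit_sub => //; exact: tens_functional_sca.
Qed.
End TensorIrreducible.

(** * The group of points of a cocommutative Hopf algebra *)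

(** Objects of [cocomm_hopf_algebras], written so that they coerce both to Hopf
algebras and to cocommutative coalgebras. *)
Definition cohopf (k : fieldType) := {A : hopfType k | cocommutative A}.
Definition cohopf_hopf (k : fieldType) (A : cohopf k) : hopfType k := sval A.
Coercion cohopf_hopf : cohopf >-> Hopf.type.
Definition cohopf_cocoalg (k : fieldType) (A : cohopf k) : cocoalg k :=
  Cocoalg (svalP A).
Coercion cohopf_cocoalg : cohopf >-> cocoalg.
Canonical cohopf_cocoalg.

Section HopfMorphisms.
Variable k : fieldType.

Lemma grouplike1 (A : hopfType k) : grouplike (1 : A).
Proof. by split; [exact: comul1 | exact: counit1]. Qed.

Definition cone (C : coalgType k) (A : hopfType k) : comor C A :=
  cconst C (grouplike1 A).

Section Mul.
Variable A : cohopf k.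
Definition cmul_fun (t : (A \ot A)%type) : A := tens_lift *%R t.
Fact mul_bil : bil (@GRing.mul A).
Proof. by split=> ? /=; [apply: lin_mull | apply: lin_mulr]; exact: lin_id. Qed.
Fact cmul_lin : lin cmul_fun.
Proof. by apply: lin_lift_arg; [exact: mul_bil | exact: lin_id]. Qed.
Fact cmul_funE a b : cmul_fun (a \ot b) = a * b.
Proof. by rewrite /cmul_fun lift_tens //; exact: mul_bil. Qed.
Let lin_cmul (U : lmodType k) (f : U -> (A \ot A)%type) : lin f ->
  lin (fun x => cmul_fun (f x)).
Proof. by apply: lin_comp; exact: cmul_lin. Qed.
Ltac lin_atom ::= first [apply: lin_comor | apply: lin_cmul].
Fact cmul_comul t :
  comul (cmul_fun t) = \swe_(t1, t2 <- t) cmul_fun t1 \ot cmul_fun t2.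
Proof.
move: t; apply: lin_ext => [||a b].
- by lin_tac.
- by apply: lin_lift_arg; [lin_tac | apply: lin_comul; exact: lin_id].
rewrite cmul_funE comulM comul_tens lift_lift; last by lin_tac.
apply: eq_tens_lift => a1 a2; rewrite lift_lift; last by lin_tac.
apply: eq_tens_lift => b1 b2; rewrite lift_tens; last by lin_tac.
by rewrite !cmul_funE.
Qed.
Fact cmul_counit t : counit (cmul_fun t) = counit t.
Proof.
move: t; apply: (@lin_ext _ _ _ k^o) => [||a b].
- by apply: sca_counit; lin_tac.
- by apply: sca_counit; lin_tac.
by rewrite cmul_funE counitM counit_tens.
Qed.
Definition cmul : comor (cprod A A) A := Comor cmul_lin cmul_comul cmul_counit.
Lemma cmulE a b : cmul (a \ot b) = a * b. Proof. exact: cmul_funE. Qed.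
End Mul.

Ltac lin_atom ::= apply: lin_comor.

Lemma cmul_pair (C : cocoalg k) (A : cohopf k) (x y : comor C A) c :
  ccomp (cmul A) (cpair x y) c = \swe_(c1, c2 <- c) x c1 * y c2.
Proof.
rewrite ccompE cpairE lift_lin; last exact: comor_lin.
by apply: eq_tens_lift => a b; rewrite cmulE.
Qed.

(** The antipode is a coalgebra morphism. The map x (x) y |-> x1 (x) x2 y is a
bijective coalgebra morphism, with inverse x (x) y |-> x1 (x) S(x2) y, so the
inverse is one as well. The antipode is the inverse at x (x) 1, followed by the
second projection. *)
Section Antipode.
Variable A : cohopf k.
Let fan : comor (cprod A A) (cprod A A) := cpair (cp1 A A) (cmul A).
Let nat_fun (t : (A \ot A)%type) : (A \ot A)%type :=
  tens_lift (fun x y => \swe_(x1, x2 <- x) x1 \ot (antipode x2 * y)) t.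

Let nat_bil : bil (fun x y : A => \swe_(x1, x2 <- x) x1 \ot (antipode x2 * y)).
Proof. by lin_tac. Qed.
Let lin_nat : lin nat_fun.
Proof. by apply: lin_lift_arg; [exact: nat_bil | exact: lin_id]. Qed.
Let natE x y : nat_fun (x \ot y) = \swe_(x1, x2 <- x) x1 \ot (antipode x2 * y).
Proof. by rewrite /nat_fun lift_tens //; exact: nat_bil. Qed.

Let fanE x y : fan (x \ot y) = \swe_(x1, x2 <- x) x1 \ot (x2 * y).
Proof.
rewrite /fan cpairE comul_tens lift_lift; last by lin_tac.
apply: eq_tens_lift => x1 x2; rewrite lift_lift; last by lin_tac.
rewrite -(@swe_counitl _ _ _ (fun y => x1 \ot (x2 * y))); last by lin_tac.
apply: eq_tens_lift => y1 y2; rewrite lift_tens; last by lin_tac.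
by rewrite cp1E cmulE tensZl.
Qed.

Let fanK : cancel fan nat_fun.
Proof.
apply: lin_ext => [||x y].
- by apply: lin_comp => //; exact: comor_lin.
- exact: lin_id.
rewrite fanE lift_lin //.
rewrite (eq_tens_lift
  (g := fun a b => \swe_(a1, a2 <- a) a1 \ot (antipode a2 * (b * y)))) =>
  [|a b]; last by rewrite natE.
rewrite (@swe_coassoc _ _ _ (fun a1 a2 b => a1 \ot (antipode a2 * (b * y))));
  try by move=> *; lin_tac.
rewrite -[RHS](@swe_counitr _ _ _ (fun c => c \ot y)); last by lin_tac.
apply: eq_tens_lift => a b.
rewrite -tensZr -[y in RHS]mul1r scalerAl -antipodel.
rewrite (@lift_lin _ _ _ _ _ (fun z => a \ot (z * y))); last by lin_tac.
by apply: eq_tens_lift => b1 b2; rewrite mulrA.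
Qed.

Let natK : cancel nat_fun fan.
Proof.
apply: lin_ext => [||x y].
- by apply: lin_comp => //; exact: comor_lin.
- exact: lin_id.
rewrite natE lift_lin; last exact: comor_lin.
rewrite (eq_tens_lift
  (g := fun a b => \swe_(a1, a2 <- a) a1 \ot (a2 * (antipode b * y)))) =>
  [|a b]; last by rewrite fanE.
rewrite (@swe_coassoc _ _ _ (fun a1 a2 b => a1 \ot (a2 * (antipode b * y))));
  try by move=> *; lin_tac.
rewrite -[RHS](@swe_counitr _ _ _ (fun c => c \ot y)); last by lin_tac.
apply: eq_tens_lift => a b.
rewrite -tensZr -[y in RHS]mul1r scalerAl -antipoder.
rewrite (@lift_lin _ _ _ _ _ (fun z => a \ot (z * y))); last by lin_tac.
by apply: eq_tens_lift => b1 b2; rewrite mulrA.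
Qed.

Let nat : comor (cprod A A) (cprod A A) :=
  let e := comor_inverse fanK natK in Comor e.1 e.2.1 e.2.2.

Definition cantipode : comor A A :=
  ccomp (cp2 A A) (ccomp nat (cpair (comor_id A) (cone A A))).

Lemma cantipodeE x : cantipode x = antipode x.
Proof.
have -> : cantipode x = cp2 A A (nat_fun (x \ot 1)).
  rewrite /cantipode !ccompE cpairE /=; congr (cp2_fun (nat_fun _)).
  rewrite -[RHS](@swe_counitr _ _ _ (fun c => c \ot 1)); last by lin_tac.
  by apply: eq_tens_lift => a b; rewrite tensZr.
rewrite natE lift_lin; last exact: comor_lin.
rewrite -[RHS](@swe_counitl _ _ _ antipode); last by exact: lin_antipode.
by apply: eq_tens_lift => a b; rewrite cp2E mulr1.
Qed.
End Antipode.

End HopfMorphisms.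

(** Points get a name of their own, which carries the group structure of
convolution. *)
Definition pt (k : fieldType) (C : cocoalg k) (A : cohopf k) := comor C A.

Section Points.
Variables (k : fieldType) (C : cocoalg k) (A : cohopf k).

HB.instance Definition _ := gen_eqMixin (pt C A).
HB.instance Definition _ := gen_choiceMixin (pt C A).

Definition pt_mul (x y : pt C A) : pt C A := ccomp (cmul A) (cpair x y).
Definition pt_one : pt C A := cone C A.
Definition pt_inv (x : pt C A) : pt C A := ccomp (cantipode A) x.

Fact pt_mulA : associative pt_mul.
Proof.
move=> x y z; apply: comorP => c; rewrite !cmul_pair.
transitivity (\swe_(a, b <- c) \swe_(b1, b2 <- b) x a * (y b1 * z b2)).
  apply: eq_tens_lift => a b;
    rewrite cmul_pair (@lift_lin _ _ _ _ _ (fun u => _ * u)) //.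
  by lin_tac.
rewrite -(@swe_coassoc _ _ _ (fun a b c => x a * (y b * z c))); try by move=> *;
  lin_tac.
apply: eq_tens_lift => a b;
  rewrite cmul_pair (@lift_lin _ _ _ _ _ (fun u => u * _)).
  by apply: eq_tens_lift => ? ?; rewrite mulrA.
by lin_tac.
Qed.
Fact pt_mul1 : left_id pt_one pt_mul.
Proof.
move=> x; apply: comorP => c; rewrite cmul_pair.
rewrite -[RHS](@swe_counitl _ _ _ x); last exact: lin_comor.
by apply: eq_tens_lift => a b /=; rewrite -scalerAl mul1r.
Qed.
Fact pt_mulr1 : right_id pt_one pt_mul.
Proof.
move=> x; apply: comorP => c; rewrite cmul_pair.
rewrite -[RHS](@swe_counitr _ _ _ x); last exact: lin_comor.
by apply: eq_tens_lift => a b /=; rewrite -scalerAr mulr1.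
Qed.
Fact pt_mulV : left_inverse pt_one pt_inv pt_mul.
Proof.
move=> x; apply: comorP => c; rewrite cmul_pair.
transitivity (\swe_(a, b <- x c) antipode a * b); last first.
  by rewrite antipodel comor_counit.
rewrite swe_comor; last by lin_tac.
by apply: eq_tens_lift => a b; rewrite ccompE cantipodeE.
Qed.
Fact pt_mulrV : right_inverse pt_one pt_inv pt_mul.
Proof.
move=> x; apply: comorP => c; rewrite cmul_pair.
transitivity (\swe_(a, b <- x c) a * antipode b); last first.
  by rewrite antipoder comor_counit.
rewrite swe_comor; last by lin_tac.
by apply: eq_tens_lift => a b; rewrite ccompE cantipodeE.
Qed.

HB.instance Definition _ :=
  isGroup.Build (pt C A) pt_mulA pt_mul1 pt_mulr1 pt_mulV pt_mulrV.

End Points.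

Section PointsFunctor.
Variable k : fieldType.
Implicit Types (C : cocoalg k) (A B : cohopf k).
Local Open Scope group_scope.

Lemma res_mul (C C' : cocoalg k) A (u : comor C' C) (x y : pt C A) :
  ccomp (x * y) u = (ccomp x u : pt C' A) * (ccomp y u : pt C' A).
Proof.
apply: comorP => c; rewrite [RHS]cmul_pair ccompE cmul_pair swe_comor //.
by split=> ? /=; [apply: lin_mull | apply: lin_mulr]; lin_tac.
Qed.

Lemma res_one (C C' : cocoalg k) A (u : comor C' C) :
  ccomp (1 : pt C A) u = 1 :> pt C' A.
Proof. by apply: comorP => c /=; rewrite comor_counit. Qed.

Lemma res_inv (C C' : cocoalg k) A (u : comor C' C) (x : pt C A) :
  ccomp x^-1 u = (ccomp x u : pt C' A)^-1 :> pt C' A.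
Proof. by apply/esym/mulg1_eq; rewrite -res_mul mulgV res_one. Qed.

Definition hom_comor A B (f : hopf_hom A B) : comor A B :=
  @Comor k A B f (@hopf_hom_linear _ _ _ f) (@hopf_hom_comul _ _ _ f)
    (@hopf_hom_counit _ _ _ f).

Definition app C A B (f : comor A B) (x : pt C A) : pt C B := ccomp f x.
Definition happ C A B (f : hopf_hom A B) (x : pt C A) : pt C B :=
  ccomp (hom_comor f) x.

Lemma happM C A B (f : hopf_hom A B) (x y : pt C A) :
  happ f (x * y) = happ f x * happ f y.
Proof.
apply: comorP => c; rewrite [RHS]cmul_pair ccompE cmul_pair lift_lin;
  last exact: comor_lin.
by apply: eq_tens_lift => a b /=; rewrite rmorphM.
Qed.

Lemma happ1 C A B (f : hopf_hom A B) : happ f (1 : pt C A) = 1.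
Proof. by apply: (mulgI (happ f 1)); rewrite -happM !mulg1. Qed.

Lemma happV C A B (f : hopf_hom A B) (x : pt C A) : happ f x^-1 = (happ f x)^-1.
Proof. by apply/esym/mulg1_eq; rewrite -happM mulgV happ1. Qed.

(** The generic point. Every point x of A is its restriction along x, so a natural
operation on points is determined by its value here. *)
Definition upt A : pt A A := comor_id A.

Lemma happ_comp C A B (D : cohopf k) (g : hopf_hom B D) (f : hopf_hom A B)
  (x : pt C A) :
  happ (hopf_comp g f) x = happ g (happ f x).
Proof. exact: comorP. Qed.

Lemma happ_id C A (x : pt C A) : happ (hopf_id A) x = x.
Proof. exact: comorP. Qed.

Lemma hopf_hom_pt A B (f g : hopf_hom A B) :
  (forall C (x : pt C A), happ f x = happ g x) -> f = g.
Proof.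
move=> fg; apply: hopf_homP => x.
by have /(congr1 (fun u : comor A B => u x)) := fg _ (upt A).
Qed.

Lemma pt_mul_tens (C D : cocoalg k) A (f : comor C A) (g : comor D A) c d :
  ((ccomp f (cp1 C D) : pt (cprod C D) A) * ccomp g (cp2 C D)) (c \ot d)
  = (f c * g d)%R.
Proof. by rewrite [LHS]ccompE cpair_tens cmulE. Qed.

Lemma ccomp_idl (C D : coalgType k) (f : comor C D) : ccomp (comor_id D) f = f.
Proof. exact: comorP. Qed.

Lemma ccomp_idr (C D : coalgType k) (f : comor C D) : ccomp f (comor_id C) = f.
Proof. exact: comorP. Qed.

(** Multiplicativity at the two projections of A (x) A, evaluated at a (x) b, is
multiplicativity on elements. *)
Section MkHom.
Variables (A B : cohopf k) (f : comor A B).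
Hypothesis fM : forall C (x y : pt C A), app f (x * y) = app f x * app f y.
Fact mkhom_monoid : GRing.monoid_morphism f.
Proof.
have f1 : app f (1 : pt A A) = 1.
  by apply: (mulgI (app f 1)); rewrite -fM !mulg1.
split.
  have := congr1 (fun u : comor A B => u (GRing.one A)) f1.
  by rewrite /= !counit1 !scale1r.
move=> a b.
have e := fM (ccomp (comor_id A) (cp1 A A) : pt (cprod A A) A)
  (ccomp (comor_id A) (cp2 A A)).
have := congr1 (fun u : comor _ B => u (a \ot b)) e.
by rewrite ccompE (pt_mul_tens (comor_id A)) !ccomp_idl pt_mul_tens.
Qed.
Definition mkhom : hopf_hom A B :=
  @HopfHom k A B f (@comor_lin _ _ _ f) mkhom_monoid (@comor_comul _ _ _ f)
    (@comor_counit _ _ _ f).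
Lemma happ_mkhom C (x : pt C A) : happ mkhom x = app f x.
Proof. exact: comorP. Qed.
End MkHom.

End PointsFunctor.

(** * Group objects are Hopf algebras *)

(** The reassociation morphism, needed to evaluate at a pure tensor a morphism
whose legs share a factor. *)
Section Assoc.
Variables (k : fieldType).
Variables C D E : cocoalg k.
Definition cass : comor (cprod C (cprod D E)) (cprod (cprod C D) E) :=
  cpair (cpair (cp1 C (cprod D E)) (ccomp (cp1 D E) (cp2 C (cprod D E))))
    (ccomp (cp2 D E) (cp2 C (cprod D E))).
Lemma cassE c d e : cass (c \ot (d \ot e)) = (c \ot d) \ot e.
Proof.
rewrite /cass cpairE comul_tens lift_lift; last by lin_tac.
rewrite -[RHS](@swe_counitr _ _ _ (fun c => c \ot d \ot e)); last by lin_tac.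
apply: eq_tens_lift => c1 c2; rewrite lift_lift; last by lin_tac.
pose L (t : (D \ot E)%type) := tens_lift (fun u v => (c1 \ot u) \ot v) t.
have bL : bil (fun u v => (c1 \ot u) \ot v : ((C \ot D) \ot E)%type) by lin_tac.
have lL : lin L by apply: lin_lift_arg.
have <- : L (cpair (cp1 D E) (cp2 D E) (d \ot e)) = c1 \ot d \ot e.
  by rewrite cpair_proj /L lift_tens.
rewrite cpairE (lift_lin _ _ lL) -liftZ.
apply: eq_tens_lift => t1 t2; rewrite lift_tens; last by lin_tac.
rewrite -[X in cpair X](ccomp_idl (cp1 _ _)) cpair_tens /L lift_tens //.
by rewrite ccompE cp2E (linZ _ _ (comor_lin _)) tensZr.
Qed.
End Assoc.

Section GroupObject.
Variable k : fieldType.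

Definition gop (P C : cocoalg k) (m : comor (cprod P P) P) (x y : comor C P) :
  comor C P := ccomp m (cpair x y).

(** Group objects are presented by the laws they satisfy on points, which are
checked by computing in groups. *)
Record group_object := GroupObject {
  go_car : cocoalg k;
  go_mul : comor (cprod go_car go_car) go_car;
  go_one : go_car;
  go_gl : grouplike go_one;
  go_inv : comor go_car go_car;
  go_opA : forall (C : cocoalg k) (x y z : comor C go_car),
    gop go_mul x (gop go_mul y z) = gop go_mul (gop go_mul x y) z;
  go_op1l : forall (C : cocoalg k) (x : comor C go_car),
    gop go_mul (cconst C go_gl) x = x;
  go_op1r : forall (C : cocoalg k) (x : comor C go_car),
    gop go_mul x (cconst C go_gl) = x;
  go_opVl : forall (C : cocoalg k) (x : comor C go_car),
    gop go_mul (ccomp go_inv x) x = cconst C go_gl;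
  go_opVr : forall (C : cocoalg k) (x : comor C go_car),
    gop go_mul x (ccomp go_inv x) = cconst C go_gl
}.

Lemma gop_tens (P C D : cocoalg k) (m : comor (cprod P P) P) (f : comor C P)
    (g : comor D P) c d :
  gop m (ccomp f (cp1 C D)) (ccomp g (cp2 C D)) (c \ot d) = m (f c \ot g d).
Proof. by rewrite ccompE cpair_tens. Qed.

Lemma gop_res (P C C' : cocoalg k) (m : comor (cprod P P) P) (x y : comor C P)
    (u : comor C' C) :
  ccomp (gop m x y) u = gop m (ccomp x u) (ccomp y u).
Proof. by rewrite /gop -cpair_comp; apply: comorP. Qed.

(** Each axiom of Hopf algebras is the value of a law on points at a generic
point. *)
Section Build.
Variable G : group_object.
Local Notation P := (go_car G).
Local Notation m := (@go_mul G).

Definition gmul (a b : P) : P := m (a \ot b).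

Fact gmulA : associative gmul.
Proof.
move=> a b c; rewrite /gmul.
have := congr1 (fun u : comor _ P => u (a \ot (b \ot c)))
  (go_opA (cp1 P (cprod P P)) (ccomp (cp1 P P) (cp2 P (cprod P P)))
     (ccomp (cp2 P P) (cp2 P (cprod P P)))).
rewrite {2}/gop -cpair_comp cpair_proj ccomp_idl
  -[X in gop _ X _ _ = _](ccomp_idl).
rewrite gop_tens => ->.
set x := cp1 P _; set y := ccomp _ _; set z := ccomp _ _.
have -> : gop m (gop m x y) z
  = ccomp (gop m (ccomp m (cp1 (cprod P P) P))
       (ccomp (comor_id P) (cp2 (cprod P P) P))) (cass P P P).
  rewrite gop_res; congr gop.
    by rewrite /gop /cass -[in LHS](cp1_pair (cpair x y) z); apply: comorP.
  by rewrite ccomp_idl /cass cp2_pair.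
by rewrite ccompE cassE gop_tens.
Qed.

Fact gmul1 : left_id (go_one G) gmul.
Proof.
move=> a; have : gop m (cconst P (go_gl G)) (comor_id P) a = a by rewrite go_op1l.
rewrite /gmul /gop ccompE cpairE => e; rewrite -[RHS]e; congr (m _).
rewrite -(@swe_counitl _ _ _ (fun x => go_one G \ot x)); last by lin_tac.
by apply: eq_tens_lift => x y /=; rewrite tensZl.
Qed.
Fact gmulr1 : right_id (go_one G) gmul.
Proof.
move=> a; have : gop m (comor_id P) (cconst P (go_gl G)) a = a by rewrite go_op1r.
rewrite /gmul /gop ccompE cpairE => e; rewrite -[RHS]e; congr (m _).
rewrite -(@swe_counitr _ _ _ (fun x => x \ot go_one G)); last by lin_tac.
by apply: eq_tens_lift => x y /=; rewrite tensZr.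
Qed.
Fact gmulDl : left_distributive gmul +%R.
Proof.
move=> a b c; rewrite /gmul -(linD (comor_lin m)); congr (m _).
exact: (linD (lin_tensl _ (@lin_id _ _))).
Qed.
Fact gmulDr : right_distributive gmul +%R.
Proof.
move=> a b c; rewrite /gmul -(linD (comor_lin m)); congr (m _).
exact: (linD (lin_tensr _ (@lin_id _ _))).
Qed.
Fact gone_neq0 : go_one G != 0.
Proof.
apply/eqP => e; have := (go_gl G).2; rewrite e linear0 => /esym/eqP.
by rewrite oner_eq0.
Qed.
Definition go_type : Type := P.
HB.instance Definition _ := Coalgebra.on go_type.
HB.instance Definition _ := GRing.Zmodule_isNzRing.Build go_type
  gmulA gmul1 gmulr1 gmulDl gmulDr gone_neq0.
Fact gscaleAl (c : k) (a b : go_type) : c *: (a * b) = (c *: a) * b.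
Proof. by rewrite [RHS]/GRing.mul /= /gmul tensZl (linZ _ _ (comor_lin m)). Qed.
HB.instance Definition _ := GRing.Lmodule_isLalgebra.Build k go_type gscaleAl.
Fact gscaleAr (c : k) (a b : go_type) : c *: (a * b) = a * (c *: b).
Proof. by rewrite [RHS]/GRing.mul /= /gmul tensZr (linZ _ _ (comor_lin m)). Qed.
HB.instance Definition _ := GRing.Lalgebra_isAlgebra.Build k go_type gscaleAr.

Definition gantipode (x : go_type) : go_type := go_inv G x.
Fact gantipode_lin : linear gantipode.
Proof. exact (comor_lin (go_inv G)). Qed.
HB.instance Definition _ :=
  GRing.isLinear.Build k go_type go_type *:%R gantipode gantipode_lin.

Fact gcomulM (x y : go_type) : comul (x * y) =
  \swe_(x1, x2 <- x) \swe_(y1, y2 <- y) (x1 * y1) \ot (x2 * y2).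
Proof.
rewrite [X in comul X]/GRing.mul /= /gmul [LHS](comor_comul m).
rewrite comul_tens lift_lift; last by lin_tac.
apply: eq_tens_lift => a b; rewrite lift_lift; last by lin_tac.
by apply: eq_tens_lift => c d; rewrite lift_tens //; lin_tac.
Qed.
Fact gcomul1 : comul (1 : go_type) = 1 \ot 1. Proof. exact: (go_gl G).1. Qed.
Fact gcounitM (x y : go_type) : counit (x * y) = counit x * counit y.
Proof. by rewrite [LHS](comor_counit m) counit_tens. Qed.
Fact gcounit1 : counit (1 : go_type) = 1. Proof. exact: (go_gl G).2. Qed.
Fact gantipodel (x : go_type) :
  \swe_(x1, x2 <- x) gantipode x1 * x2 = counit x *: 1.
Proof.
have <- : gop m (ccomp (go_inv G) (comor_id P)) (comor_id P) x = counit x *: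
  go_one G.
  by rewrite go_opVl.
by rewrite /gop ccompE cpairE (lift_lin _ _ (comor_lin m)).
Qed.
Fact gantipoder (x : go_type) :
  \swe_(x1, x2 <- x) x1 * gantipode x2 = counit x *: 1.
Proof.
have <- : gop m (comor_id P) (ccomp (go_inv G) (comor_id P)) x = counit x *:
  go_one G.
  by rewrite go_opVr.
by rewrite /gop ccompE cpairE (lift_lin _ _ (comor_lin m)).
Qed.
HB.instance Definition _ := Coalgebra_isHopf.Build k go_type
  gcomulM gcomul1 gcounitM gcounit1 gantipodel gantipoder.

Fact go_cocommutative : cocommutative go_type. Proof. exact: (@cocoalgP _ P). Qed.
Definition go_cohopf : cohopf k :=
  exist _ (go_type : hopfType k) go_cocommutative.

Definition go_in : comor P go_cohopf :=
  @Comor k P go_cohopf id (@lin_id _ _) (fun x => tensE (comul x))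
    (fun x => erefl).
Definition go_out : comor go_cohopf P :=
  @Comor k go_cohopf P id (@lin_id _ _) (fun x => tensE (comul x))
    (fun x => erefl).

Lemma go_inM (C : cocoalg k) (x y : comor C P) :
  ccomp go_in (gop m x y) =
    ((ccomp go_in x : pt C go_cohopf) * (ccomp go_in y : pt C go_cohopf))%g.
Proof.
apply: comorP => c; rewrite [RHS]cmul_pair.
exact: (lift_lin _ _ (comor_lin m)).
Qed.
End Build.

(** The isomorphism matters because the carrier of A is an opaque copy: all later
arguments use only the bijection on points and its multiplicativity. *)
Lemma represent (G : group_object) :
  {A : cohopf k & {i : comor (go_car G) A & {j : comor A (go_car G) |
    [/\ ccomp i j = comor_id _, ccomp j i = comor_id _ &
     forall (C : cocoalg k) (x y : comor C (go_car G)),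
      ccomp i (gop (@go_mul G) x y) =
        ((ccomp i x : pt C A) * (ccomp i y : pt C A))%g]}}}.
Proof.
exists (go_cohopf G), (go_in G), (go_out G).
by split; [exact: comorP | exact: comorP | exact: go_inM].
Qed.

End GroupObject.

(** * Splitting of idempotent coalgebra endomorphisms *)

(** The fixed points of an idempotent coalgebra endomorphism p form a coalgebra
with comultiplication p(x1) (x) p(x2). Describing the kernel of a split
epimorphism as a retract in this way avoids showing that the tensor square of a
subspace embeds in the tensor square of the whole space. *)
Section SplitIdempotent.
Variables (k : fieldType) (A : cocoalg k) (p : comor A A).
Hypothesis pK : forall x, p (p x) = p x.

Definition fixpred : {pred A} := fun x => p x == x.
Fact fixpred_submod : submod_closed fixpred.
Proof.
split=> [|c x y]; first by apply/eqP; rewrite (lin0 (comor_lin p)).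
by move=> /eqP hx /eqP hy; apply/eqP; rewrite (comor_lin p) hx hy.
Qed.
HB.instance Definition _ := GRing.isSubmodClosed.Build k A fixpred fixpred_submod.

Definition split_sub := {x : A | x \in fixpred}.
HB.instance Definition _ := Choice.on split_sub.
HB.instance Definition _ := SubType.on split_sub.
HB.instance Definition _ := [SubChoice_isSubLmodule of split_sub by <:].

(** The idempotence of p is an argument of the type because the coalgebra
structure depends on it. *)
Definition split_type of (forall x, p (p x) = p x) : Type := split_sub.
Local Notation K := (split_type pK).
HB.instance Definition _ := GRing.Lmodule.on K.

Fact split_in x : p x \in fixpred. Proof. by apply/eqP; exact: pK. Qed.
Definition split_proj (x : A) : K := exist _ (p x) (split_in x).
Definition split_val (x : K) : A := sval x.

Lemma split_projK : cancel split_val split_proj.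
Proof. by move=> x; apply: val_inj; apply/eqP; case: x. Qed.
Lemma split_valK x : split_val (split_proj x) = p x. Proof. by []. Qed.
Lemma split_proj_lin : lin split_proj.
Proof. by move=> c x y; apply: val_inj; rewrite /= (comor_lin p). Qed.
Lemma split_val_lin : lin split_val. Proof. by []. Qed.
Lemma split_projp x : split_proj (p x) = split_proj x.
Proof. by apply: val_inj; rewrite /= pK. Qed.

Let lin_proj (U : lmodType k) (f : U -> A) : lin f ->
  lin (fun x => split_proj (f x)).
Proof. by apply: lin_comp; exact: split_proj_lin. Qed.
Let lin_val (U : lmodType k) (f : U -> K) : lin f ->
  lin (fun x => split_val (f x)).
Proof. by apply: lin_comp; exact: split_val_lin. Qed.
Ltac lin_atom ::= first [apply: lin_comor | apply: lin_proj | apply: lin_val].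

Definition split_comul (x : K) : (K \ot K)%type :=
  \swe_(a, b <- split_val x) split_proj a \ot split_proj b.
Definition split_counit (x : K) : k := counit (split_val x).
Fact split_comul_lin : linear split_comul.
Proof. by apply: lin_lift_arg; [lin_tac | apply: lin_comul; lin_tac]. Qed.
Fact split_counit_lin : scalar split_counit.
Proof. by apply: sca_counit; lin_tac. Qed.
HB.instance Definition _ :=
  GRing.isLinear.Build k K (K \ot K)%type *:%R split_comul split_comul_lin.
HB.instance Definition _ :=
  GRing.isLinear.Build k K k *%R split_counit split_counit_lin.

Lemma split_comul_proj x : split_comul (split_proj x) =
  \swe_(a, b <- x) split_proj a \ot split_proj b.
Proof.
rewrite /split_comul split_valK swe_comor; last by lin_tac.
by apply: eq_tens_lift => a b; rewrite !split_projp.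
Qed.

Fact split_comulA (x : K) :
  tens_lift (fun x1 x2 =>
    tens_lift (fun y z => y \ot (z \ot x2)) (split_comul x1))
      (split_comul x)
    = tens_lift (fun x1 x2 =>
      tens_lift (fun y z => x1 \ot (y \ot z)) (split_comul x2))
      (split_comul x).
Proof.
pose r := split_proj.
transitivity (\swe_(a, b <- split_val x) \swe_(a1, a2 <- a) r a1 \ot
  (r a2 \ot r b)).
  rewrite [X in tens_lift _ X = _]/split_comul lift_lift; last first.
    by lin_tac; exact: (split_comul_lin : lin split_comul).
  apply: eq_tens_lift => a b; rewrite lift_tens; last first.
    by lin_tac; exact: (split_comul_lin : lin split_comul).
  rewrite split_comul_proj lift_lift; last by lin_tac.
  by apply: eq_tens_lift => c d; rewrite lift_tens //; lin_tac.
rewrite (@swe_coassoc _ _ _ (fun a b c => r a \ot (r b \ot r c)));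
  try by move=> *; rewrite /r; lin_tac.
symmetry; rewrite [X in tens_lift _ X = _]/split_comul lift_lift; last first.
  by lin_tac; exact: (split_comul_lin : lin split_comul).
apply: eq_tens_lift => a b; rewrite lift_tens; last first.
  by lin_tac; exact: (split_comul_lin : lin split_comul).
rewrite split_comul_proj lift_lift; last by lin_tac.
by apply: eq_tens_lift => c d; rewrite lift_tens //; lin_tac.
Qed.
Let counit_proj x : split_counit (split_proj x) = counit x.
Proof. by rewrite /split_counit split_valK comor_counit. Qed.
Fact split_counitl (x : K) :
  tens_lift (fun x1 x2 => split_counit x1 *: x2) (split_comul x) = x.
Proof.
have b : bil (fun x1 x2 : K => split_counit x1 *: x2).
  by split=> ? /=; [apply: lin_scalar; exact: split_counit_lin | lin_tac].
rewrite /split_comul lift_lift // -[RHS]split_projK.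
rewrite -(@swe_counitl _ _ _ split_proj); last exact: split_proj_lin.
by apply: eq_tens_lift => u v; rewrite lift_tens // counit_proj.
Qed.
Fact split_counitr (x : K) :
  tens_lift (fun x1 x2 => split_counit x2 *: x1) (split_comul x) = x.
Proof.
have b : bil (fun x1 x2 : K => split_counit x2 *: x1).
  by split=> ? /=; [lin_tac | apply: lin_scalar; exact: split_counit_lin].
rewrite /split_comul lift_lift // -[RHS]split_projK.
rewrite -(@swe_counitr _ _ _ split_proj); last exact: split_proj_lin.
by apply: eq_tens_lift => u v; rewrite lift_tens // counit_proj.
Qed.
HB.instance Definition _ := isCoalgebra.Build k K
  split_comulA split_counitl split_counitr.

Fact split_cocomm : cocommutative K.
Proof.
move=> x; rewrite [comul x]/(split_comul x) /split_comul lift_lift;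
  last by lin_tac.
rewrite [RHS](swe_cocomm _ (@cocoalgP _ A)); last by lin_tac.
by apply: eq_tens_lift => u v; rewrite lift_tens //; lin_tac.
Qed.
Definition split_cco : cocoalg k := Cocoalg split_cocomm.

Fact split_val_comul (x : K) : comul (split_val x) =
  \swe_(x1, x2 <- x) split_val x1 \ot split_val x2.
Proof.
rewrite [comul x in RHS]/(split_comul x) /split_comul lift_lift; last by lin_tac.
rewrite -{1}[x]split_projK split_valK comor_comul.
by apply: eq_tens_lift => u v; rewrite lift_tens //; lin_tac.
Qed.
Definition split_i : comor split_cco A :=
  @Comor k split_cco A split_val split_val_lin split_val_comul (fun=> erefl).
Fact split_proj_comul (x : A) : comul (split_proj x) =
  \swe_(x1, x2 <- x) split_proj x1 \ot split_proj x2.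
Proof. exact: split_comul_proj. Qed.
Definition split_r : comor A split_cco :=
  @Comor k A split_cco split_proj split_proj_lin split_proj_comul counit_proj.
End SplitIdempotent.
Ltac lin_atom ::= apply: lin_comor.

Lemma split_idempotent (k : fieldType) (A : cocoalg k) (p : comor A A) :
  ccomp p p = p ->
  {K : cocoalg k & {i : comor K A & {r : comor A K |
    ccomp r i = comor_id K /\ ccomp i r = p}}}.
Proof.
move=> pp.
have pK x : p (p x) = p x by rewrite -[in RHS]pp.
exists (split_cco pK), (split_i pK), (split_r pK).
split; last exact: comorP.
by apply: comorP => x; exact: split_projK.
Qed.

(** * Split extensions and kernels *)

Section Basics.
Local Open Scope group_scope.
Variable k : fieldType.
Implicit Types (C : cocoalg k) (A B H : cohopf k).

Lemma ccompA (C D E F : coalgType k) (h : comor E F) (g : comor D E)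
  (f : comor C D) :
  ccomp h (ccomp g f) = ccomp (ccomp h g) f.
Proof. exact: comorP. Qed.

Lemma comor_split_inj (C D : cocoalg k) (i : comor C D) (r : comor D C) X
  (x y : comor X C) :
  ccomp r i = comor_id C -> ccomp i x = ccomp i y -> x = y.
Proof.
by move=> ri e; rewrite -(ccomp_idl x) -(ccomp_idl y) -ri -!ccompA e.
Qed.

Lemma app_res C C' A B (f : comor A B) (u : comor C' C) (x : pt C A) :
  app f (ccomp x u : pt C' A) = ccomp (app f x) u.
Proof. exact: comorP. Qed.

Lemma happ_ccomp C C' A B (f : hopf_hom A B) (u : comor C' C) (x : pt C A) :
  happ f (ccomp x u : pt C' A) = ccomp (happ f x) u.
Proof. exact: comorP. Qed.

Lemma ccomp_one C A (D : coalgType k) (f : comor A D) (g : D) (gl : grouplike g) :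
  f (GRing.one A) = g -> ccomp f (1 : pt C A) = cconst C gl.
Proof. by move=> fg; apply: comorP => c /=;
  rewrite (linZ _ _ (comor_lin f)) fg. Qed.

End Basics.

(** A split extension B -> A -> H of cocommutative Hopf algebras. The retraction
[sx_r] of A onto the kernel of [sx_s], a |-> a e(s a)^-1, is only a coalgebra
morphism. *)
Record splitext (k : fieldType) (B A H : cohopf k) := SplitExt {
  sx_i : hopf_hom B A;
  sx_s : hopf_hom A H;
  sx_e : hopf_hom H A;
  sx_r : comor A B;
  sx_se : forall (C : cocoalg k) (h : pt C H), happ sx_s (happ sx_e h) = h;
  sx_si : forall (C : cocoalg k) (b : pt C B), happ sx_s (happ sx_i b) = 1%g;
  sx_ri : forall (C : cocoalg k) (b : pt C B), app sx_r (happ sx_i b) = b;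
  sx_ir : forall (C : cocoalg k) (a : pt C A),
    happ sx_i (app sx_r a) = (a * (happ sx_e (happ sx_s a))^-1)%g
}.

Section Kernel.
Local Open Scope group_scope.
Variables (k : fieldType) (A H : cohopf k).
Variables (s : hopf_hom A H) (e : hopf_hom H A).
Hypothesis se : forall (C : cocoalg k) (h : pt C H), happ s (happ e h) = h.

Let p : pt A A := upt A * (happ e (happ s (upt A)))^-1.

Let pE C (x : pt C A) : ccomp p x = x * (happ e (happ s x))^-1.
Proof. by rewrite /p res_mul res_inv -!happ_ccomp ccomp_idl. Qed.

Let sp C (x : pt C A) : happ s (x * (happ e (happ s x))^-1) = 1.
Proof. by rewrite happM happV se mulgV. Qed.

Let pp : ccomp p p = p.
Proof. by rewrite pE sp happ1 invg1 mulg1. Qed.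

(** The coalgebra endomorphism p : a |-> a e(s a)^-1 is idempotent and on points
its image is the kernel of s, a subgroup. So the coalgebra that splits p is a
group object. *)
Lemma kernel_splitext :
  {K : cohopf k & {x : splitext K A H | sx_s x = s /\ sx_e x = e}}.
Proof.
have [P [i [r [ri ir]]]] := split_idempotent pp.
pose u1 : pt (cprod P P) A := ccomp i (cp1 P P).
pose u2 : pt (cprod P P) A := ccomp i (cp2 P P).
pose m : comor (cprod P P) P := ccomp r (u1 * u2 : pt _ A).
have si (C : cocoalg k) (x : comor C P) : happ s (ccomp i x : pt C A) = 1.
  have -> : ccomp i x = ccomp p (ccomp i x : pt C A).
    by rewrite -ir -ccompA (ccompA r) ri ccomp_idl.
  by rewrite pE sp.
have pi C (a : pt C A) : happ s a = 1 -> ccomp i (ccomp r a) = a.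
  by move=> sa; rewrite ccompA ir pE sa happ1 invg1 mulg1.
have iM (C : cocoalg k) (x y : comor C P) :
  ccomp i (gop m x y) = (ccomp i x : pt C A) * (ccomp i y : pt C A).
  rewrite /gop /m -ccompA pi; last first.
    by rewrite happ_ccomp happM !si mulg1 res_one.
  by rewrite res_mul /u1 /u2 -!ccompA cp1_pair cp2_pair.
have gl : grouplike (r (GRing.one A)).
  by split; rewrite ?comor_comul ?comor_counit ?counit1 // comul1 lift_tens //;
    split=> ? /=; [apply: lin_tensl | apply: lin_tensr]; exact: lin_comor.
have i1 (C : cocoalg k) : ccomp i (cconst C gl) = 1 :> pt C A.
  have <- : ccomp r (1 : pt C A) = cconst C gl by exact: ccomp_one.
  by apply: pi; rewrite happ1.
pose v : comor P P := ccomp r ((i : pt P A)^-1 : pt P A).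
have iV (C : cocoalg k) (x : comor C P) : ccomp i (ccomp v x) =
  (ccomp i x : pt C A)^-1.
  by rewrite /v -ccompA res_inv pi // happV si invg1.
have inj (C : cocoalg k) (x y : comor C P) : ccomp i x = ccomp i y -> x = y.
  exact: comor_split_inj ri.
have hA (C : cocoalg k) (x y z : comor C P) : gop m x (gop m y z) =
  gop m (gop m x y) z.
  by apply: inj; rewrite !iM mulgA.
have h1l (C : cocoalg k) (x : comor C P) : gop m (cconst C gl) x = x.
  by apply: inj; rewrite iM i1 mul1g.
have h1r (C : cocoalg k) (x : comor C P) : gop m x (cconst C gl) = x.
  by apply: inj; rewrite iM i1 mulg1.
have hVl (C : cocoalg k) (x : comor C P) : gop m (ccomp v x) x = cconst C gl.
  by apply: inj; rewrite iM iV i1 mulVg.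
have hVr (C : cocoalg k) (x : comor C P) : gop m x (ccomp v x) = cconst C gl.
  by apply: inj; rewrite iM iV i1 mulgV.
have [K [j [l [jl lj jM]]]] := represent (GroupObject hA h1l h1r hVl hVr).
rewrite /= in j l jl lj jM.
have ilM C (x y : pt C K) :
  app (ccomp i l) (x * y) = app (ccomp i l) x * app (ccomp i l) y.
  rewrite -[x]ccomp_idl -[y]ccomp_idl -jl -!ccompA -jM /app -!ccompA.
  rewrite (ccompA l) lj ccomp_idl iM.
  by rewrite !(ccompA l j) lj !ccomp_idl.
pose ih := mkhom ilM.
exists K.
unshelve eexists (@SplitExt k K A H ih s e (ccomp j r) se _ _ _) => //.
- by move=> C b; rewrite happ_mkhom /app -ccompA si.
- move=> C b; rewrite happ_mkhom /app -!ccompA (ccompA r) ri ccomp_idl.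
  by rewrite (ccompA j) jl ccomp_idl.
- move=> C a; rewrite happ_mkhom /app -!ccompA (ccompA l) lj ccomp_idl.
  by rewrite ccompA ir pE.
Qed.
End Kernel.

(** * Actions and semidirect products *)

Section Actions.
Local Open Scope group_scope.
Variable k : fieldType.
Implicit Types (C : cocoalg k) (A B H : cohopf k).

Definition pact H B (a : comor (cprod H B) B) C (h : pt C H) (b : pt C B) :
  pt C B :=
  ccomp a (cpair h b).

Record action H B := Action {
  act_mor :> comor (cprod H B) B;
  act_1 : forall C (b : pt C B), pact act_mor 1 b = b;
  act_M : forall C (g h : pt C H) (b : pt C B),
    pact act_mor (g * h) b = pact act_mor g (pact act_mor h b);
  act_D : forall C (h : pt C H) (b c : pt C B),
    pact act_mor h (b * c) = pact act_mor h b * pact act_mor h c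
}.

Section PactTheory.
Variables (H B : cohopf k) (a : action H B).

Lemma pact_res C C' (u : comor C' C) (h : pt C H) (b : pt C B) :
  ccomp (pact a h b) u = pact a (ccomp h u : pt C' H) (ccomp b u : pt C' B).
Proof. by rewrite /pact -cpair_comp ccompA. Qed.

Lemma pact1r C (h : pt C H) : pact a h 1 = 1.
Proof. by apply: (mulgI (pact a h 1)); rewrite -act_D !mulg1. Qed.

(** The semidirect product has coalgebra B (x) H, whose points are pairs (b, h),
and multiplication (b, h) (b', h') = (b h.b', h h'). The identity recorded here,
e(h) i(b) = i(h.b) e(h), determines the group law because every point is
uniquely i(b) e(h). *)
Lemma smash_splitext : {S : cohopf k & {x : splitext B S H |
  forall C (h : pt C H) (b : pt C B),
    happ (sx_e x) h * happ (sx_i x) b =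
      happ (sx_i x) (pact a h b) * happ (sx_e x) h}}.
Proof.
pose P := cprod B H.
pose pb C (x : comor C P) : pt C B := ccomp (cp1 B H) x.
pose ph C (x : comor C P) : pt C H := ccomp (cp2 B H) x.
pose mk C (b : pt C B) (h : pt C H) : comor C P := cpair b h.
have pbmk C b h : pb _ (mk C b h) = b by exact: cp1_pair.
have phmk C b h : ph _ (mk C b h) = h by exact: cp2_pair.
have mkE C (x y : comor C P) : pb _ x = pb _ y -> ph _ x = ph _ y -> x = y.
  by move=> e1 e2; rewrite -(cpair_eta x) -(cpair_eta y); congr cpair.
pose sm C (x y : comor C P) : comor C P :=
  mk C (pb _ x * pact a (ph _ x) (pb _ y)) (ph _ x * ph _ y).
pose m : comor (cprod P P) P := sm _ (cp1 P P) (cp2 P P).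
have mE C (x y : comor C P) : gop m x y = sm _ x y.
  apply: mkE; rewrite /pb /ph /gop /m /sm /mk ccompA ?cp1_pair ?cp2_pair.
    by rewrite res_mul pact_res /pb /ph -!ccompA cp1_pair cp2_pair.
  by rewrite res_mul /pb /ph -!ccompA cp1_pair cp2_pair.
have gl : grouplike ((1 : B)%R \ot (1 : H)%R : cprod B H).
  split; last by rewrite counit_tens !counit1 mulr1.
  rewrite comul_tens !comul1 lift_tens; last first.
    by split=> ? /=; apply: lin_lift => ? ?;
      [apply: lin_tensl | apply: lin_tensr]; lin_tac.
  by rewrite lift_tens //; lin_tac.
have oneE C : cconst C gl = mk C 1 1.
  apply: mkE; rewrite ?pbmk ?phmk; apply: comorP => c.
    by rewrite ccompE [X in cp1 _ _ X]/=
      (linZ _ _ (comor_lin (cp1 B H))) cp1E counit1 scale1r.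
  by rewrite ccompE [X in cp2 _ _ X]/=
    (linZ _ _ (comor_lin (cp2 B H))) cp2E counit1 scale1r.
pose v : comor P P :=
  mk P (pact a (ph _ (comor_id P))^-1 (pb _ (comor_id P))^-1)
  (ph _ (comor_id P))^-1.
have vE C (x : comor C P) :
  ccomp v x = mk C (pact a (ph _ x)^-1 (pb _ x)^-1) (ph _ x)^-1.
  apply: mkE; rewrite ?pbmk ?phmk /v /pb /ph ccompA /mk ?cp1_pair ?cp2_pair.
    by rewrite pact_res !res_inv -!ccompA ccomp_idl.
  by rewrite res_inv -ccompA ccomp_idl.
have hA C (x y z : comor C P) : gop m x (gop m y z) = gop m (gop m x y) z.
  by rewrite !mE /sm; apply: mkE; rewrite !pbmk !phmk ?act_D ?act_M ?mulgA.
have h1l C (x : comor C P) : gop m (cconst C gl) x = x.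
  by rewrite mE oneE /sm; apply: mkE; rewrite ?pbmk ?phmk ?act_1 mul1g.
have h1r C (x : comor C P) : gop m x (cconst C gl) = x.
  by rewrite mE oneE /sm; apply: mkE; rewrite ?pbmk ?phmk ?pact1r mulg1.
have hVl C (x : comor C P) : gop m (ccomp v x) x = cconst C gl.
  rewrite mE vE oneE /sm; apply: mkE; rewrite ?pbmk ?phmk ?mulVg //.
  by rewrite -act_D mulVg pact1r.
have hVr C (x : comor C P) : gop m x (ccomp v x) = cconst C gl.
  rewrite mE vE oneE /sm; apply: mkE; rewrite ?pbmk ?phmk ?mulgV //.
  by rewrite -act_M mulgV act_1 mulgV.
have [S [j [l [jl lj jM]]]] := represent (GroupObject hA h1l h1r hVl hVr).
rewrite /= in j l jl lj jM.
pose ci : comor B S := ccomp j (mk B (upt B) 1).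
pose ce : comor H S := ccomp j (mk H 1 (upt H)).
have mk_res C C' (u : comor C' C) b h : ccomp (mk C b h) u =
  mk C' (ccomp b u) (ccomp h u).
  exact: cpair_comp.
have ciE C (b : pt C B) : app ci b = ccomp j (mk C b 1).
  by rewrite /app /ci -ccompA mk_res ccomp_idl res_one.
have ceE C (h : pt C H) : app ce h = ccomp j (mk C 1 h).
  by rewrite /app /ce -ccompA mk_res ccomp_idl res_one.
have ciM C (x y : pt C B) : app ci (x * y) = app ci x * app ci y.
  by rewrite !ciE -jM mE /sm !pbmk !phmk act_1 mul1g.
have ceM C (x y : pt C H) : app ce (x * y) = app ce x * app ce y.
  by rewrite !ceE -jM mE /sm !pbmk !phmk pact1r mul1g.
have lM C (x y : pt C S) : ccomp l (x * y) = sm _ (ccomp l x) (ccomp l y).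
  rewrite -{1}[x]ccomp_idl -{1}[y]ccomp_idl -jl -!ccompA -jM.
  by rewrite ccompA lj ccomp_idl mE.
pose cs : comor S H := ph _ l.
have csE C (x : pt C S) : app cs x = ph _ (ccomp l x).
  by rewrite /app /cs /ph ccompA.
have csM C (x y : pt C S) : app cs (x * y) = app cs x * app cs y.
  by rewrite !csE lM /sm phmk.
have ljK C (x : comor C P) : ccomp l (ccomp j x) =
  x by rewrite ccompA lj ccomp_idl.
have jlK C (x : comor C S) : ccomp j (ccomp l x) =
  x by rewrite ccompA jl ccomp_idl.
exists S.
unshelve eexists (@SplitExt k B S H (mkhom ciM) (mkhom csM) (mkhom ceM) (pb _ l)
  _ _ _ _).
- by move=> C h; rewrite !happ_mkhom csE ceE ljK phmk.
- by move=> C b; rewrite !happ_mkhom csE ciE ljK phmk.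
- by move=> C b; rewrite !happ_mkhom ciE /app /pb -ccompA ljK; exact: cp1_pair.
- move=> C x; apply: (canRL (mulgK _)); rewrite !happ_mkhom ciE ceE csE -jM mE.
  rewrite -[RHS]jlK; congr ccomp; rewrite /sm !pbmk !phmk act_1 mulg1 mul1g.
  by apply: mkE; rewrite ?pbmk ?phmk // /app /pb ccompA.
- move=> C h b /=; rewrite !happ_mkhom !ciE !ceE -!jM !mE /sm !pbmk !phmk.
  by rewrite act_1 !mulg1 !mul1g.
Qed.

End PactTheory.
End Actions.

(** * Module structures and actions on points *)

Section Dictionary.
Variable k : fieldType.
Implicit Types (C D : cocoalg k) (A B H : cohopf k).

Lemma antipode_pt C A (x : pt C A) c : (x^-1)%g c = antipode (x c).
Proof. by rewrite [LHS]ccompE cantipodeE. Qed.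

Lemma pt_mulE C A (x y : pt C A) c :
  (x * y)%g c = \swe_(c1, c2 <- c) x c1 * y c2.
Proof. exact: cmul_pair. Qed.

(** The conjugate u v u^-1 has legs u(x1) v(x2) S(u(x3)); by cocommutativity the
last two can be exchanged, which is the order in which the equivariance and
Peiffer identities of crossed modules present them. *)
Lemma pt_conjE C A (u v : pt C A) c : (u * v * u^-1)%g c =
  \swe_(c1, c2 <- c) \swe_(a, b <- c1) u a * v c2 * antipode (u b).
Proof.
rewrite pt_mulE.
transitivity (\swe_(c1, c2 <- c) \swe_(a, b <- c1) u a * v b * antipode (u c2)).
  apply: eq_tens_lift => c1 c2; rewrite antipode_pt pt_mulE.
  by rewrite (@lift_lin _ _ _ _ _ (fun z => z * _)) //; lin_tac.
rewrite (@swe_coassoc _ _ _ (fun a b c => u a * v b * antipode (u c)));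
  try by move=> *; lin_tac.
rewrite (@swe_coassoc _ _ _ (fun a b c => u a * v c * antipode (u b)));
  try by move=> *; lin_tac.
apply: eq_tens_lift => c1 c2.
by rewrite (swe_cocomm _ (@cocoalgP _ C)) //; lin_tac.
Qed.

Lemma pt_mul_prod C D A (u v : pt (cprod C D) A) c d :
  (u * v)%g (c \ot d) =
  \swe_(c1, c2 <- c) \swe_(d1, d2 <- d) u (c1 \ot d1) * v (c2 \ot d2).
Proof.
rewrite pt_mulE comul_tens lift_lift; last by lin_tac.
apply: eq_tens_lift => c1 c2; rewrite lift_lift; last by lin_tac.
by apply: eq_tens_lift => d1 d2; rewrite lift_tens //; lin_tac.
Qed.

Lemma pt_mul_cp1 C D A (u : comor C A) (w : pt (cprod C D) A) c d :
  ((ccomp u (cp1 C D) : pt (cprod C D) A) * w)%g (c \ot d) =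
  \swe_(c1, c2 <- c) u c1 * w (c2 \ot d).
Proof.
rewrite pt_mul_prod; apply: eq_tens_lift => c1 c2.
rewrite -[RHS](@swe_counitl _ _ _ (fun d => u c1 * w (c2 \ot d)));
  last by lin_tac.
apply: eq_tens_lift => d1 d2.
by rewrite ccompE cp1E (linZ _ _ (comor_lin u)) scalerAl.
Qed.

Lemma pt_mul_cp2 C D A (v : comor D A) (w : pt (cprod C D) A) c d :
  ((ccomp v (cp2 C D) : pt (cprod C D) A) * w)%g (c \ot d) =
  \swe_(d1, d2 <- d) v d1 * w (c \ot d2).
Proof.
rewrite pt_mul_prod.
rewrite -(@swe_counitl _ _ _ (fun c => \swe_(d1, d2 <- d) v d1 * w (c \ot d2)));
  last by lin_tac.
apply: eq_tens_lift => c1 c2; rewrite -liftZ; apply: eq_tens_lift => d1 d2.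
by rewrite ccompE cp2E (linZ _ _ (comor_lin v)) scalerAl.
Qed.

(** At a pure tensor, conjugation gives the right-hand sides of the equivariance
and Peiffer identities. *)
Lemma pt_conj_tens C D A (u : comor C A) (v : comor D A) c d :
  ((ccomp u (cp1 C D) : pt (cprod C D) A) * (ccomp v (cp2 C D) : pt (cprod C D) A)
     * (ccomp u (cp1 C D) : pt (cprod C D) A)^-1)%g (c \ot d) =
  \swe_(c1, c2 <- c) u c1 * v d * antipode (u c2).
Proof.
rewrite -mulgA pt_mul_cp1; apply: eq_tens_lift => c1 c2; rewrite -mulrA.
congr (_ * _); rewrite pt_mul_cp2.
rewrite -[RHS](@swe_counitr _ _ _ (fun d => v d * antipode (u c2)));
  last by lin_tac.
apply: eq_tens_lift => d1 d2.
rewrite antipode_pt ccompE cp1E (linZ _ _ (comor_lin u)).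
by rewrite linearZ /= scalerAr.
Qed.

(** A module algebra and module coalgebra structure is an action on points: the
module coalgebra axioms make h (x) b |-> h.b a coalgebra morphism, and the
module algebra axiom is distributivity over products, where cocommutativity
brings the legs in order. *)
Section ToAction.
Variables (H B : cohopf k) (act : H -> B -> B).
Hypotheses (hm : hopf_module act) (ha : module_algebra act)
  (hc : module_coalgebra act).

Let act_bil : bil act.
Proof.
have [[h1 h2] _ _] := hm.
by split=> [b c x y|a c x y]; [exact: h1 | exact: h2].
Qed.
Let lin_actl (U : lmodType k) (f : U -> H) b : lin f ->
  lin (fun x => act (f x) b).
Proof. by apply: (lin_comp (act_bil.1 b)). Qed.
Let lin_actr (U : lmodType k) (f : U -> B) h : lin f ->
  lin (fun x => act h (f x)).
Proof. by apply: lin_comp; exact: (act_bil.2 h). Qed.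

Definition cact_fun (t : (H \ot B)%type) : B := tens_lift act t.
Fact cact_lin : lin cact_fun.
Proof. by apply: lin_lift_arg; [exact: act_bil | exact: lin_id]. Qed.
Fact cact_funE h b : cact_fun (h \ot b) = act h b.
Proof. by rewrite /cact_fun lift_tens //; exact: act_bil. Qed.
Let lin_cact (U : lmodType k) (f : U -> (H \ot B)%type) :
  lin f -> lin (fun x => cact_fun (f x)).
Proof. by apply: lin_comp; exact: cact_lin. Qed.
Ltac lin_atom ::= first
  [apply: lin_comor | apply: lin_cact | apply: lin_actl | apply: lin_actr].
Fact cact_comul t :
  comul (cact_fun t) = \swe_(t1, t2 <- t) cact_fun t1 \ot cact_fun t2.
Proof.
move: t; apply: lin_ext => [||h b].
- by lin_tac.
- by apply: lin_lift_arg; [lin_tac | apply: lin_comul; exact: lin_id].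
rewrite cact_funE hc.1 comul_tens lift_lift; last by lin_tac.
apply: eq_tens_lift => h1 h2; rewrite lift_lift; last by lin_tac.
apply: eq_tens_lift => b1 b2; rewrite lift_tens; last by lin_tac.
by rewrite !cact_funE.
Qed.
Fact cact_counit t : counit (cact_fun t) = counit t.
Proof.
move: t; apply: (@lin_ext _ _ _ k^o) => [||h b].
- by apply: sca_counit; lin_tac.
- by apply: sca_counit; lin_tac.
by rewrite cact_funE hc.2 counit_tens.
Qed.
Definition cact : comor (cprod H B) B := Comor cact_lin cact_comul cact_counit.

Lemma cactE h b : cact (h \ot b) = act h b. Proof. exact: cact_funE. Qed.

Lemma pact_cact C (h : pt C H) (b : pt C B) c :
  pact cact h b c = \swe_(c1, c2 <- c) act (h c1) (b c2).
Proof.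
rewrite ccompE cpairE (lift_lin _ _ (comor_lin cact)).
by apply: eq_tens_lift => x y; rewrite cactE.
Qed.

Fact cact_1 C (b : pt C B) : pact cact 1%g b = b.
Proof.
apply: comorP => c; rewrite pact_cact.
rewrite -[RHS](@swe_counitl _ _ _ b); last by lin_tac.
have [_ h1 _] := hm.
by apply: eq_tens_lift => x y /=; rewrite (linZ _ _ (act_bil.1 _)) h1.
Qed.
Fact cact_M C (g h : pt C H) (b : pt C B) :
  pact cact (g * h)%g b = pact cact g (pact cact h b).
Proof.
apply: comorP => c; rewrite !pact_cact; have [_ _ hM] := hm.
transitivity (\swe_(x, y <- c) \swe_(x1, x2 <- x) act (g x1 * h x2) (b y)).
  apply: eq_tens_lift => x y; rewrite pt_mulE.
  by rewrite (@lift_lin _ _ _ _ _ (fun z => act z _)) //; lin_tac.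
rewrite (@swe_coassoc _ _ _ (fun x1 x2 y => act (g x1 * h x2) (b y)));
  try by move=> *; lin_tac.
apply: eq_tens_lift => x y; rewrite pact_cact.
rewrite [RHS](@lift_lin _ _ _ _ _ (fun z => act _ z)); last by lin_tac.
by apply: eq_tens_lift => y1 y2; rewrite hM.
Qed.
Fact cact_D C (h : pt C H) (a b : pt C B) :
  pact cact h (a * b)%g = (pact cact h a * pact cact h b)%g.
Proof.
apply: comorP => c; rewrite pact_cact pt_mulE.
transitivity (\swe_(x, y <- c) \swe_(x1, x2 <- x) \swe_(y1, y2 <- y)
  act (h x1) (a y1) * act (h x2) (b y2)).
  apply: eq_tens_lift => x y; rewrite pt_mulE.
  rewrite (@lift_lin _ _ _ _ _ (fun z => act _ z)); last by lin_tac.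
  rewrite lift_exch; apply: eq_tens_lift => y1 y2; rewrite ha.1 swe_comor //.
  by lin_tac.
rewrite swe_swap; [|exact: cocoalgP|by move=> *; lin_tac..].
apply: eq_tens_lift => x y; rewrite !pact_cact.
rewrite [RHS](@lift_lin _ _ _ _ _ (fun z => z * _)); last by lin_tac.
apply: eq_tens_lift => ? ?.
by rewrite [RHS](@lift_lin _ _ _ _ _ (fun z => _ * z)) //; lin_tac.
Qed.
Definition action_of : action H B := Action cact_1 cact_M cact_D.

Variable f : hopf_hom B H.

Lemma equivariant_pt :
  (forall h b, f (act h b) = \swe_(h1, h2 <- h) h1 * f b * antipode h2) ->
  forall C (h : pt C H) (b : pt C B),
    happ f (pact cact h b) = (h * happ f b * h^-1)%g.
Proof.
move=> hf C h b; apply: comorP => c; rewrite pt_conjE ccompE pact_cact.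
rewrite (lift_lin _ _ (comor_lin (hom_comor f))).
apply: eq_tens_lift => x y; rewrite [LHS]hf swe_comor //.
by lin_tac.
Qed.

Lemma peiffer_pt :
  (forall b b', act (f b) b' = \swe_(b1, b2 <- b) b1 * b' * antipode b2) ->
  forall C (b b' : pt C B), pact cact (happ f b) b' = (b * b' * b^-1)%g.
Proof.
move=> hf C b b'; apply: comorP => c; rewrite pt_conjE pact_cact.
apply: eq_tens_lift => x y; rewrite [LHS]hf swe_comor //.
by lin_tac.
Qed.
End ToAction.

Ltac lin_atom ::= apply: lin_comor.

(** Conversely the laws of an action, at the projections of a tensor product, give
the module, module algebra and module coalgebra axioms. *)
Section OfAction.
Variables (H B : cohopf k) (a : action H B).
Definition act_of (h : H) (b : B) : B := a (h \ot b).

Lemma act_of_bil : bil act_of. Proof. by rewrite /act_of; lin_tac. Qed.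

Lemma act_of_module : hopf_module act_of.
Proof.
split; first exact: bilE act_of_bil.
- move=> b; have : pact a 1%g (upt B) b = b by rewrite act_1.
  rewrite /pact ccompE cpairE => e; rewrite -[RHS]e; congr (act_mor a _).
  rewrite -(@swe_counitl _ _ _ (fun x => 1 \ot x)); last by lin_tac.
  by apply: eq_tens_lift => x y /=; rewrite tensZl.
move=> g h b.
pose P := cprod H (cprod H B).
pose x : pt P H := cp1 H (cprod H B).
pose y : pt P H := ccomp (cp1 H B) (cp2 H (cprod H B)).
pose z : pt P B := ccomp (cp2 H B) (cp2 H (cprod H B)).
have := congr1 (fun u : comor P B => u (g \ot (h \ot b))) (act_M a x y z).
have -> : pact a (x * y)%g z =
  ccomp (ccomp a (cpair (ccomp (cmul H) (cp1 (cprod H H) B))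
    (ccomp (comor_id B) (cp2 (cprod H H) B)))) (cass H H B).
  rewrite /pact -ccompA cpair_comp; congr (ccomp _ (cpair _ _)).
    by rewrite -ccompA /cass cp1_pair.
  by rewrite ccomp_idl /cass cp2_pair.
have -> : pact a x (pact a y z) =
  ccomp a (cpair (ccomp (comor_id H) (cp1 H (cprod H B)))
    (ccomp a (cp2 H (cprod H B)))).
  rewrite /pact ccomp_idl; congr (ccomp _ (cpair _ (ccomp _ _))).
  by rewrite -cpair_comp cpair_proj ccomp_idl.
by rewrite [X in X = _ -> _]ccompE cassE !ccompE !cpair_tens cmulE.
Qed.

Lemma act_of_algebra : module_algebra act_of.
Proof.
split=> [h b c|h]; last first.
  have : pact a (upt H) 1%g h = counit h *: 1 by rewrite pact1r.
  rewrite /pact ccompE cpairE => <-; congr (act_mor a _).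
  rewrite -(@swe_counitr _ _ _ (fun x => x \ot 1)); last by lin_tac.
  by apply: eq_tens_lift => x y /=; rewrite tensZr.
pose P := cprod H (cprod B B).
pose x : pt P H := ccomp (comor_id H) (cp1 H (cprod B B)).
pose y : pt P B := ccomp (cp1 B B) (cp2 H (cprod B B)).
pose z : pt P B := ccomp (cp2 B B) (cp2 H (cprod B B)).
have := congr1 (fun u : comor P B => u (h \ot (b \ot c))) (act_D a x y z).
have -> : pact a x (y * z)%g =
  ccomp a (cpair x (ccomp (cmul B) (cp2 H (cprod B B)))).
  rewrite /pact; congr (ccomp _ (cpair _ (ccomp _ _))).
  by rewrite -cpair_comp cpair_proj ccomp_idl.
rewrite ccompE cpair_tens cmulE pt_mul_prod => e; apply: (etrans e).
apply: eq_tens_lift => h1 h2.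
pose L (t : (B \ot B)%type) :=
  tens_lift (fun u v => a (h1 \ot u) * a (h2 \ot v)) t.
have bL : bil (fun u v => a (h1 \ot u) * a (h2 \ot v)) by lin_tac.
have lL : lin L by apply: lin_lift_arg.
have <- : L (cpair (cp1 B B) (cp2 B B) (b \ot c)) = a (h1 \ot b) * a (h2 \ot c).
  by rewrite cpair_proj /L lift_tens.
rewrite cpairE (lift_lin _ _ lL); apply: eq_tens_lift => t1 t2.
by rewrite /L lift_tens // /pact !ccompE !cpair_tens.
Qed.

Lemma act_of_coalgebra : module_coalgebra act_of.
Proof.
split=> [h b|h b]; last by rewrite /act_of comor_counit counit_tens.
rewrite /act_of comor_comul comul_tens lift_lift; last by lin_tac.
apply: eq_tens_lift => h1 h2; rewrite lift_lift; last by lin_tac.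
by apply: eq_tens_lift => b1 b2; rewrite lift_tens //; lin_tac.
Qed.

Variable f : hopf_hom B H.

Lemma equivariant_of :
  (forall C (h : pt C H) (b : pt C B),
    happ f (pact a h b) = (h * happ f b * h^-1)%g) ->
  forall h b, f (act_of h b) = \swe_(h1, h2 <- h) h1 * f b * antipode h2.
Proof.
move=> hf h b.
have := congr1 (fun u : comor _ H => u (h \ot b))
  (hf (cprod H B) (ccomp (comor_id H) (cp1 H B)) (ccomp (comor_id B) (cp2 H B))).
rewrite /happ (ccompA _ (comor_id B)) pt_conj_tens => <-.
by rewrite /pact !ccompE cpair_tens.
Qed.

Lemma peiffer_of :
  (forall C (b b' : pt C B), pact a (happ f b) b' = (b * b' * b^-1)%g) ->
  forall b b', act_of (f b) b' = \swe_(b1, b2 <- b) b1 * b' * antipode b2.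
Proof.
move=> hf b b'.
have := congr1 (fun u : comor _ B => u (b \ot b'))
  (hf (cprod B B) (ccomp (comor_id B) (cp1 B B)) (ccomp (comor_id B) (cp2 B B))).
rewrite /happ ccompA pt_conj_tens => <-.
by rewrite /pact !ccompE cpair_tens.
Qed.
End OfAction.

End Dictionary.

(** * Split extensions and fibre products *)

Local Open Scope group_scope.
Local Open Scope category_scope.

Section SplitExtTheory.
Variables (k : fieldType) (B A H : cohopf k) (x : splitext B A H).
Implicit Types (C : cocoalg k).
Local Notation i := (happ (sx_i x)).
Local Notation s := (happ (sx_s x)).
Local Notation e := (happ (sx_e x)).
Local Notation r := (app (sx_r x)).

Lemma sx_i_inj C (b b' : pt C B) : i b = i b' -> b = b'.
Proof. by move=> h; rewrite -(sx_ri x b) h sx_ri. Qed.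

Lemma sx_irK C (a : pt C A) : s a = 1 -> i (r a) = a.
Proof. by move=> h; rewrite sx_ir h happ1 invg1 mulg1. Qed.

Lemma sx_decomp C (a : pt C A) : i (r a) * e (s a) = a.
Proof. by rewrite sx_ir mulgVK. Qed.

Lemma sx_s_mk C (b : pt C B) (h : pt C H) : s (i b * e h) = h.
Proof. by rewrite happM sx_si sx_se mul1g. Qed.

Lemma sx_r_mk C (b : pt C B) (h : pt C H) : r (i b * e h) = b.
Proof. by apply: sx_i_inj; rewrite sx_ir sx_s_mk mulgK. Qed.

(** The conjugate lies in the kernel of s, so the retraction turns it into a point
of B. *)
Definition sx_conj C (h : pt C H) (b : pt C B) : pt C B :=
  r (e h * i b * (e h)^-1).

Lemma sx_conjE C (h : pt C H) (b : pt C B) : i (sx_conj h b) =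
  e h * i b * (e h)^-1.
Proof. by apply: sx_irK; rewrite !happM happV sx_se sx_si mulg1 mulgV. Qed.

Definition sx_act_mor : comor (cprod H B) B :=
  sx_conj (cp1 H B : pt (cprod H B) H) (cp2 H B : pt (cprod H B) B).

Lemma sx_actE C (h : pt C H) (b : pt C B) : pact sx_act_mor h b = sx_conj h b.
Proof.
rewrite /pact /sx_act_mor /sx_conj -app_res !res_mul res_inv -!happ_ccomp.
by rewrite cp1_pair cp2_pair.
Qed.

Fact sx_act_1 C (b : pt C B) : pact sx_act_mor 1 b = b.
Proof. by rewrite sx_actE; apply: sx_i_inj;
  rewrite sx_conjE happ1 invg1 mulg1 mul1g. Qed.
Fact sx_act_M C (g h : pt C H) (b : pt C B) :
  pact sx_act_mor (g * h) b = pact sx_act_mor g (pact sx_act_mor h b).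
Proof.
by rewrite !sx_actE; apply: sx_i_inj; rewrite !sx_conjE happM invgM !mulgA.
Qed.
Fact sx_act_D C (h : pt C H) (b c : pt C B) :
  pact sx_act_mor h (b * c) = pact sx_act_mor h b * pact sx_act_mor h c.
Proof.
rewrite !sx_actE; apply: sx_i_inj; rewrite !(sx_conjE, happM) !mulgA.
by rewrite mulgVK.
Qed.
Definition sx_act : action H B := Action sx_act_1 sx_act_M sx_act_D.

Lemma sx_act_conj C (h : pt C H) (b : pt C B) :
  i (pact sx_act h b) = e h * i b * (e h)^-1.
Proof. by rewrite sx_actE sx_conjE. Qed.

End SplitExtTheory.

Section ActAlong.
Variables (k : fieldType) (A H B : cohopf k) (f : hopf_hom A H) (a : action H B).
Definition along_mor : comor (cprod A B) B :=
  pact a (happ f (cp1 A B : pt (cprod A B) A)) (cp2 A B : pt (cprod A B) B).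
Lemma alongE C (g : pt C A) (b : pt C B) : pact along_mor g b =
  pact a (happ f g) b.
Proof. by rewrite {1}/pact /along_mor pact_res -happ_ccomp cp1_pair cp2_pair. Qed.
Fact along_1 C (b : pt C B) : pact along_mor 1 b = b.
Proof. by rewrite alongE happ1 act_1. Qed.
Fact along_M C (g h : pt C A) (b : pt C B) :
  pact along_mor (g * h) b = pact along_mor g (pact along_mor h b).
Proof. by rewrite !alongE happM act_M. Qed.
Fact along_D C (h : pt C A) (b c : pt C B) :
  pact along_mor h (b * c) = pact along_mor h b * pact along_mor h c.
Proof. by rewrite !alongE act_D. Qed.
Definition along : action A B := Action along_1 along_M along_D.
End ActAlong.

Section HomPoints.
Variable k : fieldType.
Local Notation CH := (cocomm_hopf_algebras k).

(** [happ] for morphisms of the category of cocommutative Hopf algebras, so that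
compositions there can be rewritten. *)
Definition hap C (A B : cohopf k) (f : @hom CH A B) (x : pt C A) : pt C B :=
  happ (f : hopf_hom A B) x.

Lemma hap_comp C (A B D : cohopf k) (g : @hom CH B D) (f : @hom CH A B)
  (x : pt C A) :
  hap (g \oc f) x = hap g (hap f x).
Proof. exact: happ_comp. Qed.

Lemma hap_id C (A : cohopf k) (x : pt C A) : hap (@idm CH A) x = x.
Proof. exact: happ_id. Qed.

Lemma hom_pt (A B : cohopf k) (f g : @hom CH A B) :
  (forall C (x : pt C A), hap f x = hap g x) -> f = g.
Proof. exact: hopf_hom_pt. Qed.

Lemma hapM C (A B : cohopf k) (f : @hom CH A B) (x y : pt C A) :
  hap f (x * y) = hap f x * hap f y.
Proof. exact: happM. Qed.

Lemma hap1 C (A B : cohopf k) (f : @hom CH A B) : hap f (1 : pt C A) = 1.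
Proof. exact: happ1. Qed.

Lemma hapV C (A B : cohopf k) (f : @hom CH A B) (x : pt C A) : hap f x^-1 =
  (hap f x)^-1.
Proof. exact: happV. Qed.

Lemma hap_ccomp (C C' : cocoalg k) (A B : cohopf k) (f : @hom CH A B)
  (u : comor C' C) (x : pt C A) :
  hap f (ccomp x u : pt C' A) = ccomp (hap f x) u.
Proof. exact: comorP. Qed.
End HomPoints.

Section Pullback.
Variables (k : fieldType).
Local Notation CH := (cocomm_hopf_algebras k).
Variables (B A H A' : cohopf k) (x : splitext B A H) (t : @hom CH A' H).
Let s : @hom CH A H := sx_s x.

(** The fibre product is the semidirect product of B by A', where A' acts on B
through t: the point (b, a') corresponds to the pair a', i(b) e(t a'). A morphism
into it is built from its points, on which the two projections are jointly
injective. *)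
Lemma pullback_ex : {P : cohopf k & {p1 : @hom CH P A' & {p2 : @hom CH P A |
  is_pullback t s p1 p2 /\
  forall C (q q' : pt C P), hap p1 q = hap p1 q' -> hap p2 q = hap p2 q' -> q =
    q'}}}.
Proof.
have [P [z zE]] := smash_splitext (along t (sx_act x)).
pose cp : comor P A := happ (sx_i x) (sx_r z : pt P B) *
  happ (sx_e x) (happ t (happ (sx_s z) (upt P))).
have cpE C (q : pt C P) : app cp q =
  happ (sx_i x) (app (sx_r z) q) * happ (sx_e x) (happ t (happ (sx_s z) q)).
  by rewrite /app /cp res_mul -!happ_ccomp ccomp_idl.
have mkM C (b b' : pt C B) (a a' : pt C A') :
  (happ (sx_i z) b * happ (sx_e z) a) * (happ (sx_i z) b' * happ (sx_e z) a')
  = happ (sx_i z) (b * sx_conj x (happ t a) b') * happ (sx_e z) (a * a').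
  rewrite mulgA -(mulgA _ (happ _ a)) zE alongE /= sx_actE !happM.
  by rewrite !mulgA.
have cpM C (q q' : pt C P) : app cp (q * q') = app cp q * app cp q'.
  rewrite -{1}(sx_decomp z q) -{1}(sx_decomp z q') mkM !cpE sx_r_mk sx_s_mk.
  by rewrite !happM sx_conjE !mulgA mulgVK.
have p2E C (q : pt C P) : hap (mkhom cpM : @hom CH P A) q = _ := happ_mkhom cpM q.
have mono C (q q' : pt C P) : hap (sx_s z : @hom CH P A') q =
  hap (sx_s z : @hom CH P A') q' ->
  hap (mkhom cpM : @hom CH P A) q = hap (mkhom cpM : @hom CH P A) q' -> q = q'.
  rewrite !p2E !cpE => e1 e2.
  rewrite -(sx_decomp z q) -(sx_decomp z q').
  rewrite /hap in e1; rewrite e1 in e2 *; congr (happ _ _ * _).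
  by apply: (sx_i_inj (x := x)); apply: mulIg e2.
have univ (Q : cohopf k) (u : @hom CH Q A') (v : @hom CH Q A) : t \oc u =
  s \oc v ->
  exists! w : @hom CH Q P, (sx_s z : @hom CH P A') \oc w = u /\
    (mkhom cpM : @hom CH P A) \oc w = v.
move=> uv.
have uvE C (q : pt C Q) : hap t (hap u q) = hap s (hap v q).
  by rewrite -!hap_comp uv.
pose cw : comor Q P := happ (sx_i z) (app (sx_r x) (hap v (upt Q))) *
  happ (sx_e z) (hap u (upt Q)).
have cwE C (q : pt C Q) : app cw q =
  happ (sx_i z) (app (sx_r x) (hap v q)) * happ (sx_e z) (hap u q).
  by rewrite /app /cw res_mul -!happ_ccomp -!app_res -?hap_ccomp -?happ_ccomp
    !ccomp_idl.
have w1 C (q : pt C Q) : hap (sx_s z : @hom CH P A') (app cw q) = hap u q.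
  by rewrite cwE; exact: sx_s_mk.
have w2 C (q : pt C Q) : hap (mkhom cpM : @hom CH P A) (app cw q) = hap v q.
  rewrite cwE p2E cpE sx_r_mk sx_s_mk -[happ t _]/(hap t _) uvE.
  exact: sx_decomp.
have cwM C (q q' : pt C Q) : app cw (q * q') = app cw q * app cw q'.
  by apply: mono; rewrite hapM ?w1 ?w2 hapM.
exists (mkhom cwM : @hom CH Q P); split.
  split; apply: hom_pt => C q; rewrite hap_comp.
    by rewrite -w1; congr hap; exact: happ_mkhom.
  by rewrite -w2; congr hap; exact: happ_mkhom.
move=> w [wu wv]; apply: hom_pt => C q.
have -> : hap (mkhom cwM : @hom CH Q P) q = app cw q by exact: happ_mkhom.
by apply: mono; rewrite ?w1 ?w2 -hap_comp ?wu ?wv.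
exists P, (sx_s z), (mkhom cpM); split=> //; split; last first.
  exact: univ.
apply: hom_pt => C q; rewrite !hap_comp p2E cpE.
  by rewrite [RHS]sx_s_mk.
Qed.

(** All fibre products are isomorphic to the one of [pullback_ex], for which the
claim holds by construction. *)
Lemma pullback_mono (P : cohopf k) (p1 : @hom CH P A') (p2 : @hom CH P A) C
  (q q' : pt C P) :
  is_pullback t s p1 p2 -> hap p1 q = hap p1 q' -> hap p2 q = hap p2 q' -> q = q'.
Proof.
move=> [c1 u1] e1 e2; have [P0 [p10 [p20 [[c0 u0] mono]]]] := pullback_ex.
have [w [[w1 w2] _]] := u0 _ _ _ c1.
have [v [[v1 v2] _]] := u1 _ _ _ c0.
have [z [_ zu]] := u1 _ _ _ c1.
have vw : v \oc w = @idm CH P.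
  rewrite -(zu (v \oc w)) ?(zu (@idm CH P)) //.
    by rewrite !compm1.
  by rewrite !compA v1 v2.
rewrite -[q]hap_id -[q']hap_id -vw !hap_comp; congr hap.
by apply: mono; rewrite -!hap_comp ?w1 ?w2.
Qed.
End Pullback.

(** * From cat1-data to category objects *)

(** Loday's notion of cat1-group on points: [cd_peiffer] says that e(t a) and a
act in the same way on the kernel of the source, that is, that the kernels of
source and target commute. *)
Record cat1_datum (k : fieldType) := Cat1Datum {
  cd_B : cohopf k; cd_A : cohopf k; cd_H : cohopf k;
  cd_ext : splitext cd_B cd_A cd_H;
  cd_tgt : hopf_hom cd_A cd_H;
  cd_tgt_unit : forall (C : cocoalg k) (h : pt C cd_H),
    happ cd_tgt (happ (sx_e cd_ext) h) = h;
  cd_peiffer : forall (C : cocoalg k) (a : pt C cd_A) (b : pt C cd_B),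
    happ (sx_e cd_ext) (happ cd_tgt a) * happ (sx_i cd_ext) b
      * (happ (sx_e cd_ext) (happ cd_tgt a))^-1
    = a * happ (sx_i cd_ext) b * a^-1
}.

Section CategoryOfDatum.
Variables (k : fieldType) (g : cat1_datum k).
Local Notation CH := (cocomm_hopf_algebras k).
Local Notation B := (cd_B g).
Local Notation A := (cd_A g).
Local Notation H := (cd_H g).
Local Notation x := (cd_ext g).
Let s : @hom CH A H := sx_s x.
Let t : @hom CH A H := cd_tgt g.
Let e : @hom CH H A := sx_e x.

Let se C (h : pt C H) : hap s (hap e h) = h. Proof. exact: sx_se. Qed.
Let te C (h : pt C H) : hap t (hap e h) = h. Proof. exact: cd_tgt_unit. Qed.

(** For pairs (a, i(b) e(t a)) the composite is i(b) a, and the product with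
(a', i(b') e(t a')) has composite i(b) (a i(b') a^-1) a a' by [cd_peiffer],
which is the product of the composites. *)
Lemma datum_pairs : {P : cohopf k & {p1 : @hom CH P A & {p2 : @hom CH P A &
  {m : @hom CH P A | is_pullback t s p1 p2 /\
    forall C (q : pt C P),
      hap m q = hap p2 q * (hap e (hap s (hap p2 q)))^-1 * hap p1 q}}}}.
Proof.
have [P [p1 [p2 [pb mono]]]] := pullback_ex x t.
pose cm : comor P A :=
  hap p2 (upt P) * (hap e (hap s (hap p2 (upt P))))^-1 * hap p1 (upt P).
have cmE C (q : pt C P) :
  app cm q = hap p2 q * (hap e (hap s (hap p2 q)))^-1 * hap p1 q.
  by rewrite /app /cm !res_mul res_inv -!hap_ccomp ccomp_idl.
have ts C (q : pt C P) : hap s (hap p2 q) = hap t (hap p1 q).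
  by rewrite -!hap_comp pb.1.
have cmM C (q q' : pt C P) : app cm (q * q') = app cm q * app cm q'.
  rewrite !cmE !hapM !ts !invgM.
  set a := hap p1 q; set a' := hap p1 q'; set v := hap p2 q; set v' := hap p2 q'.
  have -> : v' = hap (sx_i x : @hom CH B A) (app (sx_r x) v') * hap e (hap t a').
    by rewrite -ts -[LHS](sx_decomp x v').
  set b := app _ _; set E := hap e (hap t a); set E' := hap e (hap t a').
  set b' := hap (sx_i x : @hom CH B A) b.
  have h : b' * E^-1 * a = E^-1 * a * b'.
    apply: (mulgI E); rewrite !mulgA mulgV mul1g.
    by rewrite [E * b' * E^-1](cd_peiffer a b) mulgVK.
  transitivity (v * (b' * E^-1 * a) * a'); first by rewrite !mulgA mulgK.
  by rewrite h !mulgA mulgK.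
exists P, p1, p2, (mkhom cmM); split; first exact: pb.
by move=> C q; rewrite -cmE; apply: happ_mkhom.
Qed.

Let P : cohopf k := projT1 datum_pairs.
Let p1 : @hom CH P A := projT1 (projT2 datum_pairs).
Let p2 : @hom CH P A := projT1 (projT2 (projT2 datum_pairs)).
Let m : @hom CH P A := proj1_sig (projT2 (projT2 (projT2 datum_pairs))).
Let pb : is_pullback t s p1 p2.
Proof. exact: (proj2_sig (projT2 (projT2 (projT2 datum_pairs)))).1. Qed.
Let mE C (q : pt C P) :
  hap m q = hap p2 q * (hap e (hap s (hap p2 q)))^-1 * hap p1 q.
Proof. exact: (proj2_sig (projT2 (projT2 (projT2 datum_pairs)))).2. Qed.
Let ts C (q : pt C P) : hap s (hap p2 q) = hap t (hap p1 q).
Proof. by rewrite -!hap_comp pb.1. Qed.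

Fact datum_src_unit : s \oc e = @idm CH H.
Proof. by apply: hom_pt => C q; rewrite hap_comp se hap_id. Qed.
Fact datum_tgt_unit : t \oc e = @idm CH H.
Proof. by apply: hom_pt => C q; rewrite hap_comp te hap_id. Qed.
Fact datum_src_comp : s \oc m = s \oc p1.
Proof.
by apply: hom_pt => C q; rewrite !hap_comp mE !hapM hapV se mulgV mul1g.
Qed.
Fact datum_tgt_comp : t \oc m = t \oc p2.
Proof.
by apply: hom_pt => C q; rewrite !hap_comp mE !hapM hapV te ts mulgVK.
Qed.
Fact datum_unitl (y : @hom CH A P) :
  p1 \oc y = e \oc s -> p2 \oc y = @idm CH A -> m \oc y = @idm CH A.
Proof.
move=> y1 y2; apply: hom_pt => C q.
by rewrite hap_comp mE -!(hap_comp _ y) y1 y2 hap_id hap_comp mulgVK.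
Qed.
Fact datum_unitr (y : @hom CH A P) :
  p1 \oc y = @idm CH A -> p2 \oc y = e \oc t -> m \oc y = @idm CH A.
Proof.
move=> y1 y2; apply: hom_pt => C q.
by rewrite hap_comp mE -!(hap_comp _ y) y1 y2 hap_id hap_comp se mulgV mul1g.
Qed.
Fact datum_assoc (Q : cohopf k) (q1 q2 l r : @hom CH Q P) :
  p2 \oc q1 = p1 \oc q2 ->
  p1 \oc l = m \oc q1 -> p2 \oc l = p2 \oc q2 ->
  p1 \oc r = p1 \oc q1 -> p2 \oc r = m \oc q2 ->
  m \oc l = m \oc r.
Proof.
move=> q12 l1 l2 r1 r2; apply: hom_pt => C q; rewrite !hap_comp.
rewrite !mE -!hap_comp l1 l2 r1 r2 !hap_comp !mE.
rewrite !hapM !hapV !se mulgV mul1g.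
have -> : hap p1 (hap q2 q) = hap p2 (hap q1 q).
  by rewrite -!hap_comp q12.
by rewrite !mulgA.
Qed.

Definition category_of_datum : category_object CH :=
  @CategoryObject CH A H s t e P p1 p2 m pb datum_src_unit datum_tgt_unit
    datum_src_comp datum_tgt_comp datum_unitl datum_unitr datum_assoc.

End CategoryOfDatum.

(** * From category objects to cat1-data, and crossed modules on points *)

Section DatumOfCategory.
Variable k : fieldType.
Local Notation CH := (cocomm_hopf_algebras k).
Variable Y : category_object CH.
Let A : cohopf k := co_arr Y.
Let H : cohopf k := co_obj Y.
Let P : cohopf k := co_pairs Y.
Let s : @hom CH A H := co_src Y.
Let t : @hom CH A H := co_tgt Y.
Let e : @hom CH H A := co_unit Y.
Let p1 : @hom CH P A := co_p1 Y.
Let p2 : @hom CH P A := co_p2 Y.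
Let m : @hom CH P A := co_comp Y.

Lemma category_src_unit C (h : pt C H) : hap s (hap e h) = h.
Proof. by rewrite -hap_comp -[RHS](@hap_id k C H) (co_src_unit Y). Qed.
Lemma category_tgt_unit C (h : pt C H) : hap t (hap e h) = h.
Proof. by rewrite -hap_comp -[RHS](@hap_id k C H) (co_tgt_unit Y). Qed.

Let K : cohopf k := projT1 (kernel_splitext category_src_unit).
Let x0 : splitext K A H := proj1_sig (projT2 (kernel_splitext category_src_unit)).
Let x0s : sx_s x0 = s. Proof. exact:
  (proj2_sig (projT2 (kernel_splitext category_src_unit))).1. Qed.
Let x0e : sx_e x0 = e. Proof. exact:
  (proj2_sig (projT2 (kernel_splitext category_src_unit))).2. Qed.

Fact category_src_ker (C : cocoalg k) (b : pt C K) : happ s (happ (sx_i x0) b) =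
  1.
Proof. by rewrite -x0s sx_si. Qed.
Fact category_ir (C : cocoalg k) (a : pt C A) :
  happ (sx_i x0) (app (sx_r x0) a) = a * (happ e (happ s a))^-1.
Proof. by rewrite -x0s -x0e sx_ir. Qed.
Definition category_splitext : splitext K A H :=
  SplitExt category_src_unit category_src_ker (sx_ri x0) category_ir.

Let mono C (q q' : pt C P) :
  hap p1 q = hap p1 q' -> hap p2 q = hap p2 q' -> q = q'.
Proof. exact: (pullback_mono (x := category_splitext) (co_pairsP Y)). Qed.

Let tE : t \oc @idm CH A = s \oc (e \oc t).
Proof. by apply: hom_pt => C q; rewrite !hap_comp hap_id category_src_unit. Qed.
Let sE : t \oc (e \oc s) = s \oc @idm CH A.
Proof. by apply: hom_pt => C q; rewrite !hap_comp hap_id category_tgt_unit. Qed.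

(** The Hopf algebra morphisms L a = (e(s a), a) and R a = (a, e(t a)) into the
object of composable pairs, on which the unit laws determine the composition. *)
Lemma unit_pairs : exists L R : @hom CH A P,
  [/\ forall C (a : pt C A), hap p1 (hap L a) = hap e (hap s a),
      forall C (a : pt C A), hap p2 (hap L a) = a &
      forall C (a : pt C A), hap m (hap L a) = a] /\
  [/\ forall C (a : pt C A), hap p1 (hap R a) = a,
      forall C (a : pt C A), hap p2 (hap R a) = hap e (hap t a) &
      forall C (a : pt C A), hap m (hap R a) = a].
Proof.
have pair_ex (u v : @hom CH A A) : t \oc u = s \oc v ->
  exists w : @hom CH A P, p1 \oc w = u /\ p2 \oc w = v.
  move=> uv; have [_ /(_ A u v uv) [w [w12 _]]] := co_pairsP Y.
  by exists w.
have [R [R1 R2]] := pair_ex _ _ tE; have [L [L1 L2]] := pair_ex _ _ sE.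
have mR : m \oc R = @idm CH A by exact: co_unitr R1 R2.
have mL : m \oc L = @idm CH A by exact: co_unitl L1 L2.
exists L, R; split; split=> C a; rewrite -hap_comp.
- by rewrite L1 hap_comp.
- by rewrite L2 hap_id.
- by rewrite mL hap_id.
- by rewrite R1 hap_id.
- by rewrite R2 hap_comp.
- by rewrite mR hap_id.
Qed.

(** In the group of composable pairs (a, a') is the product of (u, a'), (u, u)^-1
and (a, u), where u is the identity of the middle object. The composites of these
three pairs are given by the unit laws. *)
Lemma category_compE C (q : pt C P) :
  hap m q = hap p2 q * (hap e (hap s (hap p2 q)))^-1 * hap p1 q.
Proof.
have [L [R [[L1 L2 mL] [R1 R2 mR]]]] := unit_pairs.
have ts : hap s (hap p2 q) =
  hap t (hap p1 q) by rewrite -!hap_comp (co_pairsP Y).1.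
set a := hap p1 q; set a' := hap p2 q; set u := hap e (hap s a').
have -> : q = hap L a' * (hap L u)^-1 * hap R a.
  apply: mono; rewrite !hapM !hapV ?L1 ?L2 ?R1 ?R2.
    by rewrite /u category_src_unit mulgV mul1g.
  by rewrite /u ts mulgVK.
by rewrite !hapM !hapV !mL mR.
Qed.

(** Conjugating the pair (1, b) by (a, e(t a)) gives (1, e(t a) b e(t a)^-1).
Composition is a homomorphism, and the three pairs have composites b, a and
e(t a) b e(t a)^-1. *)
Lemma category_peiffer C (a : pt C A) (b : pt C A) : hap s b = 1 ->
  hap e (hap t a) * b * (hap e (hap t a))^-1 = a * b * a^-1.
Proof.
move=> sb; have [L [R [[L1 L2 mL] [R1 R2 mR]]]] := unit_pairs.
set w := LHS.
have sw : hap s w = 1 by rewrite /w !hapM hapV sb mulg1 mulgV.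
have -> : w = hap m (hap L w) by rewrite mL.
have -> : hap L w = hap R a * hap L b * (hap R a)^-1.
  apply: mono.
    by rewrite L1 sw !hapM !hapV L1 R1 sb !hap1 mulg1 mulgV.
  by rewrite L2 !hapM !hapV L2 R2.
by rewrite !hapM hapV mR mL.
Qed.

Fact category_cd_peiffer (C : cocoalg k) (a : pt C A) (b : pt C K) :
  happ e (happ t a) * happ (sx_i category_splitext) b * (happ e (happ t a))^-1
  = a * happ (sx_i category_splitext) b * a^-1.
Proof. by apply: category_peiffer; exact: category_src_ker. Qed.

Definition datum_of_category : cat1_datum k :=
  @Cat1Datum k K A H category_splitext t category_tgt_unit category_cd_peiffer.
End DatumOfCategory.

Record xmod (k : fieldType) := Xmod {
  xm_B : cohopf k; xm_H : cohopf k;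
  xm_g : hopf_hom xm_B xm_H;
  xm_a : action xm_H xm_B;
  xm_equivariant_pt : forall (C : cocoalg k) (h : pt C xm_H) (b : pt C xm_B),
    happ xm_g (pact xm_a h b) = h * happ xm_g b * h^-1;
  xm_peiffer_pt : forall (C : cocoalg k) (b b' : pt C xm_B),
    pact xm_a (happ xm_g b) b' = b * b' * b^-1
}.

Section Conversions.
Variable k : fieldType.

Definition xmod_of_crossed_module (X : crossed_module k)
  (cB : cocommutative (xm_top X))
    (cH : cocommutative (xm_base X)) : xmod k :=
  let B : cohopf k := exist _ (xm_top X) cB in
  let H : cohopf k := exist _ (xm_base X) cH in
  @Xmod k B H (xm_map X)
    (@action_of k H B _ (xm_module X) (xm_module_algebra X)
      (xm_module_coalgebra X))
    (@equivariant_pt k H B _ (xm_module X) (xm_module_coalgebra X) _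
      (@xm_equivariant k X))
    (@peiffer_pt k H B _ (xm_module X) (xm_module_coalgebra X) _
      (@xm_peiffer k X)).

Definition crossed_module_of_xmod (p : xmod k) : crossed_module k :=
  @CrossedModule k (xm_B p) (xm_H p) (xm_g p) (act_of (xm_a p))
    (act_of_module (xm_a p)) (act_of_algebra (xm_a p))
    (act_of_coalgebra (xm_a p)) (equivariant_of (@xm_equivariant_pt _ p))
    (peiffer_of (@xm_peiffer_pt _ p)).

Section XmodOfDatum.
Variable g : cat1_datum k.
Local Notation x := (cd_ext g).
Definition datum_map : hopf_hom (cd_B g) (cd_H g) :=
  hopf_comp (cd_tgt g) (sx_i x).
Fact datum_equivariant (C : cocoalg k) (h : pt C (cd_H g)) (b : pt C (cd_B g)) :
  happ datum_map (pact (sx_act x) h b) = h * happ datum_map b * h^-1.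
Proof. by rewrite !happ_comp sx_act_conj !happM happV cd_tgt_unit. Qed.
Fact datum_peiffer (C : cocoalg k) (b b' : pt C (cd_B g)) :
  pact (sx_act x) (happ datum_map b) b' = b * b' * b^-1.
Proof.
apply: (sx_i_inj (x := x)); rewrite sx_act_conj happ_comp cd_peiffer.
by rewrite !happM happV.
Qed.
Definition xmod_of_datum : xmod k := Xmod datum_equivariant datum_peiffer.
End XmodOfDatum.

Section DatumOfXmod.
Variable p : xmod k.
Let B := xm_B p.
Let H := xm_H p.
Let S : cohopf k := projT1 (smash_splitext (xm_a p)).
Definition smash_ext : splitext B S H :=
  proj1_sig (projT2 (smash_splitext (xm_a p))).
Lemma smash_extE C (h : pt C H) (b : pt C B) :
  happ (sx_e smash_ext) h * happ (sx_i smash_ext) b =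
  happ (sx_i smash_ext) (pact (xm_a p) h b) * happ (sx_e smash_ext) h.
Proof. exact: (proj2_sig (projT2 (smash_splitext (xm_a p)))). Qed.

Lemma smash_conj C (h : pt C H) (b : pt C B) :
  happ (sx_e smash_ext) h * happ (sx_i smash_ext) b *
    (happ (sx_e smash_ext) h)^-1 =
  happ (sx_i smash_ext) (pact (xm_a p) h b).
Proof. by rewrite smash_extE mulgK. Qed.

Lemma smash_act C (h : pt C H) (b : pt C B) :
  pact (sx_act smash_ext) h b = pact (xm_a p) h b.
Proof. by apply: (sx_i_inj (x := smash_ext)); rewrite sx_act_conj smash_conj. Qed.

End DatumOfXmod.
End Conversions.

(** * Morphisms of cat1-data *)

Section DatumOfXmod.
Variable k : fieldType.

Lemma sx_r_mul (B A H : cohopf k) (x : splitext B A H) C (q q' : pt C A) :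
  app (sx_r x) (q * q')
  = app (sx_r x) q * pact (sx_act x) (happ (sx_s x) q) (app (sx_r x) q').
Proof.
apply: (sx_i_inj (x := x)); rewrite happM sx_act_conj !sx_ir !happM invgM.
by rewrite !mulgA mulgVK.
Qed.

Lemma sx_r_e (B A H : cohopf k) (x : splitext B A H) C (h : pt C H) :
  app (sx_r x) (happ (sx_e x) h) = 1.
Proof. by rewrite -[happ _ h]mul1g -(happ1 C (sx_i x)) sx_r_mk. Qed.

Variable p : xmod k.
Let x := smash_ext p.

Definition smash_tgt_mor : comor (projT1 (smash_splitext (xm_a p))) (xm_H p) :=
  happ (xm_g p) (app (sx_r x) (upt _)) * happ (sx_s x) (upt _).
Lemma smash_tgt_morE C (q : pt C _) :
  app smash_tgt_mor q = happ (xm_g p) (app (sx_r x) q) * happ (sx_s x) q.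
Proof. by rewrite /app /smash_tgt_mor res_mul -!happ_ccomp -!app_res !ccomp_idl.
  Qed.
Fact smash_tgt_morM C (q q' : pt C (projT1 (smash_splitext (xm_a p)))) :
  app smash_tgt_mor (q * q') = app smash_tgt_mor q * app smash_tgt_mor q'.
Proof.
rewrite !smash_tgt_morE sx_r_mul !happM smash_act xm_equivariant_pt.
by rewrite !mulgA mulgVK.
Qed.
Definition smash_tgt := mkhom smash_tgt_morM.

Lemma smash_tgtE C (q : pt C _) :
  happ smash_tgt q = happ (xm_g p) (app (sx_r x) q) * happ (sx_s x) q.
Proof. by rewrite happ_mkhom smash_tgt_morE. Qed.

Lemma smash_tgt_ker C (b : pt C (xm_B p)) : happ smash_tgt (happ (sx_i x) b) =
  happ (xm_g p) b.
Proof. by rewrite smash_tgtE sx_ri sx_si mulg1. Qed.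

Fact smash_tgt_unit C (h : pt C (xm_H p)) : happ smash_tgt (happ (sx_e x) h) = h.
Proof. by rewrite smash_tgtE sx_r_e sx_se happ1 mul1g. Qed.

Fact smash_peiffer (C : cocoalg k) (a : pt C (projT1 (smash_splitext (xm_a p))))
  (b : pt C (xm_B p)) :
  happ (sx_e x) (happ smash_tgt a) * happ (sx_i x) b *
    (happ (sx_e x) (happ smash_tgt a))^-1
  = a * happ (sx_i x) b * a^-1.
Proof.
rewrite smash_conj smash_tgtE act_M xm_peiffer_pt -[in RHS](sx_decomp x a).
by rewrite invgM !happM happV -smash_conj !mulgA.
Qed.

Definition datum_of_xmod : cat1_datum k :=
  @Cat1Datum k _ _ _ x smash_tgt smash_tgt_unit smash_peiffer.
End DatumOfXmod.

(** A morphism (rho, sigma) of crossed modules extends to the total objects by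
i(b) e(h) |-> i(rho b) e(sigma h). Compatibility with the actions makes this
multiplicative, and compatibility with the maps to H gives that it commutes with
the targets. *)
Section Lift.
Variables (k : fieldType) (g g' : cat1_datum k).
Local Notation x := (cd_ext g).
Local Notation x' := (cd_ext g').
Variables (rho : hopf_hom (cd_B g) (cd_B g'))
  (sigma : hopf_hom (cd_H g) (cd_H g')).
Hypothesis hmap : forall (C : cocoalg k) (b : pt C (cd_B g)),
  happ (datum_map g') (happ rho b) = happ sigma (happ (datum_map g) b).
Hypothesis hact : forall (C : cocoalg k) (h : pt C (cd_H g)) (b : pt C (cd_B g)),
  happ rho (pact (sx_act x) h b) = pact (sx_act x') (happ sigma h) (happ rho b).

Definition lift_mor : comor (cd_A g) (cd_A g') :=
  happ (sx_i x') (happ rho (app (sx_r x) (upt _))) *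
  happ (sx_e x') (happ sigma (happ (sx_s x) (upt _))).
Lemma lift_morE C (q : pt C (cd_A g)) : app lift_mor q =
  happ (sx_i x') (happ rho (app (sx_r x) q)) *
  happ (sx_e x') (happ sigma (happ (sx_s x) q)).
Proof. by rewrite /app /lift_mor res_mul -!happ_ccomp -!app_res !ccomp_idl. Qed.
Fact lift_morM C (q q' : pt C (cd_A g)) :
  app lift_mor (q * q') = app lift_mor q * app lift_mor q'.
Proof.
rewrite !lift_morE sx_r_mul !happM hact sx_act_conj.
by rewrite !mulgA mulgVK.
Qed.
Definition lift_hom : hopf_hom (cd_A g) (cd_A g') := mkhom lift_morM.
Lemma lift_homE C (q : pt C (cd_A g)) : happ lift_hom q =
  happ (sx_i x') (happ rho (app (sx_r x) q)) *
  happ (sx_e x') (happ sigma (happ (sx_s x) q)).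
Proof. by rewrite happ_mkhom lift_morE. Qed.
Lemma lift_src C (q : pt C (cd_A g)) :
  happ (sx_s x') (happ lift_hom q) = happ sigma (happ (sx_s x) q).
Proof. by rewrite lift_homE sx_s_mk. Qed.
Lemma lift_tgt C (q : pt C (cd_A g)) :
  happ (cd_tgt g') (happ lift_hom q) = happ sigma (happ (cd_tgt g) q).
Proof.
rewrite lift_homE happM cd_tgt_unit -[in RHS](sx_decomp x q) !happM cd_tgt_unit.
congr (_ * _); have := hmap (app (sx_r x) q); by rewrite !happ_comp.
Qed.
Lemma lift_unit C (h : pt C (cd_H g)) :
  happ lift_hom (happ (sx_e x) h) = happ (sx_e x') (happ sigma h).
Proof. by rewrite lift_homE sx_r_e !happ1 mul1g sx_se. Qed.
Lemma lift_ker C (b : pt C (cd_B g)) :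
  happ lift_hom (happ (sx_i x) b) = happ (sx_i x') (happ rho b).
Proof. by rewrite lift_homE sx_ri sx_si !happ1 mulg1. Qed.
End Lift.

Section Restriction.
Variables (k : fieldType) (g g' : cat1_datum k).
Local Notation x := (cd_ext g).
Local Notation x' := (cd_ext g').

(** A morphism that commutes with the sources restricts to their kernels. *)
Section Restrict.
Variables (phi : hopf_hom (cd_A g) (cd_A g'))
  (sigma : hopf_hom (cd_H g) (cd_H g')).
Hypothesis hs : forall (C : cocoalg k) (q : pt C (cd_A g)),
  happ (sx_s x') (happ phi q) = happ sigma (happ (sx_s x) q).
Hypothesis ht : forall (C : cocoalg k) (q : pt C (cd_A g)),
  happ (cd_tgt g') (happ phi q) = happ sigma (happ (cd_tgt g) q).
Hypothesis he : forall (C : cocoalg k) (h : pt C (cd_H g)),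
  happ phi (happ (sx_e x) h) = happ (sx_e x') (happ sigma h).

Definition restr_mor : comor (cd_B g) (cd_B g') :=
  app (sx_r x') (happ phi (happ (sx_i x) (upt _))).
Lemma restr_morE C (b : pt C (cd_B g)) :
  app restr_mor b = app (sx_r x') (happ phi (happ (sx_i x) b)).
Proof. by rewrite {1}/app /restr_mor -app_res -!happ_ccomp ccomp_idl. Qed.
Lemma restr_mor_i C (b : pt C (cd_B g)) :
  happ (sx_i x') (app restr_mor b) = happ phi (happ (sx_i x) b).
Proof. by rewrite restr_morE sx_irK // hs sx_si happ1. Qed.
Fact restr_morM C (b c : pt C (cd_B g)) :
  app restr_mor (b * c) = app restr_mor b * app restr_mor c.
Proof. by apply: (sx_i_inj (x := x')); rewrite happM !restr_mor_i !happM. Qed.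
Definition restr_hom : hopf_hom (cd_B g) (cd_B g') := mkhom restr_morM.
Lemma restr_homE C (b : pt C (cd_B g)) :
  happ (sx_i x') (happ restr_hom b) = happ phi (happ (sx_i x) b).
Proof. by rewrite happ_mkhom restr_mor_i. Qed.
Lemma restr_map C (b : pt C (cd_B g)) :
  happ (datum_map g') (happ restr_hom b) = happ sigma (happ (datum_map g) b).
Proof. by rewrite !happ_comp restr_homE ht. Qed.
Lemma restr_act C (h : pt C (cd_H g)) (b : pt C (cd_B g)) :
  happ restr_hom (pact (sx_act x) h b) =
  pact (sx_act x') (happ sigma h) (happ restr_hom b).
Proof.
apply: (sx_i_inj (x := x')); rewrite sx_act_conj !restr_homE sx_act_conj.
by rewrite !happM happV he.
Qed.
End Restrict.
End Restriction.

(** By [category_compE] composition is expressed by source, unit and product, so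
a morphism that respects source, target and unit respects it. *)
Section CatHom.
Variable k : fieldType.
Local Notation CH := (cocomm_hopf_algebras k).
Variables (Y Y' : category_object CH).
Let A : cohopf k := co_arr Y.
Let H : cohopf k := co_obj Y.
Let A' : cohopf k := co_arr Y'.
Let H' : cohopf k := co_obj Y'.
Variables (phi : hopf_hom A A') (sigma : hopf_hom H H').
Hypothesis hs : forall (C : cocoalg k) (q : pt C A),
  hap (co_src Y' : @hom CH A' H') (happ phi q) =
    happ sigma (hap (co_src Y : @hom CH A H) q).
Hypothesis ht : forall (C : cocoalg k) (q : pt C A),
  hap (co_tgt Y' : @hom CH A' H') (happ phi q) =
    happ sigma (hap (co_tgt Y : @hom CH A H) q).
Hypothesis he : forall (C : cocoalg k) (h : pt C H),
  happ phi (hap (co_unit Y : @hom CH H A) h) =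
    hap (co_unit Y' : @hom CH H' A') (happ sigma h).
Let f : @hom CH A A' := phi.
Let f0 : @hom CH H H' := sigma.

Fact cat1_hom_src : co_src Y' \oc f = f0 \oc co_src Y.
Proof. by apply: (@hom_pt k A H') => C q; rewrite !(@hap_comp k C A) hs. Qed.
Fact cat1_hom_tgt : co_tgt Y' \oc f = f0 \oc co_tgt Y.
Proof. by apply: (@hom_pt k A H') => C q; rewrite !(@hap_comp k C A) ht. Qed.
Fact cat1_hom_unit : f \oc co_unit Y = co_unit Y' \oc f0.
Proof. by apply: (@hom_pt k H A') => C q; rewrite !(@hap_comp k C H) -he. Qed.
Fact cat1_hom_comp (y : hom (co_pairs Y) (co_pairs Y')) :
  co_p1 Y' \oc y = f \oc co_p1 Y -> co_p2 Y' \oc y = f \oc co_p2 Y ->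
  f \oc co_comp Y = co_comp Y' \oc y.
Proof.
pose P : cohopf k := co_pairs Y; pose P' : cohopf k := co_pairs Y'.
move=> y1 y2; apply: (@hom_pt k P A') => C q.
rewrite (@hap_comp k C P A A') (@hap_comp k C P P' A') !category_compE !hapM
  !hapV.
have e1 : hap (co_p1 Y' : @hom CH P' A') (hap (y : @hom CH P P') q)
   = hap f (hap (co_p1 Y : @hom CH P A) q).
  by rewrite -[LHS](@hap_comp k C P P' A') y1 (@hap_comp k C P A A').
have e2 : hap (co_p2 Y' : @hom CH P' A') (hap (y : @hom CH P P') q)
   = hap f (hap (co_p2 Y : @hom CH P A) q).
  by rewrite -[LHS](@hap_comp k C P P' A') y2 (@hap_comp k C P A A').
by rewrite e1 e2 hs -he.
Qed.
Definition cat1_hom : category_object_hom Y Y' :=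
  @CategoryObjectHom CH Y Y' f f0 cat1_hom_src cat1_hom_tgt cat1_hom_unit
    cat1_hom_comp.
End CatHom.

(** * The equivalence of categories *)

Section Transfer.
Variable k : fieldType.

(** As a coalgebra A is B (x) H, through a |-> r(a) (x) s(a). *)
Lemma splitext_irreducible (B A H : cohopf k) (x : splitext B A H) :
  irreducible B -> irreducible H -> irreducible A.
Proof.
move=> iB iH; pose f : comor A (cprod B H) := cpair (sx_r x) (hom_comor (sx_s x)).
pose j : comor (cprod B H) A :=
  happ (sx_i x) (cp1 B H : pt (cprod B H) B) * happ (sx_e x)
    (cp2 B H : pt (cprod B H) H).
have jf : ccomp j f = comor_id A.
  rewrite /j res_mul -!happ_ccomp cp1_pair cp2_pair.
  have := sx_decomp x (upt A).
  by rewrite /app ccomp_idr [X in happ (sx_e x) X]ccomp_idr.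
apply: (@irreducible_inj k _ _ f).
  have h c : j (f c) = c by rewrite -ccompE jf.
  by move=> a b e; rewrite -[a]h e h.
exact: (tens_irreducible (grouplike1 B) (grouplike1 H)).
Qed.

Lemma splitext_kernel_irreducible (B A H : cohopf k) (x : splitext B A H) :
  irreducible A -> irreducible B.
Proof.
apply: (@irreducible_inj k _ _ (hom_comor (sx_i x))) => a b e.
have ri : ccomp (sx_r x) (hom_comor (sx_i x)) = comor_id B.
  by have := sx_ri x (upt B); rewrite /app [X in ccomp _ X]ccomp_idr.
have h c : sx_r x (hom_comor (sx_i x) c) = c by rewrite -ccompE ri.
by rewrite -[a]h e h.
Qed.

Section ElementsPoints.
Variables (H B H' B' : cohopf k) (a : action H B) (a' : action H' B').
Variables (rho : hopf_hom B B') (sigma : hopf_hom H H').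

(** Compatibility with actions can be checked on elements, as both sides are
coalgebra morphisms on H (x) B. *)
Lemma act_hom_pt :
  (forall h b, rho (act_of a h b) = act_of a' (sigma h) (rho b)) ->
  forall (C : cocoalg k) (h : pt C H) (b : pt C B),
    happ rho (pact a h b) = pact a' (happ sigma h) (happ rho b).
Proof.
move=> ha C h b.
have e : ccomp (hom_comor rho) a =
  ccomp a' (cpair (ccomp (hom_comor sigma) (cp1 H B))
  (ccomp (hom_comor rho) (cp2 H B))).
  by apply: comor_ext => x y; rewrite [RHS]ccompE cpair_tens; exact: ha.
rewrite /happ /pact ccompA e -ccompA cpair_comp; congr (ccomp _ (cpair _ _)).
  by rewrite -ccompA cp1_pair.
by rewrite -ccompA cp2_pair.
Qed.

Lemma act_hom_elt :
  (forall (C : cocoalg k) (h : pt C H) (b : pt C B),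
    happ rho (pact a h b) = pact a' (happ sigma h) (happ rho b)) ->
  forall h b, rho (act_of a h b) = act_of a' (sigma h) (rho b).
Proof.
move=> ha h b.
have := congr1 (fun u : comor _ B' => u (h \ot b)%R) (ha _
  (ccomp (comor_id H) (cp1 H B) : pt (cprod H B) H)
    (ccomp (comor_id B) (cp2 H B))).
by rewrite /happ /pact !ccompA !ccompE !cpair_tens.
Qed.
End ElementsPoints.

Lemma square_elt (A B B' D : cohopf k) (f : hopf_hom B D) (g : hopf_hom A B)
    (f' : hopf_hom B' D) (g' : hopf_hom A B') :
  (forall (C : cocoalg k) (x : pt C A), happ f (happ g x) = happ f' (happ g' x))
    ->
  forall a, f (g a) = f' (g' a).
Proof.
by move=> e a; have /(congr1 (fun u : comor A D => u a)) := e _ (upt A).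
Qed.
End Transfer.

Lemma coh_arr_comp (C : category) (X Y Z : category_object C)
    (g : category_object_hom Y Z) (f : category_object_hom X Y) :
  coh_arr (@comp (category_objects C) X Y Z g f) = coh_arr g \oc coh_arr f.
Proof. exact erefl. Qed.

Lemma coh_obj_comp (C : category) (X Y Z : category_object C)
    (g : category_object_hom Y Z) (f : category_object_hom X Y) :
  coh_obj (@comp (category_objects C) X Y Z g f) = coh_obj g \oc coh_obj f.
Proof. exact erefl. Qed.

Lemma cocomm_compE k (A B D : cohopf k) (g : hopf_hom B D) (f : hopf_hom A B) :
  @comp (cocomm_hopf_algebras k) A B D g f = hopf_comp g f.
Proof. exact erefl. Qed.

Section Equivalence.
Variable k : fieldType.
Local Notation CH := (cocomm_hopf_algebras k).
Local Notation XM := (irr_cocomm_crossed_modules k).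
Local Notation C1 := (irr_cat1_hopf_algebras k).

Definition cat1_val (Y : C1) : category_object CH := sval Y.
Definition arrows (Y : C1) : cohopf k := co_arr (cat1_val Y).
Definition objects (Y : C1) : cohopf k := co_obj (cat1_val Y).
Definition arr_hom (Y Z : C1) (f : hom Y Z) : hopf_hom (arrows Y) (arrows Z) :=
  coh_arr (f : category_object_hom (cat1_val Y) (cat1_val Z)).
Definition obj_hom (Y Z : C1) (f : hom Y Z) : hopf_hom (objects Y) (objects Z) :=
  coh_obj (f : category_object_hom (cat1_val Y) (cat1_val Z)).

Lemma arr_hom_comp (X Y Z : C1) (g : hom Y Z) (f : hom X Y) :
  arr_hom (g \oc f) = hopf_comp (arr_hom g) (arr_hom f).
Proof.
exact (etrans (@coh_arr_comp CH (cat1_val X) (cat1_val Y) (cat1_val Z) g f)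
  (cocomm_compE (arr_hom g) (arr_hom f))).
Qed.
Lemma obj_hom_comp (X Y Z : C1) (g : hom Y Z) (f : hom X Y) :
  obj_hom (g \oc f) = hopf_comp (obj_hom g) (obj_hom f).
Proof.
exact (etrans (@coh_obj_comp CH (cat1_val X) (cat1_val Y) (cat1_val Z) g f)
  (cocomm_compE (obj_hom g) (obj_hom f))).
Qed.
Lemma arr_hom_id (X : C1) : arr_hom (idm X) = hopf_id (arrows X).
Proof. exact (erefl (@idm CH (arrows X))). Qed.
Lemma obj_hom_id (X : C1) : obj_hom (idm X) = hopf_id (objects X).
Proof. exact (erefl (@idm CH (objects X))). Qed.
Lemma c1_homP (Y Z : C1) (f g : hom Y Z) :
  (forall C (q : pt C (arrows Y)), happ (arr_hom f) q = happ (arr_hom g) q) ->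
  obj_hom f = obj_hom g -> f = g.
Proof.
move=> e1 e0; apply: (@category_object_homP CH (cat1_val Y) (cat1_val Z) f g) =>
  //.
exact: hopf_hom_pt e1.
Qed.

Definition xm_val (X : XM) : crossed_module k := sval X.
Lemma xm_top_cocommutative (X : XM) : cocommutative (xm_top (xm_val X)).
Proof. by case: (svalP X). Qed.
Lemma xm_base_cocommutative (X : XM) : cocommutative (xm_base (xm_val X)).
Proof. by case: (svalP X). Qed.
Definition xmod_val (X : XM) : xmod k :=
  xmod_of_crossed_module (@xm_top_cocommutative X) (@xm_base_cocommutative X).
Definition xtop (X Y : XM) (f : hom X Y) :
  hopf_hom (xm_B (xmod_val X)) (xm_B (xmod_val Y)) :=
  xmh_top (f : crossed_module_hom (xm_val X) (xm_val Y)).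
Definition xbase (X Y : XM) (f : hom X Y) :
  hopf_hom (xm_H (xmod_val X)) (xm_H (xmod_val Y)) :=
  xmh_base (f : crossed_module_hom (xm_val X) (xm_val Y)).
Lemma xtop_comp (X Y Z : XM) (g : hom Y Z) (f : hom X Y) :
  xtop (g \oc f) = hopf_comp (xtop g) (xtop f).
Proof. exact (erefl (xmh_top
  (@crossed_module_comp k (xm_val X) (xm_val Y) (xm_val Z) g f))). Qed.
Lemma xbase_comp (X Y Z : XM) (g : hom Y Z) (f : hom X Y) :
  xbase (g \oc f) = hopf_comp (xbase g) (xbase f).
Proof. exact (erefl (xmh_base
  (@crossed_module_comp k (xm_val X) (xm_val Y) (xm_val Z) g f))). Qed.
Lemma xtop_id (X : XM) : xtop (idm X) = hopf_id (xm_B (xmod_val X)).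
Proof. exact (erefl (xmh_top (crossed_module_id (xm_val X)))). Qed.
Lemma xbase_id (X : XM) : xbase (idm X) = hopf_id (xm_H (xmod_val X)).
Proof. exact (erefl (xmh_base (crossed_module_id (xm_val X)))). Qed.
Lemma xm_homP (X Y : XM) (f g : hom X Y) :
  (forall C (b : pt C (xm_B (xmod_val X))), happ (xtop f) b = happ (xtop g) b) ->
  xbase f = xbase g -> f = g.
Proof.
move=> e1 e0; apply: (@crossed_module_homP k (xm_val X) (xm_val Y) f g) => //.
exact: hopf_hom_pt e1.
Qed.

Definition semidirect (X : XM) : cat1_datum k := datum_of_xmod (xmod_val X).
Fact semidirect_irreducible (X : XM) :
  irreducible (cd_A (semidirect X)) /\ irreducible (cd_H (semidirect X)).
Proof.
have iT : irreducible (xm_B (xmod_val X)) by case: (svalP X).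
have iB : irreducible (xm_H (xmod_val X)) by case: (svalP X).
by split=> //; exact: (splitext_irreducible (cd_ext (semidirect X))).
Qed.

Definition semidirect_ob (X : XM) : C1 :=
  exist _ (category_of_datum (semidirect X)) (semidirect_irreducible X).

Lemma semidirect_map X C (b : pt C (xm_B (xmod_val X))) :
  happ (datum_map (semidirect X)) b = happ (xm_g (xmod_val X)) b.
Proof. by rewrite happ_comp; exact: smash_tgt_ker. Qed.

Lemma semidirect_act X C (h : pt C (xm_H (xmod_val X)))
  (b : pt C (xm_B (xmod_val X))) :
  pact (sx_act (cd_ext (semidirect X))) h b = pact (xm_a (xmod_val X)) h b.
Proof. exact: smash_act. Qed.

Lemma xmod_val_actE (X : XM) (h : xm_H (xmod_val X)) (b : xm_B (xmod_val X)) :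
  act_of (xm_a (xmod_val X)) h b = @xm_act k (xm_val X) h b.
Proof. exact: cactE. Qed.

Section Hom.
Variables (X Y : XM) (f : hom X Y).
Let rho : hopf_hom (cd_B (semidirect X)) (cd_B (semidirect Y)) := xtop f.
Let sigma : hopf_hom (cd_H (semidirect X)) (cd_H (semidirect Y)) := xbase f.
Fact semidirect_hom_map (C : cocoalg k) (b : pt C (cd_B (semidirect X))) :
  happ (datum_map (semidirect Y)) (happ rho b) =
    happ sigma (happ (datum_map (semidirect X)) b).
Proof.
by rewrite !semidirect_map; apply: comorP => c;
  exact: (xmh_map (f : crossed_module_hom _ _)).
Qed.
Fact semidirect_hom_act (C : cocoalg k) (h : pt C (cd_H (semidirect X)))
  (b : pt C (cd_B (semidirect X))) :
  happ rho (pact (sx_act (cd_ext (semidirect X))) h b) =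
  pact (sx_act (cd_ext (semidirect Y))) (happ sigma h) (happ rho b).
Proof.
rewrite !semidirect_act; apply: act_hom_pt => x y; rewrite !xmod_val_actE.
exact: (xmh_act (f : crossed_module_hom _ _)).
Qed.
Definition semidirect_arr :
  hopf_hom (cd_A (semidirect X)) (cd_A (semidirect Y)) :=
  lift_hom semidirect_hom_act.
Definition semidirect_hom : hom (semidirect_ob X) (semidirect_ob Y) :=
  @cat1_hom k (category_of_datum (semidirect X))
    (category_of_datum (semidirect Y)) semidirect_arr sigma
    (lift_src semidirect_hom_act)
      (lift_tgt semidirect_hom_map semidirect_hom_act)
      (lift_unit semidirect_hom_act).
Lemma semidirect_carr : arr_hom semidirect_hom =
  semidirect_arr. Proof. exact erefl. Qed.
Lemma semidirect_cobj : obj_hom semidirect_hom = xbase f. Proof. exact erefl. Qed.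
Lemma semidirect_arrE C (q : pt C (cd_A (semidirect X))) : happ semidirect_arr q =
  happ (sx_i (cd_ext (semidirect Y)))
    (happ (xtop f) (app (sx_r (cd_ext (semidirect X))) q)) *
  happ (sx_e (cd_ext (semidirect Y)))
    (happ (xbase f) (happ (sx_s (cd_ext (semidirect X))) q)).
Proof. exact: lift_homE. Qed.
Lemma semidirect_arr_ker C (b : pt C (cd_B (semidirect X))) :
  happ semidirect_arr (happ (sx_i (cd_ext (semidirect X))) b)
  = happ (sx_i (cd_ext (semidirect Y))) (happ (xtop f) b).
Proof. exact: lift_ker. Qed.
End Hom.

Fact semidirect_hom1 (X : XM) : semidirect_hom (idm X) = idm (semidirect_ob X).
Proof.
apply: c1_homP => [C q|]; last by rewrite semidirect_cobj obj_hom_id xbase_id.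
rewrite semidirect_carr arr_hom_id semidirect_arrE xtop_id xbase_id !happ_id.
exact: sx_decomp.
Qed.

Fact semidirect_homM (X Y Z : XM) (g : hom Y Z) (f : hom X Y) :
  semidirect_hom (g \oc f) = semidirect_hom g \oc semidirect_hom f.
Proof.
apply: c1_homP => [C q|];
  last by rewrite obj_hom_comp !semidirect_cobj xbase_comp.
rewrite arr_hom_comp happ_comp !semidirect_carr [LHS]semidirect_arrE
  [RHS]semidirect_arrE semidirect_arrE sx_r_mk sx_s_mk.
by rewrite xtop_comp xbase_comp !happ_comp.
Qed.

Definition semidirect_functor : functor XM C1 :=
  @Functor XM C1 semidirect_ob semidirect_hom semidirect_hom1 semidirect_homM.

Definition kernel (Y : C1) : cat1_datum k := datum_of_category (cat1_val Y).

Fact kernel_irreducible (Y : C1) :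
  [/\ cocommutative (cd_B (kernel Y)), cocommutative (cd_H (kernel Y)),
      irreducible (cd_B (kernel Y)) & irreducible (cd_H (kernel Y))].
Proof.
have [iA iH] := svalP Y.
split.
- exact: (svalP (cd_B (kernel Y))).
- exact: (svalP (cd_H (kernel Y))).
- exact: (splitext_kernel_irreducible (cd_ext (kernel Y))).
- exact: iH.
Qed.

Definition kernel_ob (Y : C1) : XM :=
  exist _ (crossed_module_of_xmod (xmod_of_datum (kernel Y)))
  (kernel_irreducible Y).

Section KernelHom.
Variables (Y Z : C1) (f : hom Y Z).
Let phi : hopf_hom (cd_A (kernel Y)) (cd_A (kernel Z)) := arr_hom f.
Let sigma : hopf_hom (cd_H (kernel Y)) (cd_H (kernel Z)) := obj_hom f.
Local Notation y := (cd_ext (kernel Y)).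
Local Notation z := (cd_ext (kernel Z)).

Fact kernel_hom_src (C : cocoalg k) (q : pt C (cd_A (kernel Y))) :
  happ (sx_s z) (happ phi q) = happ sigma (happ (sx_s y) q).
Proof.
rewrite -[RHS]happ_comp -[LHS]happ_comp.
by rewrite [X in happ X](coh_src
  (f : category_object_hom (cat1_val Y) (cat1_val Z))).
Qed.
Fact kernel_hom_tgt (C : cocoalg k) (q : pt C (cd_A (kernel Y))) :
  happ (cd_tgt (kernel Z)) (happ phi q) = happ sigma (happ (cd_tgt (kernel Y)) q).
Proof.
rewrite -[RHS]happ_comp -[LHS]happ_comp.
by rewrite [X in happ X](coh_tgt
  (f : category_object_hom (cat1_val Y) (cat1_val Z))).
Qed.
Fact kernel_hom_unit (C : cocoalg k) (h : pt C (cd_H (kernel Y))) :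
  happ phi (happ (sx_e y) h) = happ (sx_e z) (happ sigma h).
Proof.
rewrite -[RHS]happ_comp -[LHS]happ_comp.
by rewrite [X in happ X](coh_unit
  (f : category_object_hom (cat1_val Y) (cat1_val Z))).
Qed.

Definition kernel_top : hopf_hom (cd_B (kernel Y)) (cd_B (kernel Z)) :=
  restr_hom kernel_hom_src.
Fact kernel_hom_map b : datum_map (kernel Z) (kernel_top b) =
  sigma (datum_map (kernel Y) b).
Proof.
exact: (square_elt (f := datum_map (kernel Z)) (g := kernel_top)
  (restr_map kernel_hom_src kernel_hom_tgt)).
Qed.
Fact kernel_hom_act h b : kernel_top (act_of (sx_act y) h b) =
  act_of (sx_act z) (sigma h) (kernel_top b).
Proof. exact: (act_hom_elt (restr_act kernel_hom_src kernel_hom_unit)). Qed.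
Definition kernel_hom : hom (kernel_ob Y) (kernel_ob Z) :=
  @CrossedModuleHom k (crossed_module_of_xmod (xmod_of_datum (kernel Y)))
    (crossed_module_of_xmod (xmod_of_datum (kernel Z)))
    kernel_top sigma kernel_hom_map kernel_hom_act.
Lemma kernel_xtop : xtop kernel_hom = kernel_top. Proof. exact erefl. Qed.
Lemma kernel_xbase : xbase kernel_hom = obj_hom f. Proof. exact erefl. Qed.
Lemma kernel_topE C (b : pt C (cd_B (kernel Y))) :
  happ (sx_i z) (happ kernel_top b) = happ (arr_hom f) (happ (sx_i y) b).
Proof. exact: restr_homE. Qed.
End KernelHom.

Fact kernel_hom1 (Y : C1) : kernel_hom (idm Y) = idm (kernel_ob Y).
Proof.
apply: xm_homP => [C b|]; last by rewrite kernel_xbase xbase_id obj_hom_id.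
apply: (sx_i_inj (x := cd_ext (kernel Y))).
by rewrite kernel_xtop xtop_id kernel_topE arr_hom_id !happ_id.
Qed.

Fact kernel_homM (X Y Z : C1) (g : hom Y Z) (f : hom X Y) :
  kernel_hom (g \oc f) = kernel_hom g \oc kernel_hom f.
Proof.
apply: xm_homP => [C b|]; last by rewrite xbase_comp !kernel_xbase obj_hom_comp.
apply: (sx_i_inj (x := cd_ext (kernel Z))).
rewrite xtop_comp !kernel_xtop happ_comp.
by rewrite !kernel_topE arr_hom_comp happ_comp.
Qed.

Definition kernel_functor : functor C1 XM :=
  @Functor C1 XM kernel_ob kernel_hom kernel_hom1 kernel_homM.

(** The kernel of the source of the semidirect product is B. Both isomorphisms are
restrictions of the identity of the semidirect product. *)
Section UnitIso.
Variable X : XM.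
Let g := semidirect X.
Let g1 := kernel (semidirect_functor X).
Let phi : hopf_hom (cd_A g1) (cd_A g) := hopf_id _.
Let phi' : hopf_hom (cd_A g) (cd_A g1) := hopf_id _.
Let sigma : hopf_hom (cd_H g1) (cd_H g) := hopf_id _.
Let sigma' : hopf_hom (cd_H g) (cd_H g1) := hopf_id _.

Let hs (C : cocoalg k) (q : pt C (cd_A g1)) :
  happ (sx_s (cd_ext g)) (happ phi q) = happ sigma (happ (sx_s (cd_ext g1)) q).
Proof. exact: comorP. Qed.
Let ht (C : cocoalg k) (q : pt C (cd_A g1)) :
  happ (cd_tgt g) (happ phi q) = happ sigma (happ (cd_tgt g1) q).
Proof. exact: comorP. Qed.
Let he (C : cocoalg k) (h : pt C (cd_H g1)) :
  happ phi (happ (sx_e (cd_ext g1)) h) = happ (sx_e (cd_ext g)) (happ sigma h).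
Proof. exact: comorP. Qed.
Let hs' (C : cocoalg k) (q : pt C (cd_A g)) :
  happ (sx_s (cd_ext g1)) (happ phi' q) = happ sigma' (happ (sx_s (cd_ext g)) q).
Proof. exact: comorP. Qed.
Let ht' (C : cocoalg k) (q : pt C (cd_A g)) :
  happ (cd_tgt g1) (happ phi' q) = happ sigma' (happ (cd_tgt g) q).
Proof. exact: comorP. Qed.
Let he' (C : cocoalg k) (h : pt C (cd_H g)) :
  happ phi' (happ (sx_e (cd_ext g)) h) = happ (sx_e (cd_ext g1)) (happ sigma' h).
Proof. exact: comorP. Qed.

Definition unit_top : hopf_hom (cd_B g1) (cd_B g) := restr_hom hs.
Definition unit_inv_top : hopf_hom (cd_B g) (cd_B g1) := restr_hom hs'.

Lemma unit_topE C (b : pt C (cd_B g1)) :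
  happ (sx_i (cd_ext g)) (happ unit_top b) = happ (sx_i (cd_ext g1)) b.
Proof. by rewrite restr_homE happ_id. Qed.
Lemma unit_inv_topE C (b : pt C (cd_B g)) :
  happ (sx_i (cd_ext g1)) (happ unit_inv_top b) = happ (sx_i (cd_ext g)) b.
Proof. by rewrite restr_homE happ_id. Qed.

Fact unit_map b : xm_g (xmod_val X) (unit_top b) = sigma (datum_map g1 b).
Proof.
apply: (@square_elt k (cd_B g1) (cd_B g) (cd_H g1) (cd_H g)) => C c.
by rewrite -semidirect_map; exact: (restr_map hs ht).
Qed.
Fact unit_act h b :
  unit_top (act_of (sx_act (cd_ext g1)) h b)
  = act_of (xm_a (xmod_val X)) (sigma h) (unit_top b).
Proof.
apply: act_hom_elt => C h' b'; rewrite -semidirect_act.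
exact: (restr_act hs he).
Qed.
Fact unit_inv_map b : datum_map g1 (unit_inv_top b) =
  sigma' (xm_g (xmod_val X) b).
Proof.
apply: (@square_elt k (cd_B g) (cd_B g1) (cd_H g) (cd_H g1)) => C c.
by rewrite -semidirect_map; exact: (restr_map hs' ht').
Qed.
Fact unit_inv_act h b :
  unit_inv_top (act_of (xm_a (xmod_val X)) h b)
  = act_of (sx_act (cd_ext g1)) (sigma' h) (unit_inv_top b).
Proof.
apply: act_hom_elt => C h' b'; rewrite -semidirect_act.
exact: (restr_act hs' he').
Qed.

Fact unit_act' h b :
  unit_top (act_of (sx_act (cd_ext g1)) h b) =
    @xm_act k (xm_val X) (sigma h) (unit_top b).
Proof. exact (etrans (unit_act h b) (@xmod_val_actE X (sigma h) (unit_top b))).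
  Qed.
Fact unit_inv_act' h b :
  unit_inv_top (@xm_act k (xm_val X) h b)
  = act_of (sx_act (cd_ext g1)) (sigma' h) (unit_inv_top b).
Proof.
exact (etrans (congr1 unit_inv_top (esym (@xmod_val_actE X h b)))
  (unit_inv_act h b)).
Qed.

Definition unit_hom : hom (functor_comp kernel_functor semidirect_functor X) X :=
  @CrossedModuleHom k (crossed_module_of_xmod (xmod_of_datum g1)) (xm_val X)
    unit_top sigma
    unit_map unit_act'.
Definition unit_inv : hom X (functor_comp kernel_functor semidirect_functor X) :=
  @CrossedModuleHom k (xm_val X) (crossed_module_of_xmod (xmod_of_datum g1))
    unit_inv_top sigma'
    unit_inv_map unit_inv_act'.
End UnitIso.

Lemma unit_xtop (X : XM) : xtop (unit_hom X) = @unit_top X.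
Proof. exact erefl. Qed.
Lemma unit_inv_xtop (X : XM) : xtop (unit_inv X) = @unit_inv_top X.
Proof. exact erefl. Qed.

Lemma unit_iso : naturally_isomorphic
  (functor_comp kernel_functor semidirect_functor) (functor_id XM).
Proof.
exists unit_hom, unit_inv; split.
- move=> X Y f; apply: xm_homP => [C b|]; last first.
    by rewrite !xbase_comp; exact: hopf_homP.
  apply: (sx_i_inj (x := cd_ext (semidirect Y))).
  rewrite !xtop_comp !unit_xtop !happ_comp unit_topE kernel_xtop kernel_topE
    semidirect_carr.
  by rewrite -semidirect_arr_ker unit_topE.
- move=> X; apply: xm_homP => [C b|]; last first.
    by rewrite !xbase_comp; exact: hopf_homP.
  apply: (sx_i_inj (x := cd_ext (kernel (semidirect_functor X)))).
  by rewrite xtop_comp unit_xtop unit_inv_xtop happ_comp unit_inv_topE unit_topE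
    xtop_id happ_id.
- move=> X; apply: xm_homP => [C b|]; last first.
    by rewrite !xbase_comp; exact: hopf_homP.
  apply: (sx_i_inj (x := cd_ext (semidirect X))).
  by rewrite xtop_comp unit_xtop unit_inv_xtop happ_comp unit_topE unit_inv_topE
    xtop_id happ_id.
Qed.

(** By a = i(r a) e(s a) the semidirect product of the kernel of s by H is A. Both
isomorphisms extend the identities of the kernel and of H. *)
Section CounitIso.
Variable Y : C1.
Let g := kernel Y.
Let g1 := semidirect (kernel_functor Y).
Let rho : hopf_hom (cd_B g1) (cd_B g) := hopf_id _.
Let rho' : hopf_hom (cd_B g) (cd_B g1) := hopf_id _.
Let sigma : hopf_hom (cd_H g1) (cd_H g) := hopf_id _.
Let sigma' : hopf_hom (cd_H g) (cd_H g1) := hopf_id _.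

Let hmap (C : cocoalg k) (b : pt C (cd_B g1)) :
  happ (datum_map g) (happ rho b) = happ sigma (happ (datum_map g1) b).
Proof. by rewrite semidirect_map; apply: comorP. Qed.
Let hact (C : cocoalg k) (h : pt C (cd_H g1)) (b : pt C (cd_B g1)) :
  happ rho (pact (sx_act (cd_ext g1)) h b)
  = pact (sx_act (cd_ext g)) (happ sigma h) (happ rho b).
Proof. by rewrite semidirect_act; apply: act_hom_pt => x y;
  rewrite xmod_val_actE. Qed.
Let hmap' (C : cocoalg k) (b : pt C (cd_B g)) :
  happ (datum_map g1) (happ rho' b) = happ sigma' (happ (datum_map g) b).
Proof. by rewrite semidirect_map; apply: comorP. Qed.
Let hact' (C : cocoalg k) (h : pt C (cd_H g)) (b : pt C (cd_B g)) :
  happ rho' (pact (sx_act (cd_ext g)) h b)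
  = pact (sx_act (cd_ext g1)) (happ sigma' h) (happ rho' b).
Proof. by rewrite semidirect_act; apply: act_hom_pt => x y;
  rewrite xmod_val_actE. Qed.

Definition counit_arr : hopf_hom (cd_A g1) (cd_A g) := lift_hom hact.
Definition counit_inv_arr : hopf_hom (cd_A g) (cd_A g1) := lift_hom hact'.

Definition counit_hom :
  hom (functor_comp semidirect_functor kernel_functor Y) Y :=
  @cat1_hom k (category_of_datum g1) (cat1_val Y) counit_arr sigma
    (lift_src hact) (lift_tgt hmap hact) (lift_unit hact).
Definition counit_inv :
  hom Y (functor_comp semidirect_functor kernel_functor Y) :=
  @cat1_hom k (cat1_val Y) (category_of_datum g1) counit_inv_arr sigma'
    (lift_src hact') (lift_tgt hmap' hact') (lift_unit hact').

Lemma counit_arrE C (q : pt C (cd_A g1)) : happ counit_arr q =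
  happ (sx_i (cd_ext g)) (app (sx_r (cd_ext g1)) q : pt C (cd_B g))
  * happ (sx_e (cd_ext g)) (happ (sx_s (cd_ext g1)) q : pt C (cd_H g)).
Proof.
rewrite lift_homE; congr (_ * _); apply: (congr1 (@happ k C _ _ _));
  exact: comorP.
Qed.
Lemma counit_inv_arrE C (q : pt C (cd_A g)) : happ counit_inv_arr q =
  happ (sx_i (cd_ext g1)) (app (sx_r (cd_ext g)) q : pt C (cd_B g1))
  * happ (sx_e (cd_ext g1)) (happ (sx_s (cd_ext g)) q : pt C (cd_H g1)).
Proof.
rewrite lift_homE; congr (_ * _); apply: (congr1 (@happ k C _ _ _));
  exact: comorP.
Qed.
End CounitIso.

Lemma counit_arr_hom (Y : C1) : arr_hom (counit_hom Y) = counit_arr Y.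
Proof. exact erefl. Qed.
Lemma counit_inv_arr_hom (Y : C1) : arr_hom (counit_inv Y) = counit_inv_arr Y.
Proof. exact erefl. Qed.

Lemma counit_iso : naturally_isomorphic
  (functor_comp semidirect_functor kernel_functor) (functor_id C1).
Proof.
exists counit_hom, counit_inv; split.
- move=> Y Z f; apply: c1_homP => [C q|]; last first.
    by rewrite !obj_hom_comp; exact: hopf_homP.
  rewrite !arr_hom_comp !counit_arr_hom !happ_comp !counit_arrE semidirect_carr
    semidirect_arrE.
  rewrite sx_r_mk sx_s_mk happM kernel_xtop kernel_xbase; congr (_ * _).
    exact: kernel_topE.
  exact: esym (kernel_hom_unit f _).
- move=> Y; apply: c1_homP => [C q|]; last first.
    by rewrite !obj_hom_comp; exact: hopf_homP.
  rewrite arr_hom_comp counit_arr_hom counit_inv_arr_hom happ_comp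
    counit_inv_arrE counit_arrE.
  by rewrite sx_r_mk sx_s_mk arr_hom_id happ_id sx_decomp.
- move=> Y; apply: c1_homP => [C q|]; last first.
    by rewrite obj_hom_comp obj_hom_id; exact: hopf_homP.
  rewrite arr_hom_comp counit_arr_hom counit_inv_arr_hom happ_comp counit_arrE
    counit_inv_arrE.
  by rewrite sx_r_mk sx_s_mk arr_hom_id happ_id sx_decomp.
Qed.

End Equivalence.

Theorem corollary3 (k : fieldType) (hk : [pchar k] =i pred0) :
  equivalent_categories (irr_cocomm_crossed_modules k) (irr_cat1_hopf_algebras k).
Proof.
by exists (semidirect_functor k), (kernel_functor k); split;
  [exact: unit_iso | exact: counit_iso].
Qed.
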